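(* Let $(b(u),\,0\le u\leq 1)$ be a standard Brownian bridge, $(\lambda_u^x,\ 0\le u\leq 1,\ x\in\mathbb{R})$ its family of local times, and $U$ a uniform random variable on $[0,1]$ independent of $b$. Then: (1) The variable $\lambda_1^0$ admits a density on $[0,\infty)$, whose value at $l\geq 0$ is $l\exp(-l^2/2)$. Hence $\lambda_1^0$ has the same law as $\sqrt{2\mathcal{E}}$ with $\mathcal{E}$ a standard exponential random variable, i.e. $\lambda_1^0$ is Rayleigh distributed. (2) The density of $b(U)$ at point $y\in\mathbb{R}$ given $\lambda_1^0=l$ is $$\mathbb{E}[\lambda_1^y\,|\,\lambda_1^0=l]=(2|y|+l)\exp\big(-(2y^2+2|y|l)\big).$$ Consequently, for $y\in\mathbb{R}$, $$\mathbb{E}\Big[\frac{\lambda_1^y}{\lambda_1^0}\Big]=\exp(-2y^2).$$ (3) The density of $b(U)$ at point $y\in\mathbb{R}$ is $$\mathbb{E}[\lambda_1^y]=\int_{2|y|}^{+\infty}\exp(-z^2/2)\,dz.$$ Thus $b(U)$ has the same law as $\sqrt{2\mathcal{E}}\,(V/2)$, with $\mathcal{E}$ a standard exponential variable independent of $V$, which is uniformly distributed on $[-1,1]$.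
   Context: The Brownian bridge is the standard one from $0$ to $0$ on $[0,1]$. Local times are normalized as occupation densities with respect to Lebesgue measure (jointly continuous version): $\int_0^u \phi(b(s))\,ds=\int_{\mathbb{R}}\phi(x)\lambda_u^x\,dx$ for non-negative measurable $\phi$. ''Standard exponential'' means exponential with mean $1$. Conditional densities and expectations given $\lambda_1^0=l$ are understood in the usual sense of versions (defined for almost every $l$ with respect to the law of $\lambda_1^0$). *)

(* Defs.v *)
From HB Require Import structures.
From mathcomp Require Import all_boot all_order all_algebra.
From mathcomp Require Import all_classical all_reals all_analysis.
From mathcomp Require Import measurable_realfun.

Set Implicit Arguments.
Unset Strict Implicit.
Unset Printing Implicit Defensive.

Import Order.TTheory GRing.Theory Num.Theory.
Import numFieldNormedType.Exports.

Local Open Scope classical_set_scope.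
Local Open Scope ring_scope.

(* Two laws are compared on measurable sets only: a measure is a total
   function on [set T], with unspecified values outside the sigma-algebra. *)
Definition same_law (R : realType) (d d' : measure_display)
    (T : measurableType d) (T' : measurableType d')
    (P : probability T R) (X : T -> R) (P' : probability T' R) (X' : T' -> R) :=
  [/\ measurable_fun setT X, measurable_fun setT X' &
      forall A : set R, measurable A -> P (X @^-1` A) = P' (X' @^-1` A)].

Definition has_density (R : realType) (d : measure_display)
    (T : measurableType d) (P : probability T R) (X : T -> R)
    (f : R -> \bar R) :=
  [/\ measurable_fun setT X, measurable_fun [set: R] f, (forall x, 0 <= f x)%E &
      forall A : set R, measurable A ->
        P (X @^-1` A) = (\int[lebesgue_measure]_(x in A) f x)%E].

(* [h l] is a version of E[X | Z = l]. *)
Definition is_cond_expectation (R : realType) (d : measure_display)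
    (T : measurableType d) (P : probability T R) (X Z : {RV P >-> R})
    (h : R -> R) :=
  [/\ P.-integrable setT (EFin \o X),
      (distribution P Z).-integrable setT (EFin \o h) &
      forall B : set R, measurable B ->
        (\int[P]_(w in Z @^-1` B) (X w)%:E =
         \int[distribution P Z]_(l in B) (h l)%:E)%E].

(* [g l y] is a version of the density of [Y] at [y] given [Z = l]; that
   [g l] has total mass 1 for almost every [l] is the case [A = setT]. *)
Definition has_cond_density (R : realType) (d : measure_display)
    (T : measurableType d) (P : probability T R) (Y : T -> R)
    (Z : {RV P >-> R}) (g : R -> R -> R) :=
  [/\ measurable_fun setT Y,
      measurable_fun [set: R * R] (fun p : R * R => g p.1 p.2),
      {ae distribution P Z, forall l, forall y, 0 <= g l y} &
      forall A B : set R, measurable A -> measurable B ->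
        P (Y @^-1` A `&` Z @^-1` B) =
        (\int[distribution P Z]_(l in B)
           \int[lebesgue_measure]_(y in A) (g l y)%:E)%E].

Definition sigma_rv (d d' : measure_display) (T : measurableType d)
    (T' : measurableType d') (X : T -> T') : set (set T) :=
  preimage_set_system setT X measurable.

Definition sigma_process (R : realType) (d : measure_display)
    (T : measurableType d) (I : set R) (b : R -> T -> R) : set (set T) :=
  <<s \bigcup_(t in I) sigma_rv (b t) >>.

Definition independent (R : realType) (d : measure_display)
    (T : measurableType d) (P : probability T R) (F G : set (set T)) :=
  forall A B : set T, F A -> G B -> P (A `&` B) = (P A * P B)%E.

(* [normal_prob m 0] is not the point mass at [m] in the library. *)
Definition gaussian_law (R : realType) (m s : R) : set R -> \bar R :=
  if s == 0 then \d_m else normal_prob m s.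

Definition is_gaussian (R : realType) (d : measure_display)
    (T : measurableType d) (P : probability T R) (X : T -> R) :=
  exists m s : R, 0 <= s /\
    forall A : set R, measurable A -> P (X @^-1` A) = gaussian_law m s A.

Definition gaussian_process (R : realType) (d : measure_display)
    (T : measurableType d) (P : probability T R) (I : set R)
    (b : R -> {RV P >-> R}) :=
  forall (n : nat) (c t : 'I_n -> R), (forall i, I (t i)) ->
    is_gaussian P (fun w => \sum_(i < n) c i * b (t i) w).

(* The values [b t] for [t] outside [0, 1] are irrelevant. The covariance
   gives [b 0] and [b 1] variance 0, so both vanish almost surely. *)
Definition brownian_bridge (R : realType) (d : measure_display)
    (T : measurableType d) (P : probability T R) (b : R -> {RV P >-> R}) :=
  [/\ gaussian_process `[0, 1] b,
      (forall t : R, t \in `[0, 1] -> ('E_P[b t] = 0)%E),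
      (forall s t : R, s \in `[0, 1] -> t \in `[0, 1] ->
         covariance P (b s) (b t) = (Num.min s t - s * t)%:E) &
      forall w, {within `[0, 1], continuous (fun t : R => b t w)}].

(* [lam u x] is the local time at level [x] up to time [u]. *)
Definition local_times (R : realType) (d : measure_display)
    (T : measurableType d) (P : probability T R) (b : R -> {RV P >-> R})
    (lam : R -> R -> {RV P >-> R}) :=
  {ae P, forall w,
    {within [set p : R * R | p.1 \in `[0, 1]],
       continuous (fun p : R * R => lam p.1 p.2 w)} /\
    forall u : R, u \in `[0, 1] ->
    forall phi : R -> R, measurable_fun [set: R] phi -> (forall x, 0 <= phi x) ->
      (\int[lebesgue_measure]_(s in `[0%R, u]) (phi (b s w))%:E =
       \int[lebesgue_measure]_x (phi x * lam u x w)%R%:E)%E}.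

Definition rayleigh_pdf (R : realType) : R -> R :=
  (fun l : R => l * expR (- (l ^+ 2) / 2)) \_ `[0, +oo[.

(* Main.v *)
Require Import Defs.
From HB Require Import structures.
From mathcomp Require Import all_boot all_order all_algebra.
From mathcomp Require Import all_classical all_reals all_analysis.
From mathcomp Require Import measurable_realfun ring lra.

(* Let [heat t x] be the heat kernel and [iheat n t z] its [n]-th iterated tail
   integral. The bridge has density [sqrt (2 pi) heat s x * heat (1 - s) x] at
   time [s]. If a functional [V_s] of the past satisfies
   [E[V_s; b_s in dx] = sqrt (2 pi) heat (1 - s) x * F s x dx], the Markov property
   gives the corresponding function for [int_0^t V_s f(b_s) ds] as a space-time
   convolution, and when [f] is a thin tent around [p], the first passage
   decomposition of the heat kernel turns [iheat m] at distance [d] into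
   [iheat (m + 1)] at distance [d + |x - p|], up to the width of the tent.
   Applied to powers of the occupation time of a tent at [0] times the occupation
   time of a tent at [y], and letting the tents shrink, this yields
   [E[lam^y (lam^0)^n] = sqrt (2 pi) (n + 1)! iheat (n + 1) 1 (2|y|)].
   These moments are determinate, so
   [E[lam^y; lam^0 in dl] = l (2|y| + l) exp (- (2|y| + l)^2 / 2) dl],
   and the theorem follows by integrating over [y] with the occupation formula. *)

Set Implicit Arguments.
Unset Strict Implicit.
Unset Printing Implicit Defensive.

Import Order.TTheory GRing.Theory Num.Theory.
Import numFieldNormedType.Exports.

Local Open Scope classical_set_scope.
Local Open Scope ereal_scope.
Local Open Scope ring_scope.

(** Convolving in time with [heat (t - s) x] only sees the total distance travelled between
    successive visits, because [l / s * heat s l] is a first passage density. The bridge starts and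
    ends at [0], so each of the [(n + 1)!] time orderings of [n] visits to [0] and one visit to [y]
    travels the distance [2|y|]: this is the origin of the factorial and of the argument of [iheat].
    Tents of half-width [eps] determine these distances only up to a multiple of [eps], so
    identities become pairs of bounds, brought together at the end by a Lipschitz estimate on
    [iheat n.+1]. The given local times need not be functions of the path, whereas the Markov
    property concerns functionals of the past. It is therefore proved for time integrals of
    functions of the path, starting from the Gaussian laws of linear combinations. Independence is
    tested on functions [1 + cos], which are non-negative, so that Tonelli applies to extended-real
    integrals without integrability conditions. *)

Definition pack_mfun d d' (S : sigmaRingType d) (S' : sigmaRingType d')
    (f : S -> S') (mf : measurable_fun setT f) : {mfun S >-> S'} :=
  HB.pack f (isMeasurableFun.Build _ _ _ _ _ mf).

(** * Image measures, affine substitution and Tonelli on subdomains *)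

Section image_measure.
Context d d' (T : measurableType d) (T' : measurableType d') (R : realType).
Variables (m : {measure set T -> \bar R}) (X : {mfun T >-> T'}).

Definition image_measure := pushforward m X.

Let image_measure0 : image_measure set0 = 0%E.
Proof. exact: measure0. Qed.

Let image_measure_ge0 A : (0 <= image_measure A)%E.
Proof. exact: measure_ge0. Qed.

Let image_measure_sigma_additive : semi_sigma_additive image_measure.
Proof. exact: measure_semi_sigma_additive. Qed.

HB.instance Definition _ := isMeasure.Build _ _ _ image_measure
  image_measure0 image_measure_ge0 image_measure_sigma_additive.

Lemma ge0_integral_image_measure (f : T' -> \bar R) :
  measurable_fun setT f -> (forall y, (0 <= f y)%E) ->
  (\int[image_measure]_y f y = \int[m]_x f (X x))%E.
Proof. by move=> mf f0; rewrite ge0_integral_pushforward. Qed.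

End image_measure.

Section affine_change_of_variable.
Context {R : realType}.
Notation mu := (@lebesgue_measure R).

Definition affine (a c x : R) : R := a * x + c.

Lemma measurable_affine (a c : R) : measurable_fun setT (affine a c).
Proof.
by apply: measurable_funD => //; apply: measurable_funM => //.
Qed.

(** The image of Lebesgue measure under the affine map, multiplied by [a], has the right value on
    half-open intervals and is therefore Lebesgue measure. *)
Lemma ge0_integral_affine (a c : R) (f : R -> \bar R) : 0 < a ->
  measurable_fun setT f -> (forall x, (0 <= f x)%E) ->
  (\int[mu]_x f (affine a c x) = a^-1%:E * \int[mu]_x f x)%E.
Proof.
move=> a0 mf f0.
have ma := measurable_affine a c.
have a10 : 0 <= a^-1 by rewrite invr_ge0 ltW.
pose phi : {mfun measurableTypeR R >-> measurableTypeR R} :=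
  @pack_mfun _ _ (measurableTypeR R) (measurableTypeR R) _ ma.
pose nu : measure _ R := mscale (NngNum (ltW a0)) (image_measure mu phi).
have E (A : set (measurableTypeR R)) : measurable A -> mu A = nu A.
  move=> mA; apply: lebesgue_measure_unique => //= _ [[x y]] _ <-.
  rewrite /nu /mscale/= /image_measure /pushforward/=.
  have -> : affine a c @^-1` `]x, y] = `](x - c) / a, (y - c) / a]%classic.
    apply/seteqP; split => z /=; rewrite /affine !in_itv/= ltr_pdivrMr// ler_pdivlMr// ltrBlDr lerBrDr mulrC//.
  rewrite !lebesgue_measure_itv/= !lte_fin ltr_pM2r ?invr_gt0// ltrD2r.
  case: ifPn => xy; last by rewrite mule0.
  by rewrite -!EFinB -EFinM; congr EFin; field; rewrite gt_eqF.
have -> : (\int[mu]_x f x = \int[nu]_x f x)%E.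
  apply: eq_measure_integral => //= A mA _.
  exact: E.
rewrite /nu ge0_integral_mscale//= ge0_integral_image_measure//= muleA -EFinM mulVf ?gt_eqF// mul1e.
by [].
Qed.

Lemma ge0_integral_shift (c : R) (f : R -> \bar R) :
  measurable_fun setT f -> (forall x, (0 <= f x)%E) ->
  (\int[mu]_x f (x + c)%R = \int[mu]_x f x)%E.
Proof.
move=> mf f0; have := @ge0_integral_affine 1 c f ltr01 mf f0.
by rewrite invr1 mul1e => <-; apply: eq_integral => x _; rewrite /affine mul1r.
Qed.

Lemma ge0_integral_oppr (f : R -> \bar R) :
  measurable_fun setT f -> (forall x, (0 <= f x)%E) ->
  (\int[mu]_x f (- x)%R = \int[mu]_x f x)%E.
Proof.
move=> mf f0.
rewrite -[RHS](_ : (\int[pushforward mu (-%R : measurableTypeR R -> measurableTypeR R)]_x f x = _)%E).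
  by rewrite ge0_integral_pushforward.
by apply: eq_measure_integral => //= A mA _; exact: lebesgue_measureN.
Qed.

End affine_change_of_variable.

Section tonelli.
Context d1 d2 (T1 : measurableType d1) (T2 : measurableType d2) (R : realType).
Variables (m1 : {sigma_finite_measure set T1 -> \bar R}).
Variables (m2 : {sigma_finite_measure set T2 -> \bar R}).
Variable f : T1 -> T2 -> \bar R.
Hypothesis mf : measurable_fun setT (fun p : T1 * T2 => f p.1 p.2).
Hypothesis f0 : forall x y, (0 <= f x y)%E.

Lemma measurable_fun_patch_right (D : set T2) : measurable D ->
  measurable_fun setT (fun p : T1 * T2 => ((f p.1) \_ D) p.2).
Proof.
move=> mD.
rewrite (_ : (fun _ => _) = (fun p : T1 * T2 => f p.1 p.2) \_ (setT `*` D)).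
  apply/(measurable_restrictT _ _).1 => //; first exact: measurableX.
  exact: measurable_funTS.
by apply/funext => -[x y]; rewrite !patchE/= in_setX/= in_setT.
Qed.

Lemma measurable_integral_right (D : set T2) : measurable D ->
  measurable_fun setT (fun x => \int[m2]_(y in D) f x y)%E.
Proof.
move=> mD; under eq_fun do rewrite integral_mkcond.
apply: (measurable_fun_fubini_tonelli_F (m2 := m2)
  (fun p => ((f p.1) \_ D) p.2)).
  exact: measurable_fun_patch_right.
by move=> p; apply: erestrict_ge0.
Qed.

End tonelli.

Section tonelli_domains.
Context d1 d2 (T1 : measurableType d1) (T2 : measurableType d2) (R : realType).
Variables (m1 : {sigma_finite_measure set T1 -> \bar R}).
Variables (m2 : {sigma_finite_measure set T2 -> \bar R}).
Variable f : T1 -> T2 -> \bar R.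
Hypothesis mf : measurable_fun setT (fun p : T1 * T2 => f p.1 p.2).
Hypothesis f0 : forall x y, (0 <= f x y)%E.

Lemma measurable_integral_left (D : set T1) : measurable D ->
  measurable_fun setT (fun y => \int[m1]_(x in D) f x y)%E.
Proof.
move=> mD; apply: (measurable_integral_right m1 (f := fun y x => f x y)) => //.
rewrite (_ : (fun _ => _) = (fun p => f p.1 p.2) \o (fun p : T2 * T1 => (p.2, p.1)))//.
by apply: measurableT_comp => //; exact: measurable_fun_pair.
Qed.

(** The indicators of both domains are absorbed into the integrand, and Tonelli is used on the whole
    product. *)
Lemma tonelli_domains (D1 : set T1) (D2 : set T2) : measurable D1 -> measurable D2 ->
  (\int[m1]_(x in D1) \int[m2]_(y in D2) f x y =
   \int[m2]_(y in D2) \int[m1]_(x in D1) f x y)%E.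
Proof.
move=> mD1 mD2; rewrite [LHS]integral_mkcond [RHS]integral_mkcond.
pose g (p : T1 * T2) := (((f p.1) \_ D2) p.2 * (\1_D1 p.1)%:E)%E.
have mg : measurable_fun setT g.
  apply: emeasurable_funM; first exact: measurable_fun_patch_right.
  by apply/measurable_EFinP; apply: measurableT_comp => //; exact: measurable_indic.
have g0 p : (0 <= g p)%E by rewrite mule_ge0 ?lee_fin//; exact: erestrict_ge0.
transitivity (\int[m1]_x \int[m2]_y g (x, y))%E.
  apply: eq_integral => x _; rewrite patchE /g/= indicE.
  case: ifPn => xD /=; last by under [RHS]eq_integral do rewrite mule0; rewrite integral0.
  by rewrite integral_mkcond; apply: eq_integral => y _; rewrite mule1.
rewrite fubini_tonelli//; apply: eq_integral => y _; rewrite patchE /g/=.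
case: ifPn => yD; last first.
  by apply: integral0_eq => x _; rewrite patchE (negbTE yD) mul0e.
rewrite [RHS]integral_mkcond; apply: eq_integral => x _; rewrite !patchE yD indicE.
by case: ifPn; rewrite ?mule1 ?mule0.
Qed.

End tonelli_domains.

Lemma is_derive_cvg (R : realType) (f : R -> R) (x a : R) :
  is_derive x 1 f a -> f z @[z --> x] --> f x.
Proof.
by case=> + _ => /derivable1_diffP/differentiable_continuous.
Qed.

(** * Heat kernel and iterated tails *)
Section heat_kernel.
Context {R : realType}.
Notation mu := (@lebesgue_measure R).
Implicit Types (t x y z l : R).

Definition heat t x : R := (Num.sqrt (2 * pi * t))^-1 * expR (- (x ^+ 2) / (2 * t)).

Lemma heat_ge0 t x : 0 <= heat t x.
Proof. by rewrite mulr_ge0 ?invr_ge0 ?expR_ge0. Qed.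

Lemma heatN t x : heat t (- x) = heat t x.
Proof. by rewrite /heat sqrrN. Qed.

Lemma heat_norm t x : heat t `|x| = heat t x.
Proof. by rewrite /heat real_normK ?num_real. Qed.

Lemma heat_le t x : 0 <= t -> heat t x <= heat t 0.
Proof.
move=> t0; rewrite /heat ler_wpM2l ?invr_ge0// ler_expR expr0n/= oppr0 mul0r.
by rewrite mulNr oppr_le0 divr_ge0 ?sqr_ge0// mulr_ge0.
Qed.

Lemma heat_normal_pdf m s x : s != 0 -> normal_pdf m s x = heat (s ^+ 2) (x - m).
Proof.
move=> s0; rewrite normal_pdfE// /heat /normal_peak /normal_fun.
by congr (_^-1 * expR _); [congr Num.sqrt|congr (_ / _)]; rewrite -mulr_natl; ring.
Qed.

Lemma normal_prob_heat m s A : s != 0 ->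
  normal_prob m s A = (\int[mu]_(x in A) (heat (s ^+ 2) (x - m))%:E)%E.
Proof.
by move=> s0; apply: eq_integral => x _; rewrite heat_normal_pdf.
Qed.

Lemma integral_heat t z : 0 < t -> (\int[mu]_x (heat t (x - z))%:E = 1)%E.
Proof.
move=> t0; rewrite -(integral_normal_pdf z (Num.sqrt t)); apply: eq_integral => x _.
by rewrite heat_normal_pdf ?sqr_sqrtr ?(ltW t0)// gt_eqF// sqrtr_gt0.
Qed.

Lemma measurable_invr : measurable_fun setT (fun x : R => x^-1).
Proof.
have -> : [set: R] = [set 0] `|` ~` [set 0] by rewrite setUv.
apply/measurable_funU => //; first exact: measurableC.
split; first exact: measurable_fun_set1.
apply: open_continuous_measurable_fun.
  by rewrite openC; exact: closed_eq.
by move=> x; rewrite inE/= => /eqP x0; apply: inv_continuous.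
Qed.

Lemma measurable_sqrtr : measurable_fun setT (Num.sqrt : R -> R).
Proof. by apply: continuous_measurable_fun; exact: sqrt_continuous. Qed.

Lemma measurable_heat2 d (T : measurableType d) (f g : T -> R) :
  measurable_fun setT f -> measurable_fun setT g ->
  measurable_fun setT (fun w : T => heat (f w) (g w)).
Proof.
move=> mf mg; apply: measurable_funM.
  apply: (measurableT_comp measurable_invr); apply: (measurableT_comp measurable_sqrtr).
  by apply: measurable_funM.
apply: measurableT_comp => //; apply: measurable_funM.
  by apply: measurableT_comp => //; apply: measurable_funX.
by apply: (measurableT_comp measurable_invr); apply: measurable_funM.
Qed.

Lemma is_derive_heat t x : t != 0 -> is_derive x 1 (heat t) (- (x / t) * heat t x).
Proof.
move=> t0; 

have h1 : is_derive x 1 (fun y : R => (- (2 * t)^-1) * y ^+ 2) (- (x / t)).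
  have h := is_deriveZ (- (2 * t)^-1) (is_deriveX 2 (is_derive_id x 1)).
  by apply: (is_derive_eq h); rewrite /GRing.scale/= expr1; field.
have h2 := is_derive1_comp (is_derive_expR _) h1.
have h3 := is_deriveZ (Num.sqrt (2 * pi * t))^-1 h2.
have -> : heat t = (Num.sqrt (2 * pi * t))^-1 \*: (expR \o (fun y : R => (- (2 * t)^-1) * y ^+ 2)).
  by apply/funext => y; rewrite /heat mulNr [y ^+ 2 / _]mulrC /= mulNr.
by apply: (is_derive_eq h3); rewrite /GRing.scale/= /GRing.scale/=; ring.
Qed.

Lemma continuous_heat t : t != 0 -> continuous (heat t).
Proof.
move=> t0 x; apply/differentiable_continuous/derivable1_diffP.
by have [] := is_derive_heat x t0.
Qed.


(** Completing the square gives [x - x ^ 2 / (2 t) <= t / 2], which is the exponent here. The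
    resulting bound by [expR (- x)] is reproduced by tail integration. *)
Definition heat_bound t : R := (Num.sqrt (2 * pi * t))^-1 * expR (t / 2).

Lemma heat_bound_ge0 t : 0 <= heat_bound t.
Proof. by rewrite mulr_ge0 ?invr_ge0 ?expR_ge0. Qed.

Lemma heat_le_expR t x : 0 < t -> heat t x <= heat_bound t * expR (- x).
Proof.
move=> t0; rewrite /heat /heat_bound -[leRHS]mulrA ler_wpM2l ?invr_ge0// -expRD ler_expR.
rewrite -subr_ge0 [leRHS](_ : _ = (x - t) ^+ 2 / (2 * t)).
  by rewrite divr_ge0 ?sqr_ge0// mulr_ge0// ltW.
by field; rewrite gt_eqF.
Qed.

Lemma cvg_heat_pinfty t y : 0 < t -> heat t (y + x) @[x --> +oo%R] --> (0 : R).
Proof.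
move=> t0.
have h : heat_bound t * expR (- (y + x)) @[x --> +oo%R] --> (0 : R).
  under eq_fun do rewrite opprD expRD mulrA.
  rewrite -(mulr0 (heat_bound t * expR (- y))).
  by apply: cvgM; [exact: cvg_cst|exact: cvgr_expR].
apply: (squeeze_cvgr _ _ h); last exact: cvg_cst.
by apply: nearW => x; rewrite heat_ge0 heat_le_expR.
Qed.

(** In [l], a primitive of the integrand is [- heat t (y + l)]. Read from right to left, the
    identity writes the heat kernel as a superposition of first passage densities. *)
Lemma integral_heat_tail t y : 0 < t -> 0 <= y ->
  (\int[mu]_(l in `[0%R, +oo[) ((y + l) / t * heat t (y + l))%:E = (heat t y)%:E)%E.
Proof.
move=> t0 y0; have tn : t != 0 by rewrite gt_eqF.
have dF x : is_derive x 1 (fun l : R => - heat t (y + l)) ((y + x) / t * heat t (y + x)).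
  have h1 : is_derive x 1 (fun l : R => y + l) 1.
    by apply: (is_derive_eq (is_deriveD (is_derive_cst y x 1) (is_derive_id x 1))); rewrite add0r.
  have h := is_deriveN (is_derive1_comp (is_derive_heat (y + x) tn) h1).
  by apply: (is_derive_eq h); ring.
rewrite (@ge0_continuous_FTC2y _ _ (fun l => - heat t (y + l)) 0 0).
- by rewrite addr0 EFinN oppeK add0e.
- by move=> x x0; rewrite mulr_ge0 ?heat_ge0// divr_ge0 ?addr_ge0 ?(ltW t0).
- apply: continuous_subspaceT => x.
  apply: cvgM; last first.
    by apply: (cvg_comp _ (heat t)); [apply: cvgD; [exact: cvg_cst|exact: cvg_id]|exact: continuous_heat].
  by apply: cvgM; [apply: cvgD; [exact: cvg_cst|exact: cvg_id]|exact: cvg_cst].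
- by rewrite -oppr0; apply: cvgN; exact: cvg_heat_pinfty.
- by move=> x _; have [] := dF x.
- apply: (@cvg_at_right_filter _ _ (fun l : R => - heat t (y + l))).
  exact: is_derive_cvg (dF 0).
- by move=> x _; rewrite derive1E; have [_] := dF x => /=.
Qed.


(** Up to scaling, these are the repeated integrals of the complementary error function; [iheat 1]
    is a Gaussian tail. Extended-real values postpone all questions of integrability. *)
Fixpoint iheat (n : nat) t z : \bar R :=
  match n with
  | O => (heat t z)%:E
  | m.+1 => (\int[mu]_(l in `[0%R, +oo[) iheat m t (z + l))%E
  end.

End heat_kernel.
Arguments iheat {R} n t z : simpl never.

Section iterated_heat_tails.
Context {R : realType}.
Notation mu := (@lebesgue_measure R).
Implicit Types (t x y z l : R).

Lemma iheat0 t z : iheat 0 t z = (heat t z)%:E.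
Proof. by []. Qed.

Lemma iheatS n t z :
  (iheat n.+1 t z = \int[mu]_(l in `[0%R, +oo[) iheat n t (z + l))%E.
Proof. by []. Qed.

Lemma iheat_ge0 n t z : (0 <= iheat n t z)%E.
Proof.
elim: n z => [|n ih] z; first by rewrite iheat0 lee_fin heat_ge0.
by apply: integral_ge0.
Qed.

Lemma measurable_iheat n d (T : measurableType d) (f g : T -> R) :
  measurable_fun setT f -> measurable_fun setT g ->
  measurable_fun setT (fun w : T => iheat n (f w) (g w)).
Proof.
elim: n d T f g => [|n ih] d T f g mf mg.
  by apply/measurable_EFinP; exact: measurable_heat2.
apply: (measurable_integral_right mu (f := fun w l => iheat n (f w) (g w + l))) => //.
  apply: ih; first by apply: measurableT_comp.
  by apply: measurable_funD => //; apply: measurableT_comp.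
by move=> x y; exact: iheat_ge0.
Qed.

Lemma integral_expRN z :
  (\int[mu]_(l in `[0%R, +oo[) (expR (- (z + l)))%:E = (expR (- z))%:E)%E.
Proof.
have dF x : is_derive x 1 (fun l : R => - expR (- (z + l))) (expR (- (z + x))).
  have h1 : is_derive x 1 (fun l : R => - (z + l)) (- 1).
    have h := is_deriveN (is_deriveD (is_derive_cst z x 1) (is_derive_id x 1)).
    by apply: (is_derive_eq h); rewrite add0r.
  have h := is_deriveN (is_derive1_comp (is_derive_expR _) h1).
  by apply: (is_derive_eq h); ring.
rewrite (@ge0_continuous_FTC2y _ _ (fun l => - expR (- (z + l))) 0 0).
- by rewrite addr0 EFinN oppeK add0e.
- by move=> x x0; rewrite expR_ge0.
- apply: continuous_subspaceT => x.
  apply: (cvg_comp _ expR); last exact: continuous_expR.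
  by apply: cvgN; apply: cvgD; [exact: cvg_cst|exact: cvg_id].
- rewrite -oppr0; apply: cvgN; under eq_fun do rewrite opprD expRD.
  rewrite -(mulr0 (expR (- z))).
  by apply: cvgM; [exact: cvg_cst|exact: cvgr_expR].
- by move=> x _; have [] := dF x.
- apply: (@cvg_at_right_filter _ _ (fun l : R => - expR (- (z + l)))).
  exact: is_derive_cvg (dF 0).
- by move=> x _; rewrite derive1E; have [_] := dF x => /=.
Qed.

(** The function [expR (- z)] equals its own tail integral, so the bound for [n = 0] passes through
    the induction with the same constant. *)
Lemma iheat_le n t z : 0 < t -> (iheat n t z <= (heat_bound t * expR (- z))%:E)%E.
Proof.
move=> t0; elim: n z => [|n ih] z; first by rewrite iheat0 lee_fin heat_le_expR.
have me : measurable_fun setT (fun l : R => (expR (- (z + l)))%:E).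
  apply/measurable_EFinP; apply: measurableT_comp => //.
  by apply: measurableT_comp => //; apply: measurable_funD.
rewrite iheatS EFinM -integral_expRN -ge0_integralZl//=.
- apply: ge0_le_integral => //.
  + by move=> l _; exact: iheat_ge0.
  + apply: measurable_funTS; apply: measurable_iheat => //.
    by apply: measurable_funD.
  + by apply: measurable_funTS; apply: emeasurable_funM.
- exact: measurable_funTS.
- by rewrite lee_fin heat_bound_ge0.
Qed.

Lemma iheat_fin_num n t z : 0 < t -> iheat n t z \is a fin_num.
Proof.
move=> t0; rewrite ge0_fin_numE ?iheat_ge0//.
by rewrite (le_lt_trans (iheat_le _ _ t0))// ltry.
Qed.

Lemma ge0_integral_itvcy_shift (c : R) (f : R -> \bar R) :
  measurable_fun setT f -> (forall x, (0 <= f x)%E) ->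
  (\int[mu]_(x in `[c, +oo[) f x = \int[mu]_(x in `[0%R, +oo[) f (x + c)%R)%E.
Proof.
move=> mf f0; rewrite integral_mkcond [RHS]integral_mkcond.
rewrite -(ge0_integral_shift c).
- apply: eq_integral => x _; rewrite !patchE !mem_setE/= !in_itv/= !andbT.
  by rewrite lerDr.
- by apply/(measurable_restrictT _ _).1 => //; exact: measurable_funTS.
- by move=> x; exact: erestrict_ge0.
Qed.

Lemma iheatS_split n t z e : 0 <= e ->
  (iheat n.+1 t z = \int[mu]_(l in `[0%R, e[) iheat n t (z + l) + iheat n.+1 t (z + e))%E.
Proof.
move=> e0.
have mi : measurable_fun setT (fun l : R => iheat n t (z + l)).
  by apply: measurable_iheat => //; apply: measurable_funD.
rewrite iheatS (@itv_bndbnd_setU _ _ _ (BLeft e)) ?bnd_simp//.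
rewrite ge0_integral_setU//=; first last.
- apply/disj_setPS => x [] /=; rewrite !in_itv/= andbT => /andP[_ xe] ex.
  by move: (lt_le_trans xe ex); rewrite ltxx.
- by move=> x _; exact: iheat_ge0.
- exact: measurable_funTS.
congr (_ + _)%E; rewrite (ge0_integral_itvcy_shift e)//=.
  by apply: eq_integral => x _; rewrite [x + e]addrC addrA.
by move=> x; exact: iheat_ge0.
Qed.

Lemma iheatS_le n t z z' : z <= z' -> (iheat n.+1 t z' <= iheat n.+1 t z)%E.
Proof.
move=> zz'; rewrite (@iheatS_split n t z (z' - z)) ?subr_ge0// subrKC.
by rewrite leeDr// integral_ge0// => x _; exact: iheat_ge0.
Qed.

(** The two values differ by the integral of [iheat n] over an interval of length [z' - z] in the
    positive half-line, where [iheat n] is at most [heat_bound t]. *)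
Lemma iheatS_lipschitz n t z z' : 0 < t -> 0 <= z <= z' ->
  (iheat n.+1 t z <= iheat n.+1 t z' + (heat_bound t * (z' - z))%:E)%E.
Proof.
move=> t0 /andP[z0 zz']; rewrite (@iheatS_split n t z (z' - z)) ?subr_ge0// subrKC.
rewrite addeC leeD2l//.
have mi : measurable_fun setT (fun l : R => iheat n t (z + l)).
  by apply: measurable_iheat => //; apply: measurable_funD.
apply: (@le_trans _ _ (\int[mu]_(l in `[0%R, (z' - z)%R[) (cst (heat_bound t)%:E l)))%E.
  apply: ge0_le_integral => //.
  - by move=> l _; exact: iheat_ge0.
  - exact: measurable_funTS.
  - move=> l /=; rewrite in_itv/= => /andP[l0 _].
    apply: (le_trans (iheat_le _ _ t0)); rewrite lee_fin ler_piMr ?heat_bound_ge0//.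
    by rewrite -expR0 ler_expR oppr_le0 addr_ge0.
rewrite integral_cst//= lebesgue_measure_itv/= lte_fin subr_gt0.
case: ifPn => [_|]; first by rewrite -EFinB subr0 -EFinM.
by rewrite mule0 lee_fin mulr_ge0 ?heat_bound_ge0// subr_ge0.
Qed.

Lemma iheatS_lipschitz_dist n t z z' : 0 < t -> 0 <= z -> 0 <= z' ->
  `|fine (iheat n.+1 t z) - fine (iheat n.+1 t z')| <= heat_bound t * `|z - z'|.
Proof.
move=> t0.
wlog zz' : z z' / z <= z'.
  move=> H z0 z'0; have [zz'|/ltW zz'] := leP z z'; first exact: H.
  by rewrite distrC [`|z - z'|]distrC; exact: H.
move=> z0 z'0; rewrite ger0_norm; last first.
  rewrite subr_ge0 fine_le ?iheat_fin_num//; exact: iheatS_le.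
rewrite distrC [`|z' - z|]ger0_norm ?subr_ge0// lerBlDl.
have := @iheatS_lipschitz n t z z' t0; rewrite z0 zz' => /(_ isT).
by rewrite -{1}(fineK (iheat_fin_num n.+1 z t0)) -{1}(fineK (iheat_fin_num n.+1 z' t0)).
Qed.

End iterated_heat_tails.

(** * Fundamental theorem on open intervals and the normal distribution function *)

Section improper_ftc.
Context {R : realType}.
Notation mu := (@lebesgue_measure R).

(** Nothing is asked of [f] at the endpoints, where the first passage integrand may blow up: the
    formula on compact subintervals passes to the limit by monotone convergence. *)
Lemma ge0_FTC2_oo (f F : R -> R) (a b A B : R) : a < b ->
  {in `]a, b[, forall x, 0 <= f x} ->
  {in `]a, b[, continuous f} ->
  {in `]a, b[, forall x : R, is_derive x 1 F (f x)} ->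
  F x @[x --> a^'+] --> A -> F x @[x --> b^'-] --> B ->
  (\int[mu]_(x in `]a, b[) (f x)%:E = (B - A)%:E)%E.
Proof.
move=> ab f0 cf dF FA FB.
(* A denominator of at least 3 ensures [a + e n < b - e n] already for [n = 0]. *)
pose e (n : nat) : R := (b - a) / n.+3%:R.
have e0 n : 0 < e n by rewrite divr_gt0// subr_gt0.
have e_ab n : a + e n < b - e n.
  have h : 0 < b - a by rewrite subr_gt0.
  have : e n * n.+3%:R = b - a by rewrite /e divfK.
  have := e0 n; have : 3 <= n.+3%:R :> R by rewrite ler_nat.
  nra.
have e_cvg : e n @[n --> \oo] --> (0 : R).
  rewrite /e -[X in _ --> X](mulr0 (b - a)); apply: cvgM; first exact: cvg_cst.
  apply: (@squeeze_cvgr _ _ _ _ (fun=> 0) (@harmonic R)); last exact: cvg_harmonic.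
    apply: nearW => n; rewrite invr_ge0 ler0n/= /harmonic lef_pV2 ?posrE// ler_nat.
    by rewrite ltnW.
  exact: cvg_cst.
pose D (n : nat) : set R := `[a + e n, b - e n]%classic.
have Dsub n : D n `<=` `]a, b[.
  move=> x; rewrite /D /= !in_itv/= => /andP[x1 x2]; apply/andP; split.
    by rewrite (lt_le_trans _ x1)// ltrDl.
  by rewrite (le_lt_trans x2)// ltrBlDr ltrDl.
have Dabs n x : D n x -> a < x < b.
  by move=> /Dsub; rewrite /= in_itv.
have Dio n x : x \in `]a + e n, b - e n[ -> x \in `]a, b[.
  rewrite !in_itv/= => /andP[x1 x2]; apply/andP; split.
    by rewrite (lt_trans _ x1)// ltrDl.
  by rewrite (lt_trans x2)// ltrBlDr ltrDl.
have e_nincr n m : (n <= m)%N -> e m <= e n.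
  move=> nm; rewrite /e ler_wpM2l ?subr_ge0 ?(ltW ab)//.
  by rewrite lef_pV2 ?posrE ?ltr0n// ler_nat.
have ndD : nondecreasing_seq D.
  move=> n m nm; apply/subsetPset => x; rewrite /D /= !in_itv/= => /andP[x1 x2].
  by rewrite (le_trans _ x1) ?lerD2l ?e_nincr//= (le_trans x2)// lerD2l lerN2 e_nincr.
have UD : \bigcup_n D n = `]a, b[%classic.
  apply/seteqP; split => [x [n _ /Dsub]//|x].
  rewrite /= in_itv/= => /andP[ax xb].
  have h1 : 0 < Num.min (x - a) (b - x) by rewrite lt_min !subr_gt0 ax xb.
  move/cvgrPdist_lt : e_cvg => /(_ _ h1)[N _ /(_ N (leqnn N))].
  rewrite sub0r normrN gtr0_norm// lt_min => /andP[h2 h3].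
  by exists N => //; rewrite /D /= in_itv/=; lra.
have cvg1 : (\int[mu]_(x in D n) (f x)%:E)%E @[n --> \oo] --> (\int[mu]_(x in `]a, b[) (f x)%:E)%E.
  rewrite -UD; apply: ge0_nondecreasing_set_cvg_integral => //.
  - by move=> n; exact: measurable_itv.
  - move=> n; apply/measurable_EFinP.
    apply: (measurable_funS _ (@Dsub n)) => //.
    by apply: open_continuous_measurable_fun => // x; rewrite inE; exact: cf.
  - by move=> n x /Dabs xab; rewrite lee_fin f0// in_itv.
have eqn n : (\int[mu]_(x in D n) (f x)%:E)%E = (F (b - e n) - F (a + e n))%:E.
  rewrite EFinB; apply: continuous_FTC2 => //.
  - apply: continuous_in_subspaceT => x; rewrite inE => /Dabs xab.
    by apply: cf; rewrite in_itv.
  - have cF x : D n x -> F z @[z --> x] --> F x.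
      by move=> /Dabs xab; apply: is_derive_cvg; apply: dF; rewrite in_itv.
    split.
    + by move=> x xi; have [] := dF x (Dio _ _ xi).
    + apply: cvg_at_right_filter; apply: cF.
      by rewrite /D/= in_itv/= lexx/= ltW.
    + apply: cvg_at_left_filter; apply: cF.
      by rewrite /D/= in_itv/= lexx/= ltW.
  - by move=> x xi; rewrite derive1E; have [] := dF x (Dio _ _ xi).
have cvg2 : (F (b - e n) - F (a + e n)) @[n --> \oo] --> (B - A).
  apply: cvgB.
    move/cvg_at_leftP : FB; apply; split.
      by move=> n; rewrite ltrBlDr ltrDl.
    by rewrite -[X in _ --> X]subr0; apply: cvgB => //; exact: cvg_cst.
  move/cvg_at_rightP : FA; apply; split.
    by move=> n; rewrite ltrDl.
  by rewrite -[X in _ --> X]addr0; apply: cvgD => //; exact: cvg_cst.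
apply: (cvg_unique _ cvg1) => //.
rewrite /= (_ : (fun n => _) = (fun n => (F (b - e n) - F (a + e n))%:E)); last exact/funext.
by apply: cvg_EFin; [exact: nearW|exact: cvg2].
Qed.

End improper_ftc.

Section normal_cdf.
Context {R : realType}.
Notation mu := (@lebesgue_measure R).

Definition ncdf (x : R) : R := fine (normal_prob 0 1 `]-oo, x]).

Lemma ncdfE x : (ncdf x)%:E = normal_prob 0 1 `]-oo, x].
Proof. by rewrite /ncdf fineK// fin_num_measure. Qed.

Lemma cvg_ncdfy : ncdf x @[x --> +oo%R] --> (1 : R).
Proof.
apply: fine_cvg; have := @cvg_cdfy1 _ _ _ (normal_prob 0 1) 
  (@pack_mfun _ _ (measurableTypeR R) R idfun (@measurable_id _ _ setT)).
exact.
Qed.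

Lemma cvg_ncdfNy : ncdf x @[x --> -oo%R] --> (0 : R).
Proof.
apply: fine_cvg; have := @cvg_cdfNy0 _ _ _ (normal_prob 0 1) 
  (@pack_mfun _ _ (measurableTypeR R) R idfun (@measurable_id _ _ setT)).
exact.
Qed.

Lemma ncdfN x : ncdf (- x) = 1 - ncdf x.
Proof.
have h : (normal_prob 0 1 `]-oo, (- x)%R] = normal_prob 0 1 `]x, +oo[)%E.
  rewrite /normal_prob [RHS]integral_itv_obnd_cbnd; last first.
    by apply/measurable_EFinP; apply: measurable_funTS; exact: measurable_normal_pdf.
  rewrite integral_mkcond [RHS]integral_mkcond -ge0_integral_oppr.
  - apply: eq_integral => y _; rewrite !patchE !mem_setE/= !in_itv/= andbT lerN2.
    by case: ifPn => // _; rewrite !heat_normal_pdf ?oner_eq0// !subr0 heatN.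
  - apply/(measurable_restrictT _ _).1 => //; apply: measurable_funTS.
    by apply/measurable_EFinP; exact: measurable_normal_pdf.
  - by move=> y; apply: erestrict_ge0 => z _; rewrite lee_fin normal_pdf_ge0.
apply/EFin_inj; rewrite EFinB !ncdfE h -probability_setC//.
by rewrite setCitvl.
Qed.

Lemma ncdf0 : ncdf 0 = 2^-1.
Proof. by have := ncdfN 0; rewrite oppr0 => h; lra. Qed.

Lemma is_derive_ncdf (x : R) : is_derive x 1 ncdf (heat 1 x).
Proof.
have := @continuous_FTC1 R (normal_pdf 0 1) -oo%O x (x + 1).
rewrite ltrDl ltr01 => /(_ isT) h.
have [|||/= d1 d2] := h.
- by apply: integrableS (integrable_normal_pdf 0 1).
- by rewrite ltNyr.
- by have := @continuous_normal_pdf R 0 1 (oner_neq0 R); apply.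
apply: DeriveDef; first exact: d1.
rewrite -derive1E d2 heat_normal_pdf ?oner_eq0// subr0 expr1n//.
Qed.

End normal_cdf.

(** * First passage convolution *)
Section heat_first_passage.
Context {R : realType}.
Notation mu := (@lebesgue_measure R).
Implicit Types t s l z x y : R.

Lemma heat_prodE (a b c d : R) : 0 < a -> 0 < b ->
  heat a c * heat b d = (Num.sqrt ((2 * pi * a) * (2 * pi * b)))^-1 *
    expR (- (c ^+ 2 / (2 * a) + d ^+ 2 / (2 * b))).
Proof.
move=> a0 b0; rewrite /heat mulrACA -invfM -sqrtrM; last first.
  by rewrite !mulr_ge0 ?pi_ge0 ?(ltW a0).
by rewrite -expRD opprD !mulNr.
Qed.

Lemma continuous_heat_time x s : 0 < s -> {for s, continuous (fun s => heat s x)}.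
Proof.
move=> s0; have c2 (a : R) : a * z @[z --> s] --> a * s.
  by apply: cvgM; [exact: cvg_cst|exact: cvg_id].
apply: cvgM.
  apply: (@cvg_comp _ _ _ (fun s => Num.sqrt (2 * pi * s)) (fun z => z^-1)); last first.
    by apply: inv_continuous; rewrite gt_eqF// sqrtr_gt0 !mulr_gt0// pi_gt0.
  by apply: (@cvg_comp _ _ _ (fun s => 2 * pi * s) Num.sqrt); [exact: c2|exact: sqrt_continuous].
apply: (@cvg_comp _ _ _ (fun s => - x ^+ 2 / (2 * s)) expR); last exact: continuous_expR.
apply: cvgM; first exact: cvg_cst.
apply: (@cvg_comp _ _ _ (fun s => 2 * s) (fun z => z^-1)); first exact: c2.
by apply: inv_continuous; rewrite gt_eqF// mulr_gt0.
Qed.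

(** This substitution maps []0, t[] decreasingly onto []0, +oo[]. In terms of [w],
    [l ^ 2 / s = l ^ 2 w ^ 2 + l ^ 2 / t] and [z ^ 2 / (t - s) = z ^ 2 / (t w) ^ 2 + z ^ 2 / t], so
    that the exponents can be completed to squares of [l w] plus or minus [z / (t w)]. *)
Let w t s : R := Num.sqrt (s^-1 - t^-1).

Let w_sqr t s : 0 < s < t -> w t s ^+ 2 = (t - s) / (t * s).
Proof.
move=> /andP[s0 st]; rewrite sqr_sqrtr.
  by field; rewrite !gt_eqF// (lt_trans s0).
have t0 : 0 < t := lt_trans s0 st.
by rewrite subr_ge0 lef_pV2 ?posrE// ltW.
Qed.

Let w_gt0 t s : 0 < s < t -> 0 < w t s.
Proof.
move=> /andP[s0 st]; have t0 : 0 < t := lt_trans s0 st.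
by rewrite sqrtr_gt0 subr_gt0 ltf_pV2 ?posrE.
Qed.

Let is_derive_w t s : 0 < s < t -> is_derive s 1 (w t) (- (2 * w t s * s ^+ 2)^-1).
Proof.
move=> st; have /andP[s0 s_t] := st.
have sn : s != 0 by rewrite gt_eqF.
have h1 : is_derive s 1 (fun s : R => s^-1 - t^-1) (- s ^- 2).
  have h := is_deriveB (@is_deriveV R id s 1 1 sn (is_derive_id s 1)) (is_derive_cst t^-1 s 1).
  by apply: (is_derive_eq h); rewrite subr0 scaler1.
have t0 : 0 < t := lt_trans s0 s_t.
have h0 : 0 < s^-1 - t^-1 by rewrite subr_gt0 ltf_pV2 ?posrE.
have h := @is_derive1_comp R Num.sqrt (fun s => s^-1 - t^-1) s _ _ (is_derive1_sqrt h0) h1.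
by apply: (is_derive_eq h); rewrite -/(w t s); field; rewrite sn gt_eqF// w_gt0.
Qed.

Let cvg_w_left t : 0 < t -> w t s @[s --> t^'-] --> (0 : R).
Proof.
move=> t0; rewrite -sqrtr0 -(subrr t^-1).
apply: cvg_at_left_filter.
apply: (@cvg_comp _ _ _ (fun s => s^-1 - t^-1) Num.sqrt); last exact: sqrt_continuous.
by apply: cvgB; [apply: inv_continuous; rewrite gt_eqF|exact: cvg_cst].
Qed.

Let cvg_w_right t : 0 < t -> w t s @[s --> 0^'+] --> +oo%R.
Proof.
move=> t0; apply/cvgryPge => A; near=> s.
have s0 : 0 < s by near: s; exact: nbhs_right_gt.
apply: (@le_trans _ _ (Num.sqrt (A ^+ 2))); first by rewrite sqrtr_sqr ler_norm.
rewrite ler_wsqrtr// lerBrDr -[leLHS]invrK lef_pV2 ?posrE//.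
  by near: s; apply: nbhs_right_le; rewrite invr_gt0 ltr_wpDl ?sqr_ge0// invr_gt0.
by rewrite invr_gt0 ltr_wpDl ?sqr_ge0// invr_gt0.
Unshelve. all: by end_near. Qed.

(** A primitive in [s] of the first passage integrand. The two squares differ by [4 l z / t], hence
    with the weight [expR (2 l z / t)] both [ncdf] terms have the same Gaussian density as a factor
    of their derivative; the contributions of [z] cancel and those of [l] add up. *)
Let F t l z s := - heat t (l + z) * (ncdf (l * w t s - z / (t * w t s)) +
  expR (2 * l * z / t) * ncdf (l * w t s + z / (t * w t s))).

Let is_derive_F t l z s : 0 < s < t ->
  is_derive s 1 (F t l z) (l / s * heat s l * heat (t - s) z).
Proof.
move=> st; have /andP[s0 s_t] := st.
have t0 : 0 < t by rewrite (lt_trans s0).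
have ts0 : 0 < t - s by rewrite subr_gt0.
have w0 := w_gt0 st; have w2 := w_sqr st.
have wn : w t s != 0 by rewrite gt_eqF.
have tn : t != 0 by rewrite gt_eqF.
have twn : t * w t s != 0 by rewrite mulf_neq0.
have dw := is_derive_w st.
have d1 : is_derive s 1 (fun s => l * w t s) (l * - (2 * w t s * s ^+ 2)^-1).
  exact: (is_deriveZ l dw).
have d2 : is_derive s 1 (fun s => z / (t * w t s))
    (z * (- (t * w t s) ^- 2 * (t * - (2 * w t s * s ^+ 2)^-1))).
  exact: (is_deriveZ z (@is_deriveV R (fun s => t * w t s) s _ 1 twn (is_deriveZ t dw))).
have da := @is_derive1_comp R ncdf (fun s => l * w t s - z / (t * w t s)) s _ _ (is_derive_ncdf _) (is_deriveB d1 d2).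
have dc := @is_derive1_comp R ncdf (fun s => l * w t s + z / (t * w t s)) s _ _ (is_derive_ncdf _) (is_deriveD d1 d2).
have h := is_deriveZ (- heat t (l + z)) (is_deriveD da (is_deriveZ (expR (2 * l * z / t)) dc)).
apply: (is_derive_eq h); rewrite {h da dc d1 d2} /GRing.scale/= /GRing.scale/=.
set c := l * w t s + z / (t * w t s).
have -> : heat 1 (l * w t s - z / (t * w t s)) = expR (2 * l * z / t) * heat 1 c.
  rewrite /heat mulrCA -expRD; congr (_ * expR _).
  by rewrite /c; field; rewrite wn tn.
have c2 : c ^+ 2 = l ^+ 2 * w t s ^+ 2 + 2 * l * z / t + z ^+ 2 / (t ^+ 2 * w t s ^+ 2).
  by rewrite /c; field; rewrite wn tn.
(* Completion of the square in [w]; the normalizing constants match through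
   [w ^ 2 = (t - s) / (t s)]. *)
have K : heat t (l + z) * (expR (2 * l * z / t) * heat 1 c) =
    w t s * s * (heat s l * heat (t - s) z).
  rewrite mulrCA !heat_prodE// c2 w2.
  have -> : Num.sqrt (2 * pi * s * (2 * pi * (t - s))) =
      w t s * s * Num.sqrt (2 * pi * t * (2 * pi * 1)).
    rewrite -[w t s * s]ger0_norm ?mulr_ge0 ?ltW// -sqrtr_sqr -sqrtrM ?sqr_ge0//.
    by congr Num.sqrt; rewrite exprMn w2; field; rewrite gt_eqF// gt_eqF.
  have aux (u v e : R) : u != 0 -> v != 0 -> u * ((u * v)^-1 * e) = v^-1 * e.
    by move=> un vn; rewrite invfM -mulrA mulVKf.
  rewrite aux; first last.
  - by rewrite gt_eqF// sqrtr_gt0 !mulr_gt0// pi_gt0.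
  - by rewrite mulf_neq0// gt_eqF.
  rewrite mulrCA -expRD; congr (_ * expR _); field.
  by rewrite !gt_eqF.
transitivity (heat t (l + z) * (expR (2 * l * z / t) * heat 1 c) * l / (w t s * s ^+ 2)).
  by field; rewrite wn tn gt_eqF.
by rewrite K; field; rewrite wn gt_eqF.
Qed.

(** The primitive [F] as a function of [v = w t s]: its limits at [+oo] and at [0+] are those of [F]
    at [s = 0] and [s = t]. *)
Let G t l z v := - heat t (l + z) * (ncdf (l * v - z / (t * v)) +
  expR (2 * l * z / t) * ncdf (l * v + z / (t * v))).

Let cvg_G_pinfty t l z : 0 < t -> 0 < l -> 0 <= z ->
  G t l z v @[v --> +oo%R] --> - heat t (l + z) * (1 + expR (2 * l * z / t) * 1).
Proof.
move=> t0 l0 z0; apply: cvgM; first exact: cvg_cst.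
have zt0 : 0 <= z / t by rewrite divr_ge0// ltW.
have ztv (v : R) : 1 <= v -> 0 <= z / (t * v) <= z / t.
  move=> v1; have v0 : 0 < v by rewrite (lt_le_trans _ v1).
  rewrite invfM mulrA divr_ge0//= ?(ltW v0)//.
  by rewrite ler_piMr// invf_le1.
apply: cvgD; last apply: cvgM; first last.
- apply: (cvg_comp _ _ _ cvg_ncdfy); apply/cvgryPge => A; near=> v.
  have v1 : 1 <= v by near: v; apply: nbhs_pinfty_ge; rewrite num_real.
  have vA : A / l <= v by near: v; apply: nbhs_pinfty_ge; rewrite num_real.
  have := ztv _ v1; rewrite ler_pdivrMr// in vA; lra.
- exact: cvg_cst.
- apply: (cvg_comp _ _ _ cvg_ncdfy); apply/cvgryPge => A; near=> v.
  have v1 : 1 <= v by near: v; apply: nbhs_pinfty_ge; rewrite num_real.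
  have vA : (A + z / t) / l <= v by near: v; apply: nbhs_pinfty_ge; rewrite num_real.
  have := ztv _ v1; rewrite ler_pdivrMr// in vA; lra.
Unshelve. all: by end_near. Qed.

Let cvg_G_right t l z : 0 < t -> 0 < l -> 0 <= z ->
  G t l z v @[v --> 0^'+] --> - heat t (l + z) * (expR (2 * l * z / t) * 1).
Proof.
move=> t0 l0; rewrite le_eqVlt => /predU1P[<-|z0].
  (* For [z = 0] the arguments no longer diverge: both tend to [0], and the two values
     [ncdf 0 = 1/2] add up to the same limit. *)
  have -> : G t l 0 = (fun v => - heat t (l + 0) * (ncdf (l * v) *+ 2)).
    apply/funext => v; rewrite /G !mul0r mulr0 mul0r expR0 mul1r subr0 addr0.
    by rewrite addr0 mulr2n.
  rewrite mulr0 mul0r expR0 mul1r.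
  have -> : (1 : R) = ncdf (l * 0) *+ 2 by rewrite mulr0 ncdf0 mulr2n; lra.
  apply: cvgM; first exact: cvg_cst.
  apply: cvgMn; apply: cvg_at_right_filter.
  apply: (@cvg_comp _ _ _ (fun v => l * v) ncdf).
    by apply: cvgM; [exact: cvg_cst|exact: cvg_id].
  exact: is_derive_cvg (is_derive_ncdf _).
apply: cvgM; first exact: cvg_cst.
rewrite -[X in _ --> X]add0r.
have zt0 : 0 < z / t by rewrite divr_gt0.
apply: cvgD; last apply: cvgM; first last.
- apply: (cvg_comp _ _ _ cvg_ncdfy); apply/cvgryPge => A; near=> v.
  have v0 : 0 < v by near: v; exact: nbhs_right_gt.
  have vA : v * (1 + `|A|) <= z / t.
    rewrite -ler_pdivlMr ?ltr_wpDr//.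
    by near: v; apply: nbhs_right_le; rewrite divr_gt0// ltr_wpDr.
  have h : 1 + `|A| <= z / (t * v) by rewrite invfM mulrA ler_pdivlMr// mulrC.
  have := ler_norm A; have : 0 < l * v by rewrite mulr_gt0.
  lra.
- exact: cvg_cst.
- apply: (cvg_comp _ _ _ cvg_ncdfNy); apply/cvgrNyPle => A; near=> v.
  have v0 : 0 < v by near: v; exact: nbhs_right_gt.
  have v1 : l * v <= 1.
    by rewrite mulrC -ler_pdivlMr//; near: v; apply: nbhs_right_le; rewrite divr_gt0.
  have vA : v * (1 + `|A|) <= z / t.
    rewrite -ler_pdivlMr ?ltr_wpDr//.
    by near: v; apply: nbhs_right_le; rewrite divr_gt0// ltr_wpDr.
  have h : 1 + `|A| <= z / (t * v) by rewrite invfM mulrA ler_pdivlMr// mulrC.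
  have := ler_norm (- A); rewrite normrN; lra.
Unshelve. all: by end_near. Qed.

(** Since [l / s * heat s l] is the density of the first passage time of Brownian motion at level
    [l], this is the decomposition of a path from [0] to [l + z] at its first visit to [l]. *)
Lemma heat_first_passage_convolution t l z : 0 < t -> 0 < l -> 0 <= z ->
  (\int[mu]_(s in `]0%R, t[) (l / s * heat s l * heat (t - s) z)%:E = (heat t (l + z))%:E)%E.
Proof.
move=> t0 l0 z0.
rewrite (@ge0_FTC2_oo R (fun s => l / s * heat s l * heat (t - s) z) (F t l z) 0 t
  (- heat t (l + z) * (1 + expR (2 * l * z / t) * 1))
  (- heat t (l + z) * (expR (2 * l * z / t) * 1))).
- by congr EFin; ring.
- exact: t0.
- move=> s; rewrite in_itv/= => /andP[s0 st].
  by do 3?[apply: mulr_ge0; rewrite ?heat_ge0//]; rewrite ?invr_ge0 ltW.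
- move=> s; rewrite in_itv/= => /andP[s0 st].
  have ts0 : 0 < t - s by rewrite subr_gt0.
  apply: cvgM.
    apply: cvgM; last exact: continuous_heat_time.
    by apply: cvgM; [exact: cvg_cst|apply: inv_continuous; rewrite gt_eqF].
  apply: (@cvg_comp _ _ _ (fun s => t - s) (fun s => heat s z)).
    by apply: cvgB; [exact: cvg_cst|exact: cvg_id].
  exact: continuous_heat_time.
- by move=> s; rewrite in_itv/=; exact: is_derive_F.
- exact: (cvg_comp _ _ (cvg_w_right t0) (cvg_G_pinfty t0 l0 z0)).
- apply: (cvg_comp _ _ _ (cvg_G_right t0 l0 z0)).
  move=> A /(cvg_w_left t0) hA.
  have wpos : \forall s \near t^'-, 0 < w t s.
    near=> s; apply: w_gt0; apply/andP; split; near: s.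
      exact: nbhs_left_gt.
    exact: nbhs_left_lt.
  by apply: filterS2 hA wpos => s; exact.
Unshelve. all: by end_near. Qed.

End heat_first_passage.

Section heat_convolution.
Context {R : realType}.
Notation mu := (@lebesgue_measure R).
Implicit Types t s l z x y : R.

Lemma measurable_heat_residual d (T : measurableType d) t (f : T -> R) x :
  measurable_fun setT f -> measurable_fun setT (fun w => (heat (t - f w) x)%:E).
Proof.
move=> mf; apply/measurable_EFinP; apply: measurable_heat2 => //.
exact: measurable_funB.
Qed.

(** By [integral_heat_tail], [heat s y] is an integral over [l] of first passage densities at the
    levels [y + l]; after exchanging integrals, each of them convolves to [heat t (y + l + |x|)]. *)
Lemma heat_convolution t y x : 0 < t -> 0 <= y ->
  (\int[mu]_(s in `]0%R, t[) (heat s y * heat (t - s) x)%:E = iheat 1 t (y + `|x|))%E.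
Proof.
move=> t0 y0.
(* The absolute value makes the integrand non-negative on the whole plane, as Tonelli requires; it
   is the identity on the domain of integration. *)
pose f (s l : R) : \bar R := (`|(y + l) / s * heat s (y + l) * heat (t - s) x|)%:E.
have mf : measurable_fun setT (fun p : R * R => f p.1 p.2).
  apply/measurable_EFinP; apply: measurableT_comp => //.
  apply: measurable_funM; last first.
    by apply: measurable_heat2 => //; apply: measurable_funB.
  apply: measurable_funM; last by apply: measurable_heat2 => //; apply: measurable_funD.
  by apply: measurable_funM; [apply: measurable_funD|exact: (measurableT_comp measurable_invr)].
have fE s l : 0 < s < t -> 0 <= l -> f s l = ((y + l) / s * heat s (y + l) * heat (t - s) x)%:E.
  move=> /andP[s0 st] l0; rewrite /f ger0_norm//.
  by do 3?[apply: mulr_ge0; rewrite ?heat_ge0//]; rewrite ?invr_ge0 ?addr_ge0 ?(ltW s0).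
transitivity (\int[mu]_(s in `]0%R, t[) \int[mu]_(l in `[0%R, +oo[) f s l)%E.
  apply: eq_integral => s; rewrite inE/= in_itv/= => s0t; have /andP[s0 st] := s0t.
  transitivity (\int[mu]_(l in `[0%R, +oo[)
      (((y + l) / s * heat s (y + l))%:E * (heat (t - s) x)%:E))%E; last first.
    by apply: eq_integral => l; rewrite inE/= in_itv/= andbT => l0; rewrite fE.
  rewrite ge0_integralZr//=.
  - by rewrite integral_heat_tail.
  - apply: measurable_funTS; apply/measurable_EFinP; apply: measurable_funM.
      by apply: measurable_funM => //; apply: measurable_funD.
    by apply: measurable_heat2 => //; apply: measurable_funD.
  - move=> l; rewrite in_itv/= andbT => l0.
    by rewrite lee_fin mulr_ge0 ?heat_ge0// divr_ge0 ?addr_ge0// ltW.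
  - by rewrite lee_fin heat_ge0.
rewrite (tonelli_domains mu mu mf)//; last by move=> *; rewrite lee_fin.
rewrite iheatS -integral_itv_obnd_cbnd; last first.
  by apply: measurable_funTS; apply: (measurable_integral_left mu mf) => // *; rewrite lee_fin.
rewrite -[RHS]integral_itv_obnd_cbnd; last first.
  by apply: measurable_funTS; apply: measurable_iheat => //; apply: measurable_funD.
apply: eq_integral => l; rewrite inE/= in_itv/= andbT => l0.
rewrite iheat0 addrAC.
rewrite -(@heat_first_passage_convolution _ t (y + l) `|x|)//; last by rewrite ltr_wpDl.
apply: eq_integral => s; rewrite inE/= in_itv/= => st.
by rewrite heat_norm fE// ltW.
Qed.

Lemma iheat_convolution m t y x : 0 < t -> 0 <= y ->
  (\int[mu]_(s in `]0%R, t[) (iheat m s y * (heat (t - s) x)%:E) = iheat m.+1 t (y + `|x|))%E.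
Proof.
move=> t0; elim: m y => [|m ih] y y0.
  by rewrite -heat_convolution//; apply: eq_integral.
rewrite iheatS.
under [RHS]eq_integral.
  move=> l; rewrite inE/= in_itv/= andbT => l0.
  rewrite addrAC -ih ?addr_ge0//.
  over.
rewrite -(tonelli_domains mu mu (f := fun s l => (iheat m s (y + l) * (heat (t - s) x)%:E)%E))//.
- apply: eq_integral => s _.
  rewrite -ge0_integralZr//.
  + apply: measurable_funTS; apply: measurable_iheat => //.
    by apply: measurable_funD.
  + by move=> l _; exact: iheat_ge0.
  + by rewrite lee_fin heat_ge0.
- apply: emeasurable_funM.
    by apply: measurable_iheat => //; apply: measurable_funD.
  exact: measurable_heat_residual.
- by move=> s l; rewrite mule_ge0 ?iheat_ge0// lee_fin heat_ge0.
Qed.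

Lemma integral_pow_sub n u : 0 <= u ->
  (\int[mu]_(m in `[0%R, u]) ((u - m) ^+ n / n`!%:R)%:E = (u ^+ n.+1 / n.+1`!%:R)%:E)%E.
Proof.
rewrite le_eqVlt => /predU1P[<-|u0].
  by rewrite set_itv1 integral_set1 expr0n/= mul0r.
have fn : n`!%:R != 0 :> R by rewrite pnatr_eq0 -lt0n fact_gt0.
have n1 : n.+1%:R != 0 :> R by rewrite pnatr_eq0.
have dF (x : R) : is_derive x 1 (fun m => - ((u - m) ^+ n.+1 / n.+1`!%:R)) ((u - x) ^+ n / n`!%:R).
  have h1 := is_deriveB (is_derive_cst u x 1) (is_derive_id x 1).
  have h2 := is_deriveN (is_deriveZ (n.+1`!%:R)^-1 (is_deriveX n.+1 h1)).
  have -> : (fun m => - ((u - m) ^+ n.+1 / n.+1`!%:R)) = - ((n.+1`!%:R)^-1 \*: ((cst u - id) ^+ n.+1)).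
    by apply/funext => m; rewrite !fctE /= mulrC.
  apply: (is_derive_eq h2); rewrite /GRing.scale/= /GRing.scale/= factS natrM.
  by rewrite sub0r mulrN1 mulrN opprK invfM mulrACA mulVf// mul1r mulrC.
rewrite (@continuous_FTC2 R _ (fun m => - ((u - m) ^+ n.+1 / n.+1`!%:R)) 0 u)//.
- by rewrite subrr expr0n/= mul0r subr0 oppr0 -EFinB sub0r opprK.
- apply: continuous_subspaceT => x; apply: cvgM; last exact: cvg_cst.
  apply: (@cvg_comp _ _ _ (fun x => u - x) (fun x => x ^+ n)); last exact: exprn_continuous.
  by apply: cvgB; [exact: cvg_cst|exact: cvg_id].
- split.
  + by move=> x _; have [] := dF x.
  + by apply: cvg_at_right_filter; exact: is_derive_cvg (dF 0).
  + by apply: cvg_at_left_filter; exact: is_derive_cvg (dF u).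
- by move=> x _; rewrite derive1E; have [_] := dF x.
Qed.

(** Cauchy's formula for repeated integration, applied to minus the derivative of the heat kernel:
    [iheat n] is its tail integral iterated [n + 1] times, whence the kernel [l ^ n / n!]. It turns
    [iheat] into moments of an explicit density. *)
Lemma iheat_cauchy n t z : 0 < t -> 0 <= z ->
  (iheat n t z = \int[mu]_(l in `[0%R, +oo[)
     (l ^+ n / n`!%:R * ((z + l) / t * heat t (z + l)))%:E)%E.
Proof.
move=> t0; elim: n z => [|n ih] z z0.
  rewrite iheat0 -integral_heat_tail//; apply: eq_integral => l _.
  by rewrite expr0 fact0 divr1 mul1r.
pose J (l : R) : \bar R := (`|(z + l) / t * heat t (z + l)|)%:E.
have JE l : 0 <= l -> J l = ((z + l) / t * heat t (z + l))%:E.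
  by move=> l0; rewrite /J ger0_norm// mulr_ge0 ?heat_ge0// divr_ge0 ?addr_ge0// ltW.
have mJ : measurable_fun setT J.
  apply/measurable_EFinP; apply: measurableT_comp => //; apply: measurable_funM.
    by apply: measurable_funM => //; apply: measurable_funD.
  by apply: measurable_heat2 => //; apply: measurable_funD.
(* The indicator encodes the constraint [m <= u], so that both variables range over the same
   half-line when the integrals are exchanged. *)
pose f (m u : R) : \bar R := ((\1_`[m, +oo[ u * `|(u - m) ^+ n / n`!%:R|)%:E * J u)%E.
have mi : measurable_fun setT (fun p : R * R => \1_`[p.1, +oo[%classic p.2 : R).
  rewrite (_ : (fun _ => _) = \1_[set p : R * R | p.1 <= p.2]).
    by apply: measurable_indic; rewrite -[X in measurable X]setTI; apply: measurable_fun_ler.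
  apply/funext => -[u v]; rewrite !indicE; congr (nat_of_bool _)%:R.
  by apply/idP/idP; rewrite !inE/= in_itv/= andbT.
have mf : measurable_fun setT (fun p : R * R => f p.1 p.2).
  apply: emeasurable_funM; last exact: measurableT_comp.
  apply/measurable_EFinP; apply: measurable_funM => //.
  apply: measurableT_comp => //; apply: measurable_funM => //.
  by apply: measurable_funX; apply: measurable_funB.
have f0 m u : (0 <= f m u)%E.
  by rewrite mule_ge0// lee_fin// mulr_ge0// indicE.
have mfm m : measurable_fun setT (f m) := measurableT_comp mf (pair1_measurable m).
transitivity (\int[mu]_(m in `[0%R, +oo[) \int[mu]_(u in `[0%R, +oo[) f m u)%E.
  rewrite iheatS; apply: eq_integral => m; rewrite inE/= in_itv/= andbT => m0.
  rewrite ih ?addr_ge0//.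
  transitivity (\int[mu]_(l in `[0%R, +oo[) f m (l + m)%R)%E.
    apply: eq_integral => l; rewrite inE/= in_itv/= andbT => l0.
    rewrite /f JE ?addr_ge0// indicE mem_setE/= in_itv/= andbT lerDr l0 mul1r addrK.
    rewrite ger0_norm; last by rewrite divr_ge0 ?exprn_ge0.
    by rewrite -EFinM addrA addrAC.
  rewrite -(ge0_integral_itvcy_shift m (mfm m) (f0 m)).
  rewrite integral_mkcond [RHS]integral_mkcond; apply: eq_integral => u _.
  rewrite !patchE !mem_setE/= !in_itv/= !andbT.
  case: (leP m u) => [mle|um]; first by rewrite (le_trans m0 mle).
  by rewrite /f indicE mem_setE/= in_itv/= (leNgt m) um !mul0r mul0e; case: ifP.
rewrite (tonelli_domains mu mu mf)//.
apply: eq_integral => u; rewrite inE/= in_itv/= andbT => u0.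
rewrite EFinM -integral_pow_sub// -JE// -ge0_integralZr//=; first last.
- by rewrite lee_fin.
- by move=> m; rewrite in_itv/= => /andP[m0 mu_]; rewrite lee_fin divr_ge0// exprn_ge0// subr_ge0.
- apply: measurable_funTS; apply/measurable_EFinP; apply: measurable_funM => //.
  by apply: measurable_funX; apply: measurable_funB.
rewrite integral_mkcond [RHS]integral_mkcond; apply: eq_integral => m _.
rewrite !patchE !mem_setE/= !in_itv/= andbT /f indicE mem_setE/= in_itv/= andbT.
case: (leP 0 m) => //= m0; case: (leP m u) => [mle|_]; last by rewrite !mul0r mul0e.
by rewrite mul1r ger0_norm// divr_ge0// exprn_ge0// subr_ge0.
Qed.

End heat_convolution.

(** * Measures with a density, and Gaussian integrals *)

Section weighted_measure.
Context d (T : measurableType d) (R : realType).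
Variables (m : {measure set T -> \bar R}) (f : T -> R).
Hypothesis mf : measurable_fun setT f.
Hypothesis f0 : forall x, 0 <= f x.

Import HBNNSimple.

(** The proofs are arguments so that the term carries everything its measure structure depends
    on. *)
Definition weighted_measure (_ : measurable_fun setT f) (_ : forall x, 0 <= f x)
  (A : set T) : \bar R := (\int[m]_(x in A) (f x)%:E)%E.

Let weighted_measure0 : weighted_measure mf f0 set0 = 0%E.
Proof. by rewrite /weighted_measure integral_set0. Qed.

Let weighted_measure_ge0 A : (0 <= weighted_measure mf f0 A)%E.
Proof. by apply: integral_ge0 => x _; rewrite lee_fin. Qed.

Let weighted_measure_sigma_additive : semi_sigma_additive (weighted_measure mf f0).
Proof.
move=> F mF tF mUF; rewrite /weighted_measure ge0_integral_bigcup//.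
- by apply: is_cvg_ereal_nneg_natsum_cond => n _ _; exact: weighted_measure_ge0.
- by apply: measurable_funTS; apply/measurable_EFinP.
- by move=> x _; rewrite lee_fin.
Qed.

HB.instance Definition _ := isMeasure.Build _ _ _ (weighted_measure mf f0)
  weighted_measure0 weighted_measure_ge0 weighted_measure_sigma_additive.

Lemma ge0_integral_weighted_measure (g : T -> \bar R) :
  measurable_fun setT g -> (forall x, (0 <= g x)%E) ->
  (\int[weighted_measure mf f0]_x g x = \int[m]_x (g x * (f x)%:E))%E.
Proof.
move=> mg g0.
have mfE : measurable_fun setT (EFin \o f) by exact/measurable_EFinP.
pose h : nat -> {nnsfun T >-> R} := nnsfun_approx measurableT mg.
have cvg_h x : (h n x)%:E @[n --> \oo] --> g x.
  by apply: cvg_nnsfun_approx => // y _; exact: g0.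
have ndh x : nondecreasing_seq (fun n => (h n x)%:E).
  by move=> a b ab; rewrite lee_fin; exact/lefP/nd_nnsfun_approx.
have -> : (\int[weighted_measure mf f0]_x g x =
   limn (fun n => \int[weighted_measure mf f0]_x (h n x)%:E))%E.
  have gE x : [set: T] x -> g x = limn (fun n => (h n x)%:E).
    by move=> _; apply/esym/cvg_lim.
  under eq_integral => x /[!inE] /gE -> //.
  apply: monotone_convergence => //.
  - by move=> n; apply/measurable_EFinP; exact/measurable_funP.
  - by move=> n x _; rewrite lee_fin.
have -> : (\int[m]_x (g x * (f x)%:E) =
   limn (fun n => \int[m]_x ((h n x)%:E * (f x)%:E)))%E.
  have gE x : [set: T] x -> (g x * (f x)%:E = limn (fun n => (h n x)%:E * (f x)%:E))%E.
    by move=> _; apply/esym/cvg_lim => //; exact: cvgeZr.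
  under eq_integral => x /[!inE] /gE -> //.
  apply: monotone_convergence => //.
  - move=> n; apply: emeasurable_funM => //; apply/measurable_EFinP; exact/measurable_funP.
  - by move=> n x _; rewrite mule_ge0// lee_fin.
  - by move=> x _ a b ab; rewrite lee_wpmul2r ?lee_fin//; have := ndh x a b ab; rewrite lee_fin.
congr (limn _); apply/funext => n.
transitivity (\int[weighted_measure mf f0]_x
   (\sum_(y \in range (h n)) (y * \1_(h n @^-1` [set y]) x)%:E))%E.
  by apply: eq_integral => t tE; rewrite /= fimfunE -fsumEFin.
have indich r : measurable_fun setT (fun x => (r * \1_(h n @^-1` [set r]) x)%:E).
  by apply/measurable_EFinP; apply: measurable_funM => //; exact: measurable_indic.
rewrite ge0_integral_fsum//; last by move=> y x _; exact: nnfun_muleindic_ge0.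
transitivity (\int[m]_x (\sum_(y \in range (h n))
    (y * \1_(h n @^-1` [set y]) x)%:E * (f x)%:E))%E; last first.
  under [LHS]eq_integral => x xE.
    rewrite -ge0_mule_fsuml => [|y]; last exact: nnfun_muleindic_ge0.
    rewrite fsumEFin // -(fimfunE _ x); over.
  by [].
rewrite ge0_integral_fsum//; last 2 first.
  - by move=> y; exact: emeasurable_funM.
  - move=> y x _; apply: mule_ge0; last by rewrite lee_fin.
    exact: nnfun_muleindic_ge0.
apply: eq_fsbigr => r rhn.
under [LHS]eq_integral do rewrite EFinM.
rewrite integralZl_indic_nnsfun//.
have r0 : 0 <= r by move: rhn; rewrite inE => -[t _ <-].
under [RHS]eq_integral do rewrite EFinM -muleA.
rewrite ge0_integralZl//.
- rewrite integral_indic// setIT; congr (_ * _)%E.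
  change (\int[m]_(x in h n @^-1` [set r]) (f x)%:E =
    \int[m]_x ((\1_(h n @^-1` [set r]) x)%:E * (f x)%:E))%E.
  rewrite integral_mkcond; apply: eq_integral => x _.
  by rewrite patchE indicE; case: ifPn; rewrite ?mul1e ?mul0e.
- by apply: emeasurable_funM => //; apply/measurable_EFinP; exact: measurable_indic.
- by move=> t _; rewrite mule_ge0 ?lee_fin.
Qed.

End weighted_measure.

Section integral_derivative.
Context {R : realType}.
Notation mu := (@lebesgue_measure R).

Lemma cvg_patch_itv_sym (g : R -> \bar R) (x : R) :
  (g \_ (`[- n.+1%:R, n.+1%:R]%classic : set R)) x @[n --> \oo] --> g x.
Proof.
apply: cvg_near_cst; near=> n; rewrite patchE mem_setE/= in_itv/= -ler_norml.
have -> // : `|x| <= n.+1%:R.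
near: n; exists (Num.truncn `|x|) => // n /= h.
by rewrite (le_trans (ltW (truncnS_gt _)))// ler_nat.
Unshelve. all: by end_near. Qed.

(** Serves as integration by parts: applied to products with the heat kernel, it yields the Gaussian
    moments and the differential equation of the cosine transform. *)
Lemma integral_is_derive0 (f f' : R -> R) :
  (forall x : R, is_derive x 1 f (f' x)) -> continuous f' ->
  mu.-integrable setT (EFin \o f') ->
  f x @[x --> +oo%R] --> (0 : R) -> f x @[x --> -oo%R] --> (0 : R) ->
  (\int[mu]_x (f' x)%:E = 0)%E.
Proof.
move=> df cf' intf' fy fNy.
have mf' : measurable_fun setT (EFin \o f') := measurable_int _ intf'.
pose D n : set R := `[- n.+1%:R, n.+1%:R]%classic.
have eqn n : (\int[mu]_x ((EFin \o f') \_ (D n)) x = (f n.+1%:R - f (- n.+1%:R))%:E)%E.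
  rewrite -integral_mkcond EFinB; apply: continuous_FTC2.
  - by rewrite gtrN// ltr0n.
  - by apply: continuous_subspaceT => x; exact: cf'.
  - split.
    + by move=> x _; have [] := df x.
    + by apply: cvg_at_right_filter; exact: is_derive_cvg (df _).
    + by apply: cvg_at_left_filter; exact: is_derive_cvg (df _).
  - by move=> x _; rewrite derive1E; have [_] := df x.
have h1 n : measurable_fun setT ((EFin \o f') \_ (D n)).
  apply/(measurable_restrictT _ _).1; first exact: measurable_itv.
  exact: measurable_funTS.
have h2 : {ae mu, forall x, setT x -> (EFin \o f') \_ (D n) x @[n --> \oo] --> (EFin \o f') x}.
  by apply: aeW => x _; exact: cvg_patch_itv_sym.
have h3 : {ae mu, forall x n, setT x -> (`|((EFin \o f') \_ (D n)) x| <= (abse \o (EFin \o f')) x)%E}.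
  apply: aeW => x n _; rewrite patchE; case: ifP => //= _.
  by rewrite lee_fin normr0.
have [_ _ cvg1] := dominated_convergence (mu := mu) measurableT h1 mf' h2 (integrable_abse intf') h3.
have cvg2 : (f n.+1%:R - f (- n.+1%:R)) @[n --> \oo] --> (0 : R).
  have ny : (n.+1%:R : R) @[n --> \oo] --> +oo%R.
    rewrite (cvg_shiftS (fun n => n%:R : R)); exact: cvgr_idn.
  rewrite -(subr0 0); apply: cvgB; first exact: (cvg_comp _ _ ny fy).
  apply: (cvg_comp _ _ _ fNy); apply/cvgNrNy.
  exact: ny.
apply: (cvg_unique _ cvg1) => //=.
rewrite (_ : (fun n => _) = (fun n => (f n.+1%:R - f (- n.+1%:R))%:E)); last exact/funext.
by apply: cvg_EFin; [exact: nearW|exact: cvg2].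
Qed.

End integral_derivative.

Section gaussian_integrals.
Context {R : realType}.
Notation mu := (@lebesgue_measure R).
Implicit Types (t x a : R).

(** Doubling the variance absorbs the quadratic factor: with [e = x ^ 2 / (4 t)], one has [1 + 4 t e
    <= (1 + 4 t) (1 + e) <= (1 + 4 t) expR e]. *)
Lemma heat_quadratic_bound t : 0 < t ->
  exists2 C : R, 0 <= C & forall x, (1 + x ^+ 2) * heat t x <= C * heat (2 * t) x.
Proof.
move=> t0.
have s2 : 0 < 2 * pi * t by rewrite !mulr_gt0// pi_gt0.
have s4 : 0 < 2 * pi * (2 * t) by rewrite !mulr_gt0// pi_gt0.
pose c := Num.sqrt (2 * pi * (2 * t)) / Num.sqrt (2 * pi * t).
have c0 : 0 <= c by rewrite divr_ge0.
exists ((1 + 4 * t) * c) => [|x]; first by rewrite mulr_ge0// addr_ge0 ?mulr_ge0// ltW.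
set e := x ^+ 2 / (2 * (2 * t)).
have e0 : 0 <= e by rewrite divr_ge0 ?sqr_ge0// !mulr_ge0// ltW.
have -> : heat t x = (Num.sqrt (2 * pi * t))^-1 * (expR (- e) * expR (- e)).
  by rewrite /heat -expRD; congr (_ * expR _); rewrite /e; field; rewrite gt_eqF.
have -> : heat (2 * t) x = (Num.sqrt (2 * pi * (2 * t)))^-1 * expR (- e).
  by rewrite /heat /e mulNr.
have -> : (1 + 4 * t) * c * ((Num.sqrt (2 * pi * (2 * t)))^-1 * expR (- e)) =
   (Num.sqrt (2 * pi * t))^-1 * ((1 + 4 * t) * expR (- e)).
  by rewrite /c; field; rewrite !gt_eqF// sqrtr_gt0.
rewrite mulrCA ler_wpM2l ?invr_ge0// mulrA ler_wpM2r ?expR_ge0//.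
have -> : x ^+ 2 = 4 * t * e by rewrite /e; field; rewrite gt_eqF.
rewrite expRN ler_pdivrMr ?expR_gt0//.
have := expR_ge1Dx e; have : 0 < 4 * t by rewrite mulr_gt0.
nra.
Qed.

Lemma integrable_heat t : 0 < t -> mu.-integrable setT (fun x => (heat t x)%:E).
Proof.
move=> t0; apply/integrableP; split.
  by apply/measurable_EFinP; exact: measurable_heat2.
rewrite (_ : (\int[mu]_x _)%E = 1%E) ?ltry//.
rewrite -(integral_heat 0 t0); apply: eq_integral => x _.
by rewrite subr0 gee0_abs// lee_fin heat_ge0.
Qed.

Lemma integrable_quadratic_heat t (g : R -> R) : 0 < t -> measurable_fun setT g ->
  (forall x, `|g x| <= 1 + x ^+ 2) ->
  mu.-integrable setT (fun x => (g x * heat t x)%:E).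
Proof.
move=> t0 mg gb; have [C C0 hC] := heat_quadratic_bound t0.
have t20 : 0 < 2 * t by rewrite mulr_gt0.
apply: (le_integrable measurableT _ _ (integrableZl measurableT C (integrable_heat t20))).
  apply/measurable_EFinP; apply: measurable_funM => //; exact: measurable_heat2.
move=> x _; rewrite -EFinM !lee_fin normrM (ger0_norm (heat_ge0 _ _)).
rewrite (ger0_norm C0) normrM (ger0_norm (heat_ge0 _ _)).
by apply: le_trans (hC x); rewrite ler_wpM2r ?heat_ge0.
Qed.

Lemma cvg_quadratic_heat t (g : R -> R) (F : set_system R) : 0 < t ->
  (forall x, `|g x| <= 1 + x ^+ 2) ->
  ((F --> +oo%R) \/ (F --> -oo%R)) -> Filter F ->
  g x * heat t x @[x --> F] --> (0 : R).
Proof.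
move=> t0 gb hF FF; have [C C0 hC] := heat_quadratic_bound t0.
have t20 : 0 < 2 * t by rewrite mulr_gt0.
have h : C * heat (2 * t) x @[x --> F] --> (0 : R).
  rewrite -(mulr0 C); apply: cvgM; first exact: cvg_cst.
  have h0 : heat (2 * t) x @[x --> +oo%R] --> (0 : R).
    by have := cvg_heat_pinfty 0 t20; under eq_fun do rewrite add0r.
  case: hF => hF; first exact: cvg_trans (cvg_app _ hF) h0.
  apply: cvg_trans (cvg_app _ hF) _; apply/cvgNy_compNP.
  by rewrite (_ : heat (2 * t) \o -%R = heat (2 * t))//; apply/funext => x /=; rewrite heatN.
apply: norm_cvg0; apply: (squeeze_cvgr _ (cvg_cst 0) h).
apply: nearW => x; rewrite normr_ge0/= normrM (ger0_norm (heat_ge0 _ _)).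
by apply: le_trans (hC x); rewrite ler_wpM2r ?heat_ge0.
Qed.

Lemma heat_first_moment t : 0 < t -> (\int[mu]_x (x * heat t x)%:E = 0)%E.
Proof.
move=> t0; have tn : t != 0 by rewrite gt_eqF.
have i1 : mu.-integrable setT (fun x => (x * heat t x)%:E).
  by apply: integrable_quadratic_heat => // x; rewrite ler_norml; apply/andP; split; nra.
have h := @integral_is_derive0 R (heat t) (fun x => - (x / t) * heat t x) (fun x => is_derive_heat x tn).
have E : (fun x : R => (- (x / t) * heat t x)%:E) = (fun x => (- t^-1)%:E * (x * heat t x)%:E)%E.
  by apply/funext => x; rewrite -EFinM; congr EFin; ring.
have i2 : mu.-integrable setT (EFin \o (fun x => - (x / t) * heat t x)).
  by rewrite /comp E; exact: integrableZl.
have c1 : continuous (fun x => - (x / t) * heat t x).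
  move=> x; apply: cvgM; last exact: continuous_heat.
  by apply: cvgN; apply: cvgM; [exact: cvg_id|exact: cvg_cst].
have one (x : R) : `|1 : R| <= 1 + x ^+ 2 by rewrite normr1 lerDl sqr_ge0.
have z1 : heat t x @[x --> +oo%R] --> (0 : R).
  by have := @cvg_quadratic_heat t (fun=> 1) +oo%R t0 one (or_introl (@cvg_id _ _)) _;
    under eq_fun do rewrite mul1r; exact.
have z2 : heat t x @[x --> -oo%R] --> (0 : R).
  by have := @cvg_quadratic_heat t (fun=> 1) -oo%R t0 one (or_intror (@cvg_id _ _)) _;
    under eq_fun do rewrite mul1r; exact.
have := h c1 i2 z1 z2; rewrite E integralZl// => /eqP.
rewrite mule_eq0 => /orP[|/eqP//]; rewrite eqe oppr_eq0 invr_eq0 => /eqP t00.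
by rewrite t00 ltxx in t0.
Qed.

Lemma heat_second_moment t : 0 < t -> (\int[mu]_x (x ^+ 2 * heat t x)%:E = t%:E)%E.
Proof.
move=> t0; have tn : t != 0 by rewrite gt_eqF.
have i1 : mu.-integrable setT (fun x => (x ^+ 2 * heat t x)%:E).
  apply: integrable_quadratic_heat => // x.
  by rewrite ger0_norm ?sqr_ge0// lerDr.
have df (x : R) : is_derive x 1 (fun x => x * heat t x) (heat t x - t^-1 * (x ^+ 2 * heat t x)).
  have h := is_deriveM (is_derive_id x 1) (is_derive_heat x tn).
  by apply: (is_derive_eq h); rewrite /GRing.scale/=; ring.
have h := @integral_is_derive0 R _ _ df.
have i2 := integrableB measurableT (integrable_heat t0) (integrableZl measurableT t^-1 i1).
have c1 : continuous (fun x => heat t x - t^-1 * (x ^+ 2 * heat t x)).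
  move=> x; apply: cvgB; first exact: continuous_heat.
  apply: cvgM; first exact: cvg_cst.
  by apply: cvgM; [exact: exprn_continuous|exact: continuous_heat].
have one (x : R) : `|x| <= 1 + x ^+ 2 by rewrite ler_norml; apply/andP; split; nra.
have z1 : x * heat t x @[x --> +oo%R] --> (0 : R).
  exact: (@cvg_quadratic_heat t id +oo%R t0 one (or_introl (@cvg_id _ _)) _).
have z2 : x * heat t x @[x --> -oo%R] --> (0 : R).
  exact: (@cvg_quadratic_heat t id -oo%R t0 one (or_intror (@cvg_id _ _)) _).
have := h c1 i2 z1 z2; rewrite integralB_EFin//; last first.
  exact: (integrableZl measurableT t^-1 i1).
  exact: integrable_heat.
rewrite -[X in (X - _)%E](_ : 1%E = _); last first.
  by rewrite -(integral_heat 0 t0); apply: eq_integral => x _; rewrite subr0.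
under [X in (_ - X)%E]eq_integral do rewrite EFinM.
rewrite integralZl// -(fineK (integrable_fin_num measurableT i1)) -EFinM -EFinB => -[] e.
congr EFin; move: e; set I := fine _ => e.
have : t * (1 - t^-1 * I) = 0 by rewrite e mulr0.
by rewrite mulrBr mulr1 mulrA mulfV// mul1r => /eqP; rewrite subr_eq0 => /eqP.
Qed.

(** With [K] the integral as a function of [a], differentiation under the integral gives [K' = - S],
    and integration by parts in [x] gives [S = a t K]; hence [K] times [expR (t a ^ 2 / 2)] is
    constant. The phase [eta] covers the real and imaginary parts of the characteristic function
    together. *)
Lemma integral_cos_heat t a eta : 0 < t ->
  (\int[mu]_x (cos (a * x + eta) * heat t x)%:E = (cos eta * expR (- (a ^+ 2 * t / 2)))%:E)%E.
Proof.
move=> t0; have tn : t != 0 by rewrite gt_eqF.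
pose f (a x : R) := cos (a * x + eta) * heat t x.
pose K (a : R) := (\int[mu]_x f a x)%R.
have mlin (b : R) : measurable_fun setT (fun x : R => b * x + eta).
  by apply: measurable_funD => //; apply: measurable_funM.
have mcos (b : R) : measurable_fun setT (fun x : R => cos (b * x + eta)).
  by apply: measurableT_comp => //; apply: continuous_measurable_fun; exact: continuous_cos.
have msin (b : R) : measurable_fun setT (fun x : R => sin (b * x + eta)).
  by apply: measurableT_comp => //; apply: continuous_measurable_fun; exact: continuous_sin.
have cosb (b x : R) : `|cos (b * x + eta)| <= 1 + x ^+ 2.
  rewrite (@le_trans _ _ 1)// ?lerDl ?sqr_ge0// ler_norml cos_geN1 cos_le1//.
have sinb (b x : R) : `|sin (b * x + eta)| <= 1.
  by rewrite ler_norml sin_geN1 sin_le1.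
have absx (x : R) : `|x| <= 1 + x ^+ 2 by rewrite ler_norml; apply/andP; split; nra.
have if1 (b : R) : mu.-integrable setT (EFin \o f b).
  exact: integrable_quadratic_heat.
have is1 (b : R) : mu.-integrable setT (fun x => (x * sin (b * x + eta) * heat t x)%:E).
  apply: integrable_quadratic_heat => // [|x]; first exact: measurable_funM.
  by rewrite normrM (le_trans _ (absx x))// ler_piMr.
have dlin (b x : R) : is_derive b 1 (fun b : R => b * x + eta) x.
  have h := is_deriveD (is_deriveZ x (is_derive_id b 1)) (is_derive_cst eta b 1).
  have -> : (fun b : R => b * x + eta) = x \*: id + cst eta.
    by apply/funext => c; rewrite !fctE /= mulrC.
  by apply: (is_derive_eq h); rewrite /GRing.scale/= mulr1 addr0.
have df (b x : R) : is_derive b 1 (f^~ x) (- (x * sin (b * x + eta) * heat t x)).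
  have h1 := @is_derive1_comp R cos (fun b => b * x + eta) b _ _ (is_derive_cos _) (dlin b x).
  have h := is_deriveZ (heat t x) h1.
  have -> : f^~ x = heat t x \*: (cos \o (fun b => b * x + eta)).
    by apply/funext => c; rewrite /f mulrC.
  by apply: (is_derive_eq h); rewrite /GRing.scale/=; ring.
have d1E b : partial1of2 f b = (fun x => - (x * sin (b * x + eta) * heat t x)).
  by apply/funext => x; rewrite /partial1of2 derive1E; have [_ ->] := df b x.
pose G (x : R) := `|x| * heat t x.
have iG : mu.-integrable setT (EFin \o G).
  by apply: integrable_quadratic_heat => // x; rewrite normr_id.
pose S b := (\int[mu]_x (x * sin (b * x + eta) * heat t x))%R.
have dK (b : R) : is_derive b 1 K (- S b).
  have bI : `]b - 1, b + 1[%classic b by rewrite /= in_itv/= gtrDl ltrDl ltrN10 ltr01.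
  have H1 (x : R) : `]b - 1, b + 1[%classic x -> mu.-integrable setT (EFin \o f x) by move=> _; exact: if1.
  have H2 (x y : R) : `]b - 1, b + 1[%classic x -> setT y -> derivable (f^~ y) x 1.
    by move=> _ _; have [] := df x y.
  have H3 (y : R) : 0 <= G y by rewrite mulr_ge0 ?heat_ge0.
  have H4 (x y : R) : `]b - 1, b + 1[%classic x -> setT y -> `|partial1of2 f x y| <= G y.
    move=> _ _; rewrite d1E normrN normrM (ger0_norm (heat_ge0 _ _)) normrM /G.
    by rewrite ler_wpM2r ?heat_ge0// ler_piMr.
  have D1 := derivable_under_integral measurableT bI H1 H2 H3 iG H4.
  have D2 := differentiation_under_integral measurableT bI H1 H2 H3 iG H4.
  apply: DeriveDef; first exact: D1.
  rewrite -derive1E; transitivity (\int[mu]_y partial1of2 f b y)%R; first exact: D2.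
  rewrite /S -[RHS]mulN1r -RintegralZl//; last exact: is1.
  by apply: eq_Rintegral => x _; rewrite d1E mulN1r.
have SE b : S b = b * t * K b.
  have dg (x : R) : is_derive x 1 (fun x => sin (b * x + eta) * heat t x)
      (b * f b x - t^-1 * (x * sin (b * x + eta) * heat t x)).
    have h0 : is_derive x 1 (fun x : R => b * x + eta) b.
      have h := is_deriveD (is_deriveZ b (is_derive_id x 1)) (is_derive_cst eta x 1).
      by apply: (is_derive_eq h); rewrite /GRing.scale/= mulr1 addr0.
    have h1 := @is_derive1_comp R sin (fun x => b * x + eta) x _ _ (is_derive_sin _) h0.
    have h := is_deriveM h1 (is_derive_heat x tn).
    by apply: (is_derive_eq h); rewrite /GRing.scale/= /f; ring.
  have i2 := integrableB measurableT (integrableZl measurableT b (if1 b)) (integrableZl measurableT t^-1 (is1 b)).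
  have clin : continuous (fun x : R => b * x + eta).
    by move=> x; apply: cvgD; [apply: cvgM; [exact: cvg_cst|exact: cvg_id]|exact: cvg_cst].
  have ccos : continuous (fun x : R => cos (b * x + eta)).
    by move=> x; apply: (@cvg_comp _ _ _ (fun x => b * x + eta) cos); [exact: clin|exact: continuous_cos].
  have csin : continuous (fun x : R => sin (b * x + eta)).
    by move=> x; apply: (@cvg_comp _ _ _ (fun x => b * x + eta) sin); [exact: clin|exact: continuous_sin].
  have c1 : continuous (fun x => b * f b x - t^-1 * (x * sin (b * x + eta) * heat t x)).
    move=> x; apply: cvgB; (apply: cvgM; first exact: cvg_cst).
      by apply: cvgM; [exact: ccos|exact: continuous_heat].
    by apply: cvgM; [apply: cvgM; [exact: cvg_id|exact: csin]|exact: continuous_heat].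
  have one (x : R) : `|sin (b * x + eta)| <= 1 + x ^+ 2.
    by rewrite (le_trans (sinb _ _))// lerDl sqr_ge0.
  have z1 : sin (b * x + eta) * heat t x @[x --> +oo%R] --> (0 : R).
    exact: (@cvg_quadratic_heat t _ +oo%R t0 one (or_introl (@cvg_id _ _)) _).
  have z2 : sin (b * x + eta) * heat t x @[x --> -oo%R] --> (0 : R).
    exact: (@cvg_quadratic_heat t _ -oo%R t0 one (or_intror (@cvg_id _ _)) _).
  have := @integral_is_derive0 R _ _ dg c1 i2 z1 z2.
  rewrite integralB_EFin//; last 2 first.
  - exact: (integrableZl measurableT b (if1 b)).
  - exact: (integrableZl measurableT t^-1 (is1 b)).
  under eq_integral do rewrite EFinM.
  under [X in (_ - X)%E]eq_integral do rewrite EFinM.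
  rewrite (integralZl measurableT (if1 b)) (integralZl measurableT (is1 b)).
  rewrite -(fineK (integrable_fin_num measurableT (if1 b))) -(fineK (integrable_fin_num measurableT (is1 b))).
  rewrite -!EFinM -EFinB => -[]; rewrite -/(Rintegral _ _ _) -/(K b) => /eqP.
  rewrite subr_eq0 => /eqP e; rewrite mulrAC e.
  by rewrite mulrAC mulVf// mul1r.
pose Q (b : R) := K b * expR (t / 2 * b ^+ 2).
have dQ (b : R) : is_derive b 1 Q 0.
  have h1 : is_derive b 1 (fun b : R => t / 2 * b ^+ 2) (t * b).
    have h := is_deriveZ (t / 2) (is_deriveX 2 (is_derive_id b 1)).
    by apply: (is_derive_eq h); rewrite /GRing.scale/= expr1; field.
  have h2 := @is_derive1_comp R expR (fun b => t / 2 * b ^+ 2) b _ _ (is_derive_expR _) h1.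
  have h := is_deriveM (dK b) h2.
  by apply: (is_derive_eq h); rewrite /GRing.scale/= SE; ring.
have QE : Q a = Q 0 by exact: (is_derive_0_is_cst _ _ dQ).
have K0 : K 0 = cos eta.
  rewrite /K /f.
  under eq_Rintegral do rewrite mul0r add0r.
  rewrite RintegralZl//; last exact: integrable_heat.
  rewrite /Rintegral (_ : (\int[mu]_x (heat t x)%:E = 1)%E) ?mulr1//.
  by rewrite -(integral_heat 0 t0); apply: eq_integral => x _; rewrite subr0.
have -> : (\int[mu]_x (cos (a * x + eta) * heat t x)%:E = (K a)%:E)%E.
  by rewrite /K /Rintegral fineK// (integrable_fin_num measurableT (if1 a)).
congr EFin; move: QE; rewrite /Q K0 expr0n/= mulr0 expR0 mulr1 => <-.
by rewrite -[RHS]mulrA -expRD (_ : _ + _ = 0) ?expR0 ?mulr1//; ring.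
Qed.

End gaussian_integrals.

(** * Fourier uniqueness on the line *)
Section as_finite_measure.
Context d (T : measurableType d) (R : realType).
Variables (m : {measure set T -> \bar R}) (mfin : (m setT < +oo)%E).

(** The finiteness proof is an argument so that the finite measure structure can be attached to the
    term. *)
Definition as_finite_measure (_ : (m setT < +oo)%E) : set T -> \bar R := m.

HB.instance Definition _ := Measure.on (as_finite_measure mfin).

Let as_finite_measure_fin : fin_num_fun (as_finite_measure mfin).
Proof.
move=> A mA; rewrite ge0_fin_numE; last exact: (measure_ge0 m).
by apply: (le_lt_trans _ mfin); apply: (le_measure m); rewrite ?inE.
Qed.

HB.instance Definition _ := Measure_isFinite.Build _ _ _
  (as_finite_measure mfin) as_finite_measure_fin.

End as_finite_measure.

Section fourier_uniqueness.
Context {R : realType}.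
Notation mu := (@lebesgue_measure R).

(** The Gaussian kernel as a mixture of cosines, with a Gaussian law of frequencies. Adding [1] to
    the cosine keeps the integrand non-negative, which makes Tonelli available for any finite
    measure in [u]. *)
Let gauss_kernelE (e u : R) : 0 < e ->
  (\int[mu]_xi ((1 + cos (xi * u)) * heat e^-1 xi)%:E = (1 + expR (- (u ^+ 2 / (2 * e))))%:E)%E.
Proof.
move=> e0; have ie0 : 0 < e^-1 by rewrite invr_gt0.
under eq_integral do rewrite mulrDl mul1r EFinD.
have i1 : mu.-integrable setT (fun xi : R => (cos (xi * u) * heat e^-1 xi)%:E).
  apply: integrable_quadratic_heat => // [|x].
    apply: measurableT_comp; last exact: measurable_funM.
    by apply: continuous_measurable_fun; exact: continuous_cos.
  by rewrite (@le_trans _ _ 1)// ?lerDl ?sqr_ge0// ler_norml cos_geN1 cos_le1.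
rewrite integralD//; last exact: integrable_heat.
rewrite (_ : (\int[mu]_x (heat e^-1 x)%:E = 1)%E); last first.
  by rewrite -(integral_heat 0 ie0); apply: eq_integral => x _; rewrite subr0.
have -> : (\int[mu]_x (cos (x * u) * heat e^-1 x)%:E = (expR (- (u ^+ 2 * e^-1 / 2)))%:E)%E.
  rewrite -[RHS](_ : (cos 0 * expR (- (u ^+ 2 * e^-1 / 2)))%:E = _); last by rewrite cos0 mul1r.
  rewrite -integral_cos_heat//; apply: eq_integral => x _.
  by rewrite addr0 [u * x]mulrC.
rewrite -EFinD; congr (1 + expR (- _))%:E.
by field; rewrite gt_eqF.
Qed.

Let smooth (e : R) (phi : R -> R) (x : R) := (\int[mu]_y (phi y * heat e (y - x))%:E)%E.

Section finite_measures.
Variables m1 m2 : {finite_measure set R -> \bar R}.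
Hypothesis H : forall a eta : R,
  (\int[m1]_x (1 + cos (a * x + eta))%:E = \int[m2]_x (1 + cos (a * x + eta))%:E)%E.

Let cos1_ge0 (u : R) : 0 <= 1 + cos u.
Proof. by rewrite -lerBlDl sub0r cos_geN1. Qed.

Lemma fourier_mass_eq : m1 setT = m2 setT.
Proof.
have E (m : {finite_measure set R -> \bar R}) :
    (\int[m]_x (1 + cos (0 * x + 0))%:E = 2%:E * m setT)%E.
  by under eq_integral do rewrite mul0r addr0 cos0; rewrite integral_cst.
have := H 0 0; rewrite !E -(fineK (fin_num_measure m1 _ measurableT)) -(fineK (fin_num_measure m2 _ measurableT)).
by rewrite -!EFinM => -[/mulfI] => ->//; rewrite pnatr_eq0.
Qed.

Lemma fourier_gauss (m : {finite_measure set R -> \bar R}) (e y : R) : 0 < e ->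
  (\int[m]_x (1 + expR (- ((y - x) ^+ 2 / (2 * e))))%:E =
   \int[mu]_xi ((heat e^-1 xi)%:E * \int[m]_x (1 + cos (- xi * x + xi * y))%:E))%E.
Proof.
move=> e0.
pose f (x xi : R) : \bar R := ((1 + cos (xi * (y - x))) * heat e^-1 xi)%:E.
have mc : measurable_fun setT (fun p : R * R => 1 + cos (p.2 * (y - p.1))).
  apply: measurable_funD => //; apply: measurableT_comp.
    by apply: continuous_measurable_fun; exact: continuous_cos.
  by apply: measurable_funM => //; apply: measurable_funB.
have mf : measurable_fun setT (fun p : R * R => f p.1 p.2).
  by apply/measurable_EFinP; apply: measurable_funM => //; apply: measurable_heat2.
under eq_integral do rewrite -gauss_kernelE//.
rewrite (tonelli_domains m mu mf)//; last first.
  by move=> x xi; rewrite lee_fin mulr_ge0 ?heat_ge0.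
apply: eq_integral => xi _; rewrite -ge0_integralZl//.
- apply: eq_integral => x _; rewrite /f EFinM muleC; congr (_ * (1 + cos _)%:E)%E.
  by rewrite mulrBr mulNr addrC.
- apply/measurable_EFinP; apply: measurable_funD => //; apply: measurableT_comp.
    by apply: continuous_measurable_fun; exact: continuous_cos.
  by apply: measurable_funD => //; apply: measurable_funM.
- by rewrite lee_fin heat_ge0.
Qed.

Lemma fourier_heat_eq (e y : R) : 0 < e ->
  (\int[m1]_x (heat e (y - x))%:E = \int[m2]_x (heat e (y - x))%:E)%E.
Proof.
move=> e0.
have mE : measurable_fun setT (fun x : R => expR (- ((y - x) ^+ 2 / (2 * e)))).
  apply: measurableT_comp => //; apply: measurableT_comp => //; apply: measurable_funM => //.
  by apply: measurable_funX; apply: measurable_funB.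
have E : (\int[m1]_x (expR (- ((y - x) ^+ 2 / (2 * e))))%:E =
    \int[m2]_x (expR (- ((y - x) ^+ 2 / (2 * e))))%:E)%E.
  have D (m : {finite_measure set R -> \bar R}) :
      (\int[m]_x (1 + expR (- ((y - x) ^+ 2 / (2 * e))))%:E = m setT +
       \int[m]_x (expR (- ((y - x) ^+ 2 / (2 * e))))%:E)%E.
    under eq_integral do rewrite EFinD.
    rewrite ge0_integralD//.
    + by rewrite integral_cst// mul1e.
    + exact/measurable_EFinP.
  have : (m1 setT + \int[m1]_x (expR (- ((y - x) ^+ 2 / (2 * e))))%:E =
          m2 setT + \int[m2]_x (expR (- ((y - x) ^+ 2 / (2 * e))))%:E)%E.
    by rewrite -!D !fourier_gauss//; apply: eq_integral => xi _; rewrite H.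
  have mfin := fin_num_measure m2 _ measurableT.
  by rewrite fourier_mass_eq => /(congr1 (fun z => z - m2 setT)%E); rewrite ![(m2 _ + _)%E]addeC !addeK.
have hE (x : R) : (heat e (y - x))%:E = ((Num.sqrt (2 * pi * e))^-1%:E * (expR (- ((y - x) ^+ 2 / (2 * e))))%:E)%E.
  by rewrite -EFinM /heat mulNr.
under eq_integral do rewrite hE.
under [RHS]eq_integral do rewrite hE.
rewrite !ge0_integralZl//; first by rewrite E.
all: try by apply/measurable_EFinP.
all: try by move=> x _; rewrite lee_fin expR_ge0.
all: by rewrite lee_fin invr_ge0.
Qed.

Lemma fourier_smooth_eq (e : R) (phi : R -> R) : 0 < e -> measurable_fun setT phi -> (forall x : R, 0 <= phi x) ->
  (\int[m1]_x smooth e phi x = \int[m2]_x smooth e phi x)%E.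
Proof.
move=> e0 mphi phi0.
pose f (x y : R) : \bar R := (phi y * heat e (y - x))%:E.
have mf : measurable_fun setT (fun p : R * R => f p.1 p.2).
  apply/measurable_EFinP; apply: measurable_funM; first exact: measurableT_comp.
  by apply: measurable_heat2 => //; apply: measurable_funB.
have f0 x y : (0 <= f x y)%E by rewrite lee_fin mulr_ge0 ?heat_ge0.
rewrite (tonelli_domains m1 mu mf)// (tonelli_domains m2 mu mf)//.
apply: eq_integral => y _; under eq_integral do rewrite /f EFinM.
under [RHS]eq_integral do rewrite /f EFinM.
have mh : measurable_fun setT (fun x : R => (heat e (y - x))%:E).
  by apply/measurable_EFinP; apply: measurable_heat2 => //; apply: measurable_funB.
rewrite !ge0_integralZl ?lee_fin ?fourier_heat_eq//.
all: by move=> x _; rewrite lee_fin heat_ge0.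
Qed.

End finite_measures.

Let smooth_near (L delta : R) (phi : R -> R) (x : R) : 0 < delta -> 0 <= L ->
  measurable_fun setT phi -> (forall x, 0 <= phi x) ->
  (forall x y, `|phi x - phi y| <= L * `|x - y|) ->
  (smooth (delta ^+ 2) phi x <= (phi x + L * delta)%:E)%E /\
  ((phi x)%:E <= smooth (delta ^+ 2) phi x + (L * delta)%:E)%E.
Proof.
move=> d0 L0 mphi phi0 lip; set e := delta ^+ 2.
have e0 : 0 < e by rewrite exprn_gt0.
have mh : measurable_fun setT (fun y : R => (heat e (y - x))%:E).
  by apply/measurable_EFinP; apply: measurable_heat2 => //; apply: measurable_funB.
(* Arithmetic-geometric majorant of [L |y - x|]. Being quadratic it integrates in closed form, and
   for the variance [delta ^ 2] its integral is exactly [L delta]. *)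
pose g (y : R) := L * (((y - x) ^+ 2 / delta + delta) / 2).
have mg : measurable_fun setT g.
  apply: measurable_funM => //; apply: measurable_funM => //; apply: measurable_funD => //.
  by apply: measurable_funM => //; apply: measurable_funX; apply: measurable_funB.
have g0 y : 0 <= g y.
  by rewrite mulr_ge0// divr_ge0// addr_ge0 ?(ltW d0)// divr_ge0 ?sqr_ge0// ltW.
have lipg y : L * `|y - x| <= g y.
  rewrite ler_wpM2l// ler_pdivlMr// -subr_ge0.
  rewrite (_ : _ - _ = (`|y - x| - delta) ^+ 2 / delta).
    by rewrite divr_ge0 ?sqr_ge0// ltW.
  by rewrite -[(y - x) ^+ 2]real_normK ?num_real//; field; rewrite gt_eqF.
have ig : (\int[mu]_y (g y * heat e (y - x))%:E = (L * delta)%:E)%E.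
  pose k (y : R) := ((L / (2 * delta) * (y ^+ 2 * heat e y))%:E + (L * delta / 2 * heat e y)%:E)%E.
  have kE y : (g y * heat e (y - x))%:E = k (y + - x).
    by rewrite /k -EFinD; congr EFin; rewrite /g; field; rewrite gt_eqF.
  under eq_integral do rewrite kE.
  have m1 : measurable_fun setT (fun y : R => (y ^+ 2 * heat e y)%:E).
    by apply/measurable_EFinP; apply: measurable_funM => //; apply: measurable_heat2.
  have m2 : measurable_fun setT (fun y : R => (heat e y)%:E).
    by apply/measurable_EFinP; apply: measurable_heat2.
  have h1 y : 0 <= y ^+ 2 * heat e y by rewrite mulr_ge0 ?sqr_ge0 ?heat_ge0.
  have L1 : 0 <= L / (2 * delta) by rewrite divr_ge0// mulr_ge0// ltW.
  have L2 : 0 <= L * delta / 2 by rewrite divr_ge0// mulr_ge0// ltW.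
  rewrite (ge0_integral_shift (- x)) /k; last 2 first.
  - by apply: emeasurable_funD; under eq_fun do rewrite EFinM; exact: emeasurable_funM.
  - by move=> z; apply: adde_ge0; rewrite lee_fin; [exact: mulr_ge0 L1 (h1 z) | exact: mulr_ge0 L2 (heat_ge0 _ _)].
  rewrite ge0_integralD//; last 4 first.
  - by move=> y _; rewrite lee_fin mulr_ge0.
  - by under eq_fun do rewrite EFinM; exact: emeasurable_funM.
  - by move=> y _; rewrite lee_fin mulr_ge0 ?heat_ge0.
  - by under eq_fun do rewrite EFinM; exact: emeasurable_funM.
  under eq_integral do rewrite EFinM.
  under [X in (_ + X)%E]eq_integral do rewrite EFinM.
  rewrite !ge0_integralZl//; do ?[by move=> y _; rewrite lee_fin ?heat_ge0].
  rewrite heat_second_moment//.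
  rewrite (_ : (\int[mu]_y (heat e y)%:E = 1)%E); last first.
    by rewrite -(integral_heat 0 e0); apply: eq_integral => y _; rewrite subr0.
  rewrite mule1 -EFinM -EFinD; congr EFin; rewrite /e; field.
  by rewrite gt_eqF.
have mgh : measurable_fun setT (fun y : R => (g y * heat e (y - x))%:E).
  by apply/measurable_EFinP; apply: measurable_funM => //; apply/measurable_EFinP.
have mph : measurable_fun setT (fun y : R => (phi y * heat e (y - x))%:E).
  by apply/measurable_EFinP; apply: measurable_funM => //; apply/measurable_EFinP.
have ic (c : R) : 0 <= c -> (\int[mu]_y (c * heat e (y - x))%:E = c%:E)%E.
  move=> c0; under eq_integral do rewrite EFinM.
  rewrite ge0_integralZl//; first by rewrite integral_heat// mule1.
  by move=> y _; rewrite lee_fin heat_ge0.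
have mc (c : R) : measurable_fun setT (fun y : R => (c * heat e (y - x))%:E).
  by under eq_fun do rewrite EFinM; exact: emeasurable_funM.
split.
- rewrite EFinD -ig -(ic (phi x))// -ge0_integralD//.
  + apply: ge0_le_integral => //.
    * by move=> y _; rewrite lee_fin mulr_ge0 ?heat_ge0.
    * by apply: emeasurable_funD; [exact: mc|exact: mgh].
    * move=> y _; rewrite -EFinD lee_fin -mulrDl ler_wpM2r ?heat_ge0//.
      rewrite -lerBlDl (le_trans (ler_norm _))// (le_trans (lip _ _))//.
  + by move=> y _; rewrite lee_fin mulr_ge0 ?heat_ge0.
  + exact: mc.
  + by move=> y _; rewrite lee_fin mulr_ge0 ?heat_ge0.
- rewrite -ig -(ic (phi x))// /smooth -ge0_integralD//.
  + apply: ge0_le_integral => //.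
    * by move=> y _; rewrite lee_fin mulr_ge0 ?heat_ge0.
    * exact: mc.
    * by apply: emeasurable_funD; [exact: mph|exact: mgh].
    * move=> y _; rewrite -EFinD lee_fin -mulrDl ler_wpM2r ?heat_ge0//.
      rewrite -lerBlDl (le_trans (ler_norm _))// distrC (le_trans (lip _ _))//.
  + by move=> y _; rewrite lee_fin mulr_ge0 ?heat_ge0.
  + by move=> y _; rewrite lee_fin mulr_ge0 ?heat_ge0.
Qed.

(** The smoothed integrals agree, and smoothing costs at most [L delta] times the common mass under
    each measure. One inequality suffices, as the hypothesis is symmetric in the two measures. *)
Let lipschitz_le (m1 m2 : {finite_measure set R -> \bar R}) (L : R) (phi : R -> R) :
  (forall a eta : R,
    (\int[m1]_x (1 + cos (a * x + eta))%:E = \int[m2]_x (1 + cos (a * x + eta))%:E)%E) ->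
  0 <= L -> measurable_fun setT phi -> (forall x, 0 <= phi x) ->
  (forall x y, `|phi x - phi y| <= L * `|x - y|) ->
  (\int[m1]_x (phi x)%:E <= \int[m2]_x (phi x)%:E)%E.
Proof.
move=> H L0 mphi phi0 lip.
pose M : R := fine (m1 setT).
have M0 : 0 <= M by rewrite fine_ge0.
have m1E : m1 setT = M%:E by rewrite fineK// fin_num_measure.
have m2E : m2 setT = M%:E by rewrite -m1E (fourier_mass_eq H).
have mphe : measurable_fun setT (fun x : R => (phi x)%:E) by exact/measurable_EFinP.
have ms (e : R) : measurable_fun setT (smooth e phi).
  pose f (x y : R) : \bar R := (phi y * heat e (y - x))%:E.
  apply: (measurable_integral_right mu (f := f)) => //.
    apply/measurable_EFinP; apply: measurable_funM; first exact: measurableT_comp.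
    by apply: measurable_heat2 => //; apply: measurable_funB.
  by move=> x y; rewrite lee_fin mulr_ge0 ?heat_ge0.
have s0 (e x : R) : (0 <= smooth e phi x)%E.
  by apply: integral_ge0 => y _; rewrite lee_fin mulr_ge0 ?heat_ge0.
apply/lee_addgt0Pr => e e0.
(* Chosen so that the total error [2 L M delta] is at most [e]; the [+ 1] keeps the denominator
   positive when [L] or [M] vanishes. *)
pose delta := e / (2 * L * M + 1).
have LM0 : 0 <= 2 * L * M by rewrite !mulr_ge0.
have d0 : 0 < delta by rewrite divr_gt0// ltr_wpDl.
have Ld0 : 0 <= L * delta by rewrite mulr_ge0// ltW.
have D2 : 0 < delta ^+ 2 by rewrite exprn_gt0.
apply: (@le_trans _ _ (\int[m1]_x (smooth (delta ^+ 2) phi x + (L * delta)%:E))%E).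
  apply: ge0_le_integral => //.
  - by move=> x _; rewrite lee_fin.
  - by apply: emeasurable_funD.
  - by move=> x _; have [] := smooth_near x d0 L0 mphi phi0 lip.
rewrite ge0_integralD//.
have -> : (\int[m1]__ (L * delta)%:E = (L * delta)%:E * M%:E)%E by rewrite integral_cst// -m1E.
rewrite (fourier_smooth_eq H)//.
apply: (@le_trans _ _ (\int[m2]_x ((phi x)%:E + (L * delta)%:E) + (L * delta)%:E * M%:E)%E).
  apply: leeD => //; apply: ge0_le_integral => //.
  - by apply: emeasurable_funD.
  - by move=> x _; have [] := smooth_near x d0 L0 mphi phi0 lip.
rewrite ge0_integralD//; last by move=> x _; rewrite lee_fin.
have -> : (\int[m2]__ (L * delta)%:E = (L * delta)%:E * M%:E)%E by rewrite integral_cst// -m2E.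
rewrite -addeA; apply: leeD => //.
rewrite -!EFinM -EFinD lee_fin /delta.
rewrite (_ : _ + _ = e * (2 * L * M / (2 * L * M + 1))); last by field; rewrite gt_eqF// ltr_wpDl.
by rewrite ger_pMr// ler_pdivrMr ?mul1r ?lerDl// ltr_wpDl.
Qed.

(** Lipschitz functions with constant [k], increasing with [k] to the indicator of the open
    half-line []-oo, a[]. *)
Let cut (a : R) (k : nat) (x : R) : R := Num.min 1 (k%:R * Num.max 0 (a - x)).

Let cut_ge0 a k x : 0 <= cut a k x.
Proof. by rewrite /cut le_min ler01 mulr_ge0// le_max lexx. Qed.

Let cut_lip a k x y : `|cut a k x - cut a k y| <= k%:R * `|x - y|.
Proof.
have lip1 (u v : R) : `|Num.max 0 u - Num.max 0 v| <= `|u - v|.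
  rewrite /Num.max; case: (ltP 0 u) => u0; case: (ltP 0 v) => v0; rewrite ?subr0 ?sub0r ?normrN//.
  - by rewrite gtr0_norm// (le_trans _ (ler_norm _))// lerBrDr gerDl.
  - by rewrite gtr0_norm// distrC (le_trans _ (ler_norm _))// lerBrDr gerDl.
  - by rewrite normr0.
have lip2 (u v : R) : `|Num.min 1 u - Num.min 1 v| <= `|u - v|.
  rewrite /Num.min; case: (ltP 1 u) => u0; case: (ltP 1 v) => v0//; rewrite ?subrr ?normr0//.
  - by rewrite !ger0_norm ?subr_ge0 ?(le_trans v0) ?(ltW u0)// lerD2r ltW.
  - by rewrite distrC [leRHS]distrC !ger0_norm ?subr_ge0 ?(le_trans u0) ?(ltW v0)// lerD2r ltW.
apply: (le_trans (lip2 _ _)); rewrite -mulrBr normrM ger0_norm// ler_wpM2l//.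
by apply: (le_trans (lip1 _ _)); rewrite opprB addrC addrA subrK distrC.
Qed.

Let measurable_cut a k : measurable_fun setT (cut a k).
Proof.
apply: measurable_minr => //; apply: measurable_funM => //; apply: measurable_maxr => //.
exact: measurable_funB.
Qed.

Let cvg_cut a (x : R) : (cut a k x)%:E @[k --> \oo] --> (\1_`]-oo, a[%classic x : R)%:E.
Proof.
apply: cvg_EFin; first exact: nearW.
rewrite indicE; case: (boolP (x < a)) => xa; last first.
  rewrite memNset/=; last by rewrite in_itv/=; exact/negP.
  rewrite [X in X @ _](_ : _ = fun=> 0); first exact: cvg_cst.
  apply/funext => k; rewrite /cut/= max_l ?subr_le0 ?leNgt// mulr0 min_r//.
rewrite mem_set/=; last by rewrite in_itv.
apply: cvg_near_cst; near=> k.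
rewrite /cut/= max_r ?subr_ge0 ?ltW// min_l// -ler_pdivrMr ?subr_gt0// mul1r.
by near: k; exact: nbhs_infty_ger.
Unshelve. all: by end_near. Qed.

(** Open half-lines form a generating family closed under intersection, and their measures are
    monotone limits of integrals of the Lipschitz functions [cut]. *)
Lemma fourier_uniqueness (m1 m2 : {finite_measure set R -> \bar R}) :
  (forall a eta : R,
    (\int[m1]_x (1 + cos (a * x + eta))%:E = \int[m2]_x (1 + cos (a * x + eta))%:E)%E) ->
  forall A : set R, measurable A -> m1 A = m2 A.
Proof.
move=> H; have Hs a eta := esym (H a eta).
have half (a : R) : m1 `]-oo, a[%classic = m2 `]-oo, a[%classic.
  have C (m : {finite_measure set R -> \bar R}) :
      (\int[m]_x (cut a k x)%:E @[k --> \oo] --> m `]-oo, a[%classic)%E.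
    rewrite -[m _]mul1e -[`]-oo, a[%classic]setIT -integral_indic// mul1e.
    rewrite (_ : (\int[m]_x _)%E = (\int[m]_x limn (fun k => (cut a k x)%:E))%E); last first.
      by apply: eq_integral => x _; rewrite (cvg_lim _ (@cvg_cut a x)).
    apply: cvg_monotone_convergence => //.
    - by move=> k; exact/measurable_EFinP.
    - by move=> k x _; rewrite lee_fin.
    - move=> x _ k l kl; rewrite lee_fin /cut.
      apply: Order.TotalTheory.le_min2 => //; rewrite ler_wpM2r ?le_max ?lexx//.
      by rewrite ler_nat.
  apply: cvg_unique (C m1) _ => //.
  rewrite (_ : (fun k => _) = (fun k => \int[m2]_x (cut a k x)%:E)%E); first exact: C.
  apply/funext => k; apply/eqP; rewrite eq_le.
  by apply/andP; split; apply: (lipschitz_le (L := k%:R)).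
move=> A mA.
have mG : (measurable : set (set R)) = <<s @RGenInftyO.G R >> by exact: RGenInftyO.measurableE.
have GI : setI_closed (@RGenInftyO.G R).
  move=> _ _ [x ->] [y ->]; exists (Num.min x y).
  by apply/seteqP; split => z /=; rewrite !in_itv/= lt_min => /andP.
have GG n : @RGenInftyO.G R `]-oo, n%:R[%classic by exists n%:R.
have cover : \bigcup_n `]-oo, n%:R[%classic = [set: R].
  rewrite -subTset => x _; exists (Num.bound `|x|) => //=.
  by rewrite in_itv/= (le_lt_trans (ler_norm x))// archi_boundP.
have fin n : (m1 `]-oo, n%:R[%classic < +oo)%E by rewrite ltey_eq fin_num_measure.
have eqG (B : set R) : @RGenInftyO.G R B -> m1 B = m2 B by move=> [x ->]; exact: half.
have := @measure_unique _ R _ _ _ mG GI GG cover m1 m2 eqG fin A mA.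
by [].
Qed.

End fourier_uniqueness.

(** * Gaussian laws and linear combinations of bridge values *)

Section laws.
Context d (T : measurableType d) (R : realType).
Notation mu := (@lebesgue_measure R).

Lemma ge0_integral_law d' (T' : measurableType d') (m : {measure set T -> \bar R})
    (n : {measure set T' -> \bar R}) (X : T -> T') (phi : T' -> \bar R) :
  measurable_fun setT X ->
  (forall A : set T', measurable A -> m (X @^-1` A) = n A) ->
  measurable_fun setT phi -> (forall x, (0 <= phi x)%E) ->
  (\int[m]_w phi (X w) = \int[n]_x phi x)%E.
Proof.
move=> mX h mphi phi0.
transitivity (\int[image_measure m (pack_mfun mX)]_x phi x)%E.
  by rewrite ge0_integral_image_measure.
by apply: eq_measure_integral => A mA _; rewrite -h.
Qed.

Lemma ge0_integral_density (m : {measure set T -> \bar R}) (X : T -> R) (f : R -> R)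
    (phi : R -> \bar R) : measurable_fun setT X ->
  measurable_fun setT f -> (forall x, 0 <= f x) ->
  (forall A : set R, measurable A -> m (X @^-1` A) = (\int[mu]_(x in A) (f x)%:E)%E) ->
  measurable_fun setT phi -> (forall x, (0 <= phi x)%E) ->
  (\int[m]_w phi (X w) = \int[mu]_x (phi x * (f x)%:E))%E.
Proof.
move=> mX mf f0 h mphi phi0.
rewrite -(ge0_integral_weighted_measure mu mf f0)//.
exact: (@ge0_integral_law _ (measurableTypeR R) m (weighted_measure mu mf f0) X).
Qed.

(** The free shift [c] allows [lin_law] to read off both mean and variance by comparing [c = 0] with
    [c = 1], while all integrands stay non-negative. *)
Lemma gaussian_law_square (m : {measure set T -> \bar R}) (X : T -> R) (a s c : R) :
  measurable_fun setT X ->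
  (forall A : set R, measurable A -> m (X @^-1` A) = gaussian_law a s A) ->
  (\int[m]_w ((X w + c) ^+ 2)%:E = (s ^+ 2 + (a + c) ^+ 2)%:E)%E.
Proof.
move=> mX; rewrite /gaussian_law; case: eqP => [-> h|/eqP s0 h].
  have mphi : measurable_fun setT (fun x : R => ((x + c) ^+ 2)%:E).
    by apply/measurable_EFinP; apply: measurable_funX; apply: measurable_funD.
  rewrite (@ge0_integral_law _ R m (\d_a) X (fun x => ((x + c) ^+ 2)%:E))//.
    by rewrite integral_dirac// diracT mul1e expr0n add0r.
  by move=> x; rewrite lee_fin sqr_ge0.
have s2 : 0 < s ^+ 2 by rewrite exprn_even_gt0.
have mphi : measurable_fun setT (fun x : R => ((x + c) ^+ 2)%:E).
  by apply/measurable_EFinP; apply: measurable_funX; apply: measurable_funD.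
rewrite (@ge0_integral_density m X (fun x => heat (s ^+ 2) (x - a)) (fun x => ((x + c) ^+ 2)%:E))//.
- pose k (x : R) : \bar R := (x ^+ 2 * heat (s ^+ 2) x)%:E.
  pose k1 (x : R) : \bar R := ((2 * (a + c))%:E * (x * heat (s ^+ 2) x)%:E)%E.
  pose k2 (x : R) : \bar R := (((a + c) ^+ 2)%:E * (heat (s ^+ 2) x)%:E)%E.
  have i0 : mu.-integrable setT k.
    by apply: integrable_quadratic_heat => // x; rewrite ger0_norm ?sqr_ge0// lerDr.
  have i1' : mu.-integrable setT (fun x : R => (x * heat (s ^+ 2) x)%:E).
    by apply: integrable_quadratic_heat => // x; rewrite ler_norml; apply/andP; split; nra.
  have i1 : mu.-integrable setT k1 by apply: integrableZl.
  have i2' := integrable_heat s2.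
  have i2 : mu.-integrable setT k2 by apply: integrableZl.
  transitivity (\int[mu]_x (k x + (k1 x + k2 x)))%E.
    rewrite -(ge0_integral_shift (- a) (f := fun x => k x + (k1 x + k2 x))%E).
    + apply: eq_integral => x _; rewrite /k /k1 /k2 -!EFinM -!EFinD; congr EFin; ring.
    + apply: emeasurable_funD; [exact: measurable_int i0|].
      by apply: emeasurable_funD; [exact: measurable_int i1|exact: measurable_int i2].
    + move=> x; rewrite /k /k1 /k2 -!EFinM -!EFinD lee_fin.
      rewrite (_ : _ + _ = (x + (a + c)) ^+ 2 * heat (s ^+ 2) x); last by ring.
      by rewrite mulr_ge0 ?sqr_ge0 ?heat_ge0.
  rewrite integralD//; last exact: integrableD.
  rewrite integralD// heat_second_moment// !integralZl// heat_first_moment// mule0 add0e.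
  rewrite (_ : (\int[mu]_x _)%E = 1%E) ?mule1//.
  by rewrite -(integral_heat 0 s2); apply: eq_integral => x _; rewrite subr0.
- by apply: measurable_heat2 => //; apply: measurable_funB.
- by move=> x; exact: heat_ge0.
- by move=> A mA; rewrite h// normal_prob_heat.
- by move=> x; rewrite lee_fin sqr_ge0.
Qed.

Lemma gaussian_law_cos (P : probability T R) (X : T -> R) (s c : R) :
  measurable_fun setT X ->
  (forall A : set R, measurable A -> P (X @^-1` A) = gaussian_law 0 s A) ->
  (\int[P]_w (1 + cos (X w + c))%:E = (1 + cos c * expR (- (s ^+ 2 / 2)))%:E)%E.
Proof.
move=> mX.
have mphi : measurable_fun setT (fun x : R => (1 + cos (x + c))%:E).
  apply/measurable_EFinP; apply: measurable_funD => //; apply: measurableT_comp.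
    by apply: continuous_measurable_fun; exact: continuous_cos.
  exact: measurable_funD.
have phi0 (x : R) : (0 <= (1 + cos (x + c))%:E)%E.
  by rewrite lee_fin -lerBlDl sub0r cos_geN1.
rewrite /gaussian_law; case: eqP => [-> h|/eqP s0 h].
  rewrite (@ge0_integral_law _ R P (\d_(0 : R)) X (fun x => (1 + cos (x + c))%:E))//.
  by rewrite integral_dirac// diracT mul1e add0r expr0n/= mul0r oppr0 expR0 mulr1.
have s2 : 0 < s ^+ 2 by rewrite exprn_even_gt0.
rewrite (@ge0_integral_density P X (heat (s ^+ 2)) (fun x => (1 + cos (x + c))%:E))//.
- under eq_integral do rewrite -EFinM mulrDl mul1r EFinD.
  rewrite integralD//.
  + rewrite (_ : (\int[mu]_x (heat (s ^+ 2) x)%:E)%E = 1%E); last first.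
      by rewrite -(integral_heat 0 s2); apply: eq_integral => x _; rewrite subr0.
    have := integral_cos_heat 1 c s2; rewrite expr1n mul1r [X in _ -> _ = X]EFinD => <-.
    by congr (_ + _)%E; apply: eq_integral => x _; rewrite mul1r.
  + exact: integrable_heat.
  + apply: integrable_quadratic_heat => // [|x].
      apply: measurableT_comp; last exact: measurable_funD.
      by apply: continuous_measurable_fun; exact: continuous_cos.
    by rewrite (@le_trans _ _ 1)// ?lerDl ?sqr_ge0// ler_norml cos_geN1 cos_le1.
- by apply: measurable_heat2.
- by move=> x; exact: heat_ge0.
- move=> A mA; apply: (eq_trans (h A mA)); apply: (eq_trans (normal_prob_heat 0 A s0)).
  by apply: eq_integral => x _; rewrite subr0.
Qed.

End laws.

Section bridge.
Context d (T : measurableType d) (R : realType) (P : probability T R) (b : R -> {RV P >-> R}).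
Hypothesis hb : brownian_bridge b.
Notation mu := (@lebesgue_measure R).
Implicit Types (s t r x : R) (w : T).

(** The bridge is only constrained on [[0, 1]]. Composing it with this projection gives a process
    with continuous paths on the whole line, so time never has to be restricted. *)
Definition clip t : R := Num.max 0 (Num.min 1 t).

Lemma clip_ge0 t : 0 <= clip t. Proof. by rewrite le_max lexx. Qed.
Lemma clip_le1 t : clip t <= 1. Proof. by rewrite ge_max ler01 ge_min lexx. Qed.
Lemma clip_id t : 0 <= t -> t <= 1 -> clip t = t.
Proof. by move=> t0 t1; rewrite /clip min_r// max_r. Qed.
Lemma clip_le s t : s <= t -> clip s <= clip t.
Proof. by move=> st; rewrite /clip le_max2// le_min2. Qed.
Lemma clip_in t : clip t \in `[0, 1].
Proof. by rewrite in_itv/= clip_ge0 clip_le1. Qed.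

Definition bridge_path t w : R := b (clip t) w.
Notation path := bridge_path.

Lemma measurable_path t : measurable_fun setT (path t).
Proof. exact: measurable_funP. Qed.

(** Combinations are lists of pairs (coefficient, time), so that sums of combinations are
    concatenations and the covariance expands over them. *)
Definition bridge_comb (l : seq (R * R)) w : R := \sum_(p <- l) p.1 * path p.2 w.
Notation lin := bridge_comb.

Lemma measurable_lin l : measurable_fun setT (lin l).
Proof.
apply: measurable_sum => p; apply: measurable_funM => //; exact: measurable_path.
Qed.

Lemma lin_gaussian l : exists a s : R, forall A : set R, measurable A ->
  P (lin l @^-1` A) = gaussian_law a s A.
Proof.
case: hb => g _ _ _.
have [a [s [_ h]]] := g (size l) (fun i => (nth (0, 0) l i).1) (fun i => clip (nth (0, 0) l i).2)
   (fun i => clip_in _).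
exists a, s => A mA; rewrite -h//; congr (P (_ @^-1` A)).
by apply/funext => w; rewrite /lin (big_nth (0, 0)) big_mkord.
Qed.

Let path_square t : P.-integrable setT (fun w => (path t w ^+ 2)%:E).
Proof.
have [a [s h]] := lin_gaussian [:: (1, t)].
apply/integrableP; split.
  by apply/measurable_EFinP; apply: measurable_funX; exact: measurable_path.
have := gaussian_law_square 0 (measurable_lin [:: (1, t)]) h.
under eq_integral do rewrite addr0 /lin big_seq1 mul1r.
move=> E; rewrite (_ : (\int[P]_w _)%E = (s ^+ 2 + (a + 0) ^+ 2)%:E) ?ltry// -E.
by apply: eq_integral => w _; rewrite gee0_abs// lee_fin sqr_ge0.
Qed.

Let path_integrable t : P.-integrable setT (fun w => (path t w)%:E).
Proof.
have i1 : P.-integrable setT (fun w => (1 + path t w ^+ 2)%:E).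
  under eq_fun do rewrite EFinD; apply: integrableD => //.
  exact: finite_measure_integrable_cst.
apply: (le_integrable _ _ _ i1) => //.
  by apply/measurable_EFinP; exact: measurable_path.
move=> w _; rewrite !lee_fin [leRHS]ger0_norm ?addr_ge0 ?sqr_ge0// ler_norml.
by apply/andP; split; nra.
Qed.

Let path_prod_integrable s t : P.-integrable setT (fun w => (path s w * path t w)%:E).
Proof.
have i1 : P.-integrable setT (fun w => (path s w ^+ 2 + path t w ^+ 2)%:E).
  by under eq_fun do rewrite EFinD; exact: integrableD.
apply: (le_integrable _ _ _ i1) => //.
  by apply/measurable_EFinP; apply: measurable_funM; exact: measurable_path.
move=> w _; rewrite !lee_fin [leRHS]ger0_norm ?addr_ge0 ?sqr_ge0// ler_norml.
by apply/andP; split; nra.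
Qed.

Definition bridge_cov s t : R := Num.min (clip s) (clip t) - clip s * clip t.

Let path_mean t : (\int[P]_w (path t w)%:E = 0)%E.
Proof. by case: hb => _ + _ _ => /(_ _ (clip_in t)); rewrite unlock. Qed.

Let path_cov s t : (\int[P]_w (path s w * path t w)%:E = (bridge_cov s t)%:E)%E.
Proof.
case: hb => _ m + _ => /(_ _ _ (clip_in s) (clip_in t)) <-.
rewrite covariance.unlock !m ?clip_in// unlock; apply: eq_integral => w _.
by rewrite /path mulrfctE/= !subr0.
Qed.

Definition lin_cov (l l' : seq (R * R)) : R :=
  \sum_(p <- l) \sum_(q <- l') p.1 * q.1 * bridge_cov p.2 q.2.

Let lin_prodE l l' w : (lin l w * lin l' w)%:E =
  (\sum_(p <- l) \sum_(q <- l') (p.1 * q.1)%:E * (path p.2 w * path q.2 w)%:E)%E.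
Proof.
rewrite /lin big_distrlr/= -sumEFin; apply: eq_bigr => p _.
rewrite -sumEFin; apply: eq_bigr => q _.
by rewrite -EFinM mulrACA.
Qed.

Let lin_prod_integrable l l' : P.-integrable setT (fun w => (lin l w * lin l' w)%:E).
Proof.
under eq_fun do rewrite lin_prodE.
apply: integrable_sum => // p _; apply: integrable_sum => // q _; exact: integrableZl.
Qed.

Let lin_prod l l' : (\int[P]_w (lin l w * lin l' w)%:E = (lin_cov l l')%:E)%E.
Proof.
under eq_integral do rewrite lin_prodE.
have i1 (p q : R * R) : P.-integrable setT (fun w => (p.1 * q.1)%:E * (path p.2 w * path q.2 w)%:E)%E.
  exact: integrableZl.
rewrite integral_sum//=; last by move=> p; apply: integrable_sum.
rewrite -sumEFin; apply: eq_bigr => p _.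
rewrite integral_sum//= -sumEFin; apply: eq_bigr => q _.
by rewrite integralZl// path_cov EFinM.
Qed.

Let linE l w : (lin l w)%:E = (\sum_(p <- l) p.1%:E * (path p.2 w)%:E)%E.
Proof. by rewrite /lin -sumEFin; apply: eq_bigr => p _; rewrite EFinM. Qed.

Let lin_integrable l : P.-integrable setT (fun w => (lin l w)%:E).
Proof.
by under eq_fun do rewrite linE; apply: integrable_sum => // p _; exact: integrableZl.
Qed.

Let lin_mean l : (\int[P]_w (lin l w)%:E = 0)%E.
Proof.
under eq_integral do rewrite linE.
rewrite integral_sum//=; last by move=> p; exact: integrableZl.
by rewrite big1// => p _; rewrite integralZl// path_mean mule0.
Qed.

Lemma lin_law l : exists2 s : R, s ^+ 2 = lin_cov l l &
  forall A : set R, measurable A -> P (lin l @^-1` A) = gaussian_law 0 s A.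
Proof.
have [a [s h]] := lin_gaussian l.
have E c : lin_cov l l + c ^+ 2 = s ^+ 2 + (a + c) ^+ 2.
  have := gaussian_law_square c (measurable_lin l) h.
  rewrite (_ : (\int[P]_w _)%E =
      (\int[P]_w ((lin l w * lin l w)%:E + ((2 * c)%:E * (lin l w)%:E + (c ^+ 2)%:E)))%E); last first.
    by apply: eq_integral => w _; rewrite -!EFinM -!EFinD; congr EFin; ring.
  have ic : P.-integrable setT (fun w => ((2 * c)%:E * (lin l w)%:E)%E) by exact: integrableZl.
  have ic2 : P.-integrable setT (fun w => (c ^+ 2)%:E) by exact: finite_measure_integrable_cst.
  have icst : (\int[P]_w (c ^+ 2)%:E = (c ^+ 2)%:E)%E by have := expectation_cst P (c ^+ 2); rewrite unlock.
  rewrite integralD//; last exact: integrableD.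
  rewrite integralD// integralZl// lin_mean mule0 add0e icst.
  by rewrite lin_prod -EFinD => -[].
have a0 : a = 0 by have := E 0; have := E 1; nra.
exists s; first by have := E 0; rewrite a0; lra.
by rewrite a0 in h.
Qed.

Lemma lin_cos l c :
  (\int[P]_w (1 + cos (lin l w + c))%:E = (1 + cos c * expR (- (lin_cov l l / 2)))%:E)%E.
Proof.
have [s <- h] := lin_law l.
exact: (gaussian_law_cos _ (measurable_lin l) h).
Qed.

Lemma lin_cov_cat l1 l2 : lin_cov (l1 ++ l2) (l1 ++ l2) =
  lin_cov l1 l1 + 2 * lin_cov l1 l2 + lin_cov l2 l2.
Proof.
have sym : lin_cov l2 l1 = lin_cov l1 l2.
  rewrite /lin_cov exchange_big/=; apply: eq_bigr => p _; apply: eq_bigr => q _.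
  by rewrite [q.1 * p.1]mulrC /bridge_cov minC [clip q.2 * _]mulrC.
rewrite /lin_cov big_cat/=.
under eq_bigr do rewrite big_cat/=.
under [X in _ + X = _]eq_bigr do rewrite big_cat/=.
rewrite !big_split/= -!/(lin_cov _ _) sym; ring.
Qed.

Lemma lin_cat l1 l2 w : lin (l1 ++ l2) w = lin l1 w + lin l2 w.
Proof. by rewrite /lin big_cat. Qed.

End bridge.

(** * Independence and functionals of the past *)

Lemma adde_cancelr (R : realType) (x y z : \bar R) :
  z \is a fin_num -> (x + z = y + z)%E -> x = y.
Proof. by move=> zfin /(congr1 (fun u => u - z)%E); rewrite !addeK. Qed.

Section independence.
Context d (T : measurableType d) (R : realType).

(** The measure [m] need not have mass 1: it will be [P] weighted by a functional of the past, while
    [n] is the unweighted law of [Y]. The joint image measure is the product because both agree on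
    rectangles. *)
Lemma ge0_integral_indep d1 d2 (T1 : measurableType d1) (T2 : measurableType d2)
    (m : {finite_measure set T -> \bar R}) (n : {sigma_finite_measure set T2 -> \bar R})
    (X : T -> T1) (Y : T -> T2) (f : T1 -> T2 -> \bar R) :
  measurable_fun setT X -> measurable_fun setT Y ->
  (forall A B, measurable A -> measurable B ->
    m (X @^-1` A `&` Y @^-1` B) = (m (X @^-1` A) * n B)%E) ->
  measurable_fun setT (fun p : T1 * T2 => f p.1 p.2) -> (forall x y, (0 <= f x y)%E) ->
  (\int[m]_w f (X w) (Y w) = \int[m]_w \int[n]_y f (X w) y)%E.
Proof.
move=> mX mY XY mf f0.
have mXY : measurable_fun setT (fun w => (X w, Y w)) by exact: measurable_fun_pair.
have fin : (image_measure m (pack_mfun mX) setT < +oo)%E.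
  by rewrite /image_measure /pushforward preimage_setT ltey_eq fin_num_measure.
pose m1 := as_finite_measure fin.
rewrite (@ge0_integral_law _ _ _ _ _ m (m1 \x n)%E (fun w => (X w, Y w)) (fun p => f p.1 p.2))//.
- rewrite fubini_tonelli1//.
  rewrite (@ge0_integral_law _ _ _ _ _ m m1 X (fun x => \int[n]_y f x y)%E)//.
  + exact: (measurable_integral_right n mf f0 measurableT).
  + by move=> x; exact: integral_ge0.
- move=> A mA.
  have RM B C : measurable B -> measurable C ->
    image_measure m (pack_mfun mXY) (B `*` C) = (as_finite_measure fin B * n C)%E by exact: XY.
  exact: (esym (product_measure_unique RM mA)).
Qed.

(** Fourier uniqueness for the images under [X] of the measures with densities [W1] and [W2]: an
    identity checked on cosines of [X] extends to every non-negative measurable [h]. *)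
Lemma weighted_fourier (P : probability T R) (W1 W2 : T -> R) (c1 c2 : R) (X : T -> R) (h : R -> R) :
  measurable_fun setT W1 -> measurable_fun setT W2 -> measurable_fun setT X ->
  (forall w, 0 <= W1 w) -> (forall w, 0 <= W2 w) ->
  (forall w, W1 w <= c1) -> (forall w, W2 w <= c2) ->
  (forall a eta : R, (\int[P]_w ((1 + cos (a * X w + eta)) * W1 w)%:E =
    \int[P]_w ((1 + cos (a * X w + eta)) * W2 w)%:E)%E) ->
  measurable_fun setT h -> (forall x, 0 <= h x) ->
  (\int[P]_w (h (X w) * W1 w)%:E = \int[P]_w (h (X w) * W2 w)%:E)%E.
Proof.
move=> mW1 mW2 mX W10 W20 W1c W2c H mh h0.
have fin (W : T -> R) (c : R) (mW : measurable_fun setT W) (W0 : forall w, 0 <= W w) :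
    (forall w, W w <= c) ->
    (image_measure (weighted_measure P mW W0) (pack_mfun mX) setT < +oo)%E.
  move=> Wc; rewrite /image_measure /pushforward preimage_setT /weighted_measure.
  apply: (@le_lt_trans _ _ (\int[P]_w c%:E)%E).
    by apply: ge0_le_integral => //; [move=> w _; rewrite lee_fin|exact/measurable_EFinP|move=> w _; rewrite lee_fin].
  by have := expectation_cst P c; rewrite unlock => ->; rewrite ltry.
have E (W : T -> R) (c : R) (mW : measurable_fun setT W) (W0 : forall w, 0 <= W w)
    (Wc : forall w, W w <= c) (g : R -> R) : measurable_fun setT g -> (forall x, 0 <= g x) ->
    (\int[as_finite_measure (fin W c mW W0 Wc)]_x (g x)%:E = \int[P]_w (g (X w) * W w)%:E)%E.
  move=> mg g0; transitivity (\int[weighted_measure P mW W0]_w (g (X w))%:E)%E.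
    apply/esym; apply: (@ge0_integral_law _ _ _ _ _ (weighted_measure P mW W0)
        (as_finite_measure (fin W c mW W0 Wc)) X (fun x => (g x)%:E)) => //.
    exact/measurable_EFinP.
  rewrite ge0_integral_weighted_measure//.
  - by apply/measurable_EFinP; exact: measurableT_comp.
  - by move=> w; rewrite lee_fin.
rewrite -(E _ _ mW1 W10 W1c)// -(E _ _ mW2 W20 W2c)//.
apply: eq_measure_integral => A mA _; apply: fourier_uniqueness => // a eta.
rewrite !E//.
all: try by move=> x; rewrite -lerBlDl sub0r cos_geN1.
all: apply: measurable_funD => //; apply: measurableT_comp.
all: try by apply: continuous_measurable_fun; exact: continuous_cos.
all: by apply: measurable_funD => //; exact: measurable_funM.
Qed.

Lemma cos1_ge0 (u : R) : 0 <= 1 + cos u.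
Proof. by rewrite -lerBlDl sub0r cos_geN1. Qed.

Lemma cos1_le2 (u : R) : 1 + cos u <= 2.
Proof. by have := cos_le1 u; lra. Qed.

Lemma measurable_cos1 (f : T -> R) : measurable_fun setT f ->
  measurable_fun setT (fun w => 1 + cos (f w)).
Proof.
move=> mf; apply: measurable_funD => //; apply: measurableT_comp => //.
by apply: continuous_measurable_fun; exact: continuous_cos.
Qed.

(* Product-to-sum formula, arranged so that all terms are non-negative. *)
Lemma integral_cos_product (P : probability T R) (f g W : T -> R) :
  measurable_fun setT f -> measurable_fun setT g -> measurable_fun setT W ->
  (forall w, 0 <= W w) ->
  (\int[P]_w ((1 + cos (f w)) * ((1 + cos (g w)) * W w))%:E + 2%:E * \int[P]_w (W w)%:E =
   (2^-1)%:E * \int[P]_w ((1 + cos (f w + g w)) * W w)%:E +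
   (2^-1)%:E * \int[P]_w ((1 + cos (f w - g w)) * W w)%:E +
   (\int[P]_w ((1 + cos (f w)) * W w)%:E + \int[P]_w ((1 + cos (g w)) * W w)%:E))%E.
Proof.
move=> mf mg mW W0.
have m1 (u : T -> R) : measurable_fun setT u -> measurable_fun setT (fun w => ((1 + cos (u w)) * W w)%:E).
  by move=> mu; apply/measurable_EFinP; apply: measurable_funM => //; exact: measurable_cos1.
have p1 (u : T -> R) w : (0 <= ((1 + cos (u w)) * W w)%:E)%E.
  by rewrite lee_fin mulr_ge0// cos1_ge0.
have mD : measurable_fun setT (fun w => f w + g w) by exact: measurable_funD.
have mB : measurable_fun setT (fun w => f w - g w) by exact: measurable_funB.
have mWe : measurable_fun setT (fun w => (W w)%:E) by exact/measurable_EFinP.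
have mfg : measurable_fun setT (fun w => ((1 + cos (f w)) * ((1 + cos (g w)) * W w))%:E).
  apply/measurable_EFinP; apply: measurable_funM; first exact: measurable_cos1.
  by apply/measurable_EFinP; exact: m1.
rewrite -!ge0_integralZl//; do ?[by move=> w _; exact: (p1 _ w)|exact: m1].
rewrite -!ge0_integralD//.
1: apply: eq_integral => w _; rewrite -!EFinM -!EFinD; congr EFin; rewrite cosD cosB; field.
all: try by move=> w _; do ?[apply: adde_ge0|apply: mule_ge0]; rewrite // lee_fin ?mulr_ge0 ?cos1_ge0.
all: try by repeat (apply: emeasurable_funM || apply: emeasurable_funD); try exact: m1.
all: try exact: m1.
Qed.

End independence.

Section independent_increment.
Context d (T : measurableType d) (R : realType) (P : probability T R) (b : R -> {RV P >-> R}).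
Hypothesis hb : brownian_bridge b.
Notation mu := (@lebesgue_measure R).
Notation lin := (bridge_comb b).
Notation path := (bridge_path b).

Definition scale_lin (a : R) (l : seq (R * R)) := [seq (a * p.1, p.2) | p <- l].

Lemma lin_scale a l w : lin (scale_lin a l) w = a * lin l w.
Proof. by rewrite /bridge_comb big_map/= big_distrr/=; apply: eq_bigr => p _; rewrite mulrA. Qed.

Lemma lin_cov_scale (a a' : R) (l l' : seq (R * R)) :
  lin_cov (scale_lin a l) (scale_lin a' l') = a * a' * lin_cov l l'.
Proof.
rewrite /lin_cov big_map big_distrr/=; apply: eq_bigr => p _.
rewrite big_map big_distrr/=; apply: eq_bigr => q _; ring.
Qed.

Variables (s : R) (lY : seq (R * R)).
Definition past (l : seq (R * R)) := all (fun p => p.2 <= s) l.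
Hypothesis orth : forall l, past l -> lin_cov lY l = 0.

Lemma past_scale a l : past l -> past (scale_lin a l).
Proof. by rewrite /past all_map. Qed.

Lemma past_cat l l' : past (l ++ l') = past l && past l'.
Proof. exact: all_cat. Qed.

(* Independence of the past functional [V] and of [bridge_comb lY], jointly with the
   characteristic functions of the path up to time [s]. *)
Definition past_functional (V : T -> R) := [/\ measurable_fun setT V,
  (forall w, 0 <= V w), (exists c, forall w, V w <= c) &
  forall l eta (k : R -> R), past l -> measurable_fun setT k ->
    (forall x, 0 <= k x) -> (forall x, k x <= 1) ->
    (\int[P]_w ((1 + cos (lin l w + eta)) * (V w * k (lin lY w)))%:E =
     \int[P]_w ((1 + cos (lin l w + eta)) * V w)%:E * \int[P]_w (k (lin lY w))%:E)%E].

Let Ebound (W : T -> R) (c : R) : measurable_fun setT W -> (forall w, 0 <= W w) ->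
  (forall w, W w <= c) -> (\int[P]_w (W w)%:E \is a fin_num)%E.
Proof.
move=> mW W0 Wc; rewrite ge0_fin_numE; last by apply: integral_ge0 => w _; rewrite lee_fin.
apply: (@le_lt_trans _ _ (\int[P]_w c%:E)%E).
  by apply: ge0_le_integral => //; [move=> w _; rewrite lee_fin|exact/measurable_EFinP|move=> w _; rewrite lee_fin].
by have := expectation_cst P c; rewrite unlock => ->; rewrite ltry.
Qed.

Let mlinc l eta : measurable_fun setT (fun w => lin l w + eta).
Proof. by apply: measurable_funD => //; exact: measurable_lin. Qed.

(** Orthogonality removes the cross term from the covariance of a concatenation, hence the joint
    cosine transform of the past and [lY] factors; [weighted_fourier] then replaces cosines of
    [lin lY] by [k]. *)
Lemma past_functional1 : past_functional (cst 1).
Proof.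
split => //; first by exists 1.
move=> l eta k pl mk k0 k1.
have lc : (\int[P]_w ((1 + cos (lin l w + eta)) * cst 1 w)%:E =
           (1 + cos eta * expR (- (lin_cov l l / 2)))%:E)%E.
  by rewrite -(lin_cos hb); apply: eq_integral => w _; rewrite mulr1.
rewrite lc; set e := 1 + _.
have e0 : 0 <= e.
  by rewrite -lee_fin -lc; apply: integral_ge0 => w _; rewrite lee_fin mulr1 cos1_ge0.
have mk' : measurable_fun setT (fun w => (k (lin lY w))%:E).
  by apply/measurable_EFinP; apply: measurableT_comp => //; exact: measurable_lin.
transitivity (\int[P]_w (k (lin lY w) * (1 + cos (lin l w + eta)))%:E)%E.
  by apply: eq_integral => w _; congr EFin; rewrite /=; ring.
(* The weights compared are [1 + cos (lin l w + eta)] and its mean, the constant [e]. *)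
rewrite (@weighted_fourier _ _ _ P _ (cst e) 2 e (lin lY))//.
- rewrite -ge0_integralZl//; last by move=> w _; rewrite lee_fin.
  by apply: eq_integral => w _; rewrite -EFinM mulrC.
- exact/measurable_cos1/mlinc.
- exact: measurable_lin.
- by move=> w; exact: cos1_le2.
move=> a theta.
pose la := scale_lin a lY.
have laE w : a * lin lY w + theta = lin la w + theta by rewrite lin_scale.
under eq_integral do rewrite laE; under [RHS]eq_integral do rewrite laE.
have := @integral_cos_product _ _ _ P (fun w => lin la w + theta) (fun w => lin l w + eta) (cst 1)
   (mlinc _ _) (mlinc _ _) (measurable_cst (1 : R)) (fun=> ler01).
have E1 (u v : T -> R) : u =1 v -> (\int[P]_w ((1 + cos (u w)) * cst 1 w)%:E = \int[P]_w (1 + cos (v w))%:E)%E.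
  by move=> uv; apply: eq_integral => w _; rewrite mulr1 uv.
rewrite (E1 (fun w => lin la w + theta + (lin l w + eta)) (fun w => lin (la ++ l) w + (theta + eta))); last by move=> w; rewrite lin_cat; ring.
rewrite (E1 (fun w => lin la w + theta - (lin l w + eta)) (fun w => lin (la ++ scale_lin (-1) l) w + (theta - eta))); last first.
  by move=> w; rewrite lin_cat lin_scale; ring.
rewrite (E1 (fun w => lin la w + theta) (fun w => lin la w + theta))// (E1 (fun w => lin l w + eta) (fun w => lin l w + eta))// !(lin_cos hb).
rewrite [X in (_ + 2%:E * X)%E](_ : _ = 1%E); last by have := expectation_cst P 1; rewrite unlock.
rewrite !lin_cov_cat.
have cov0 a' : lin_cov la (scale_lin a' l) = 0 by rewrite lin_cov_scale orth// mulr0.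
have cov1 : lin_cov la l = 0.
  by rewrite -(cov0 1) /scale_lin; congr lin_cov; rewrite -[LHS]map_id; apply: eq_map => -[x y]/=; rewrite mul1r.
rewrite cov0 cov1 lin_cov_scale !mulr0 !addr0.
rewrite (_ : -1 * -1 = 1) ?mul1r; last by rewrite mulN1r opprK.
move=> E; apply: (@adde_cancelr _ _ _ (2%:E * 1)%E) => //.
transitivity (\int[P]_w ((1 + cos (lin la w + theta)) * ((1 + cos (lin l w + eta)) * cst 1 w))%:E + 2%:E * 1)%E.
  by congr (_ + _)%E; apply: eq_integral => w _; rewrite mulr1.
rewrite E (_ : (\int[P]_w _)%E = ((1 + cos theta * expR (- (lin_cov la la / 2))) * e)%:E); last first.
  transitivity (\int[P]_w (e%:E * (1 + cos (lin la w + theta))%:E))%E.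
    by apply: eq_integral => w _; rewrite -EFinM mulrC.
  rewrite ge0_integralZl//.
  - by rewrite (lin_cos hb) -EFinM mulrC.
  - by apply/measurable_EFinP; exact/measurable_cos1/mlinc.
rewrite mule1 -!EFinM -!EFinD; congr EFin; rewrite /e.
rewrite (_ : - ((lin_cov la la + lin_cov l l) / 2) = - (lin_cov la la / 2) + - (lin_cov l l / 2)); last by ring.
by rewrite expRD cosD cosB; field.
Qed.

(** When [h] is a cosine, the product formula merges it with the given cosine into cosines of past
    combinations, to which the hypothesis on [V] applies; [weighted_fourier] in the variable
    [path r] gives general [h]. *)
Lemma past_functional_comp r (h : R -> R) c V : r <= s -> past_functional V ->
  measurable_fun setT h -> (forall x, 0 <= h x) -> (forall x, h x <= c) ->
  past_functional (fun w => V w * h (path r w)).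
Proof.
move=> rs [mV V0 [c' Vc] HV] mh h0 hc.
have mhr : measurable_fun setT (fun w => h (path r w)).
  by apply: measurableT_comp => //; exact: measurable_path.
split.
- exact: measurable_funM.
- by move=> w; rewrite mulr_ge0.
- by exists (c' * c) => w; rewrite ler_pM.
move=> l eta k pl mk k0 k1.
have mk' : measurable_fun setT (fun w => k (lin lY w)).
  by apply: measurableT_comp => //; exact: measurable_lin.
have kfin := Ebound mk' (fun=> k0 _) (fun=> k1 _).
pose kap := fine (\int[P]_w (k (lin lY w))%:E)%E.
have kapE : (\int[P]_w (k (lin lY w))%:E = kap%:E)%E by rewrite fineK.
have kap0 : 0 <= kap by apply: fine_ge0; apply: integral_ge0 => w _; rewrite lee_fin.
have mcl l' eta' := measurable_cos1 (mlinc l' eta').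
pose W1 w := (1 + cos (lin l w + eta)) * (V w * k (lin lY w)).
pose W2 w := (1 + cos (lin l w + eta)) * (V w * kap).
have HV' l' eta' : past l' ->
    (\int[P]_w ((1 + cos (lin l' w + eta')) * (V w * k (lin lY w)))%:E =
     \int[P]_w ((1 + cos (lin l' w + eta')) * (V w * kap))%:E)%E.
  move=> pl'; rewrite HV// kapE muleC -ge0_integralZl//.
  - by apply: eq_integral => w _; rewrite -EFinM; congr EFin; ring.
  - by apply/measurable_EFinP; apply: measurable_funM.
  - by move=> w _; rewrite lee_fin mulr_ge0// cos1_ge0.
transitivity (\int[P]_w (h (path r w) * W1 w)%:E)%E.
  by apply: eq_integral => w _; congr EFin; rewrite /W1; ring.
rewrite kapE muleC -ge0_integralZl//; last 2 first.
- by apply/measurable_EFinP; apply: measurable_funM => //; apply: measurable_funM.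
- by move=> w _; rewrite lee_fin !mulr_ge0// cos1_ge0.
transitivity (\int[P]_w (h (path r w) * W2 w)%:E)%E; last first.
  by apply: eq_integral => w _; rewrite -EFinM; congr EFin; rewrite /W2; ring.
have mVk : measurable_fun setT (fun w => V w * k (lin lY w)) by exact: measurable_funM.
have mVkap : measurable_fun setT (fun w => V w * kap) by exact: measurable_funM.
apply: (@weighted_fourier _ _ _ P W1 W2 (2 * (c' * 1)) (2 * (c' * kap)) (path r)) => //.
- exact: measurable_funM.
- exact: measurable_funM.
- by move=> w; rewrite /W1 !mulr_ge0// cos1_ge0.
- by move=> w; rewrite /W2 !mulr_ge0// cos1_ge0.
- by move=> w; rewrite /W1 ler_pM ?mulr_ge0 ?cos1_ge0 ?cos1_le2// ler_pM.
- by move=> w; rewrite /W2 ler_pM ?mulr_ge0 ?cos1_ge0 ?cos1_le2// ler_wpM2r.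
move=> a theta.
have pr : past [:: (a, r)] by rewrite /past/= rs.
have aE w : a * path r w + theta = lin [:: (a, r)] w + theta by rewrite /bridge_comb big_seq1.
under eq_integral do rewrite aE; under [RHS]eq_integral do rewrite aE.
(* The term [2 W] of the product formula is rewritten as the cosine term of the empty combination,
   so that all terms have the form treated by [HV']. *)
have F (W : T -> R) : measurable_fun setT W -> (forall w, 0 <= W w) ->
  (\int[P]_w ((1 + cos (lin [:: (a, r)] w + theta)) * ((1 + cos (lin l w + eta)) * W w))%:E +
     \int[P]_w ((1 + cos (lin [::] w + 0)) * W w)%:E =
   (2^-1)%:E * \int[P]_w ((1 + cos (lin ([:: (a, r)] ++ l) w + (theta + eta))) * W w)%:E +
   (2^-1)%:E * \int[P]_w ((1 + cos (lin ([:: (a, r)] ++ scale_lin (-1) l) w + (theta - eta))) * W w)%:E +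
   (\int[P]_w ((1 + cos (lin [:: (a, r)] w + theta)) * W w)%:E + \int[P]_w ((1 + cos (lin l w + eta)) * W w)%:E))%E.
  move=> mW W0; have := @integral_cos_product _ _ _ P _ _ _ (mlinc [:: (a, r)] theta) (mlinc l eta) mW W0.
  have E1 (u v : T -> R) : u =1 v -> (\int[P]_w ((1 + cos (u w)) * W w)%:E = \int[P]_w ((1 + cos (v w)) * W w)%:E)%E.
    by move=> uv; apply: eq_integral => w _; rewrite uv.
  rewrite (E1 (fun w => lin [:: (a, r)] w + theta + (lin l w + eta)) (fun w => lin ([:: (a, r)] ++ l) w + (theta + eta))); last by move=> w; rewrite lin_cat; ring.
  rewrite (E1 (fun w => lin [:: (a, r)] w + theta - (lin l w + eta)) (fun w => lin ([:: (a, r)] ++ scale_lin (-1) l) w + (theta - eta))); last first.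
    by move=> w; rewrite lin_cat lin_scale; ring.
  move=> <-; congr (_ + _)%E; rewrite -ge0_integralZl//.
  - by apply: eq_integral => w _; rewrite -EFinM /bridge_comb big_nil addr0 cos0; congr EFin; ring.
  - exact/measurable_EFinP.
  - by move=> w _; rewrite lee_fin.
have Vk0 w : 0 <= V w * k (lin lY w) by rewrite mulr_ge0.
have Vkap0 w : 0 <= V w * kap by rewrite mulr_ge0.
have nilfin : (\int[P]_w ((1 + cos (lin [::] w + 0)) * (V w * kap))%:E)%E \is a fin_num.
  apply: (@Ebound _ (2 * (c' * kap))).
  - exact: measurable_funM.
  - by move=> w; rewrite !mulr_ge0// cos1_ge0.
  - by move=> w; rewrite ler_pM ?mulr_ge0 ?cos1_ge0 ?cos1_le2// ler_wpM2r.
apply: (adde_cancelr nilfin).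
rewrite (F _ mVkap Vkap0) -(HV' [::] 0)// (F _ mVk Vk0) !HV'//.
- by rewrite past_cat pr past_scale.
- by rewrite past_cat pr.
Qed.

Lemma past_functional_sum (a1 a2 : R) V1 V2 : 0 <= a1 -> 0 <= a2 ->
  past_functional V1 -> past_functional V2 ->
  past_functional (fun w => a1 * V1 w + a2 * V2 w).
Proof.
move=> a10 a20 [mV1 V10 [c1 V1c] H1] [mV2 V20 [c2 V2c] H2].
split.
- by apply: measurable_funD; exact: measurable_funM.
- by move=> w; rewrite addr_ge0// mulr_ge0.
- by exists (a1 * c1 + a2 * c2) => w; rewrite lerD// ler_wpM2l.
move=> l eta k pl mk k0 k1.
have mcl l' eta' := measurable_cos1 (mlinc l' eta').
have mk' : measurable_fun setT (fun w => k (lin lY w)).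
  by apply: measurableT_comp => //; exact: measurable_lin.
have F (W1 W2 : T -> R) : measurable_fun setT W1 -> measurable_fun setT W2 ->
    (forall w, 0 <= W1 w) -> (forall w, 0 <= W2 w) ->
    (\int[P]_w (a1 * W1 w + a2 * W2 w)%:E =
     a1%:E * \int[P]_w (W1 w)%:E + a2%:E * \int[P]_w (W2 w)%:E)%E.
  move=> mW1 mW2 W10 W20; under eq_integral do rewrite EFinD !EFinM.
  have mE1 : measurable_fun setT (fun w => (W1 w)%:E) by exact/measurable_EFinP.
  have mE2 : measurable_fun setT (fun w => (W2 w)%:E) by exact/measurable_EFinP.
  rewrite ge0_integralD//.
  - by rewrite !ge0_integralZl// => w _; rewrite lee_fin.
  - by move=> w _; rewrite -EFinM lee_fin mulr_ge0.
  - exact: emeasurable_funM.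
  - by move=> w _; rewrite -EFinM lee_fin mulr_ge0.
  - exact: emeasurable_funM.
have p1 (V : T -> R) w : (forall w, 0 <= V w) -> 0 <= (1 + cos (lin l w + eta)) * V w.
  by move=> V0; rewrite mulr_ge0 ?cos1_ge0.
transitivity (\int[P]_w (a1 * ((1 + cos (lin l w + eta)) * (V1 w * k (lin lY w))) +
     a2 * ((1 + cos (lin l w + eta)) * (V2 w * k (lin lY w))))%:E)%E.
  by apply: eq_integral => w _; congr EFin; ring.
rewrite F ?H1 ?H2//; last 4 first.
- by apply: measurable_funM => //; exact: measurable_funM.
- by apply: measurable_funM => //; exact: measurable_funM.
- by move=> w; rewrite !mulr_ge0// cos1_ge0.
- by move=> w; rewrite !mulr_ge0// cos1_ge0.
rewrite !muleA -ge0_muleDl; last 2 first.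
- by rewrite mule_ge0 ?lee_fin//; apply: integral_ge0 => w _; rewrite lee_fin p1.
- by rewrite mule_ge0 ?lee_fin//; apply: integral_ge0 => w _; rewrite lee_fin p1.
congr (_ * _)%E; rewrite -F//.
- by apply: eq_integral => w _; congr EFin; ring.
- exact: measurable_funM.
- exact: measurable_funM.
- by move=> w; rewrite p1.
- by move=> w; rewrite p1.
Qed.

(** Tonelli in time and chance. Together with the previous closure properties it makes polynomials
    in occupation times functionals of the past. *)
Lemma past_functional_integral t (V : R -> T -> R) (c : R) (W : T -> R) : 0 <= t ->
  measurable_fun setT (fun p : R * T => V p.1 p.2) ->
  (forall q w, 0 <= V q w) -> (forall q w, q <= t -> V q w <= c) ->
  (forall q, 0 <= q -> q <= t -> past_functional (V q)) ->
  (forall w, (W w)%:E = \int[mu]_(q in `[0%R, t]) (V q w)%:E)%E ->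
  past_functional W.
Proof.
move=> t0 mV V0 Vc HV WE.
pose f (w : T) (q : R) : \bar R := (V q w)%:E.
have mf : measurable_fun setT (fun p : T * R => f p.1 p.2).
  apply/measurable_EFinP.
  rewrite (_ : (fun _ => _) = (fun p => V p.1 p.2) \o (fun p : T * R => (p.2, p.1)))//.
  by apply: measurableT_comp => //; exact: measurable_fun_pair.
have mW : measurable_fun setT W.
  apply/measurable_EFinP; rewrite (_ : _ \o _ = (fun w => \int[mu]_(q in `[0%R, t]) f w q)%E).
    by apply: measurable_integral_right => // w q; rewrite lee_fin.
  by apply/funext => w; exact: WE.
have W0 w : 0 <= W w by rewrite -lee_fin WE; apply: integral_ge0 => q _; rewrite lee_fin.
have mVq q : measurable_fun setT (V q) by exact: (measurableT_comp mV (pair1_measurable q)).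
have mVw w : measurable_fun setT (fun q => (V q w)%:E).
  by apply/measurable_EFinP; exact: (measurableT_comp mV (pair2_measurable w)).
split => //.
  exists (c * t) => w; rewrite -lee_fin WE.
  apply: (@le_trans _ _ (\int[mu]_(q in `[0%R, t]) c%:E)%E).
    apply: ge0_le_integral => //.
    - by move=> q _; rewrite lee_fin.
    - by apply: measurable_funTS; exact: mVw.
    - by move=> q /=; rewrite in_itv/= => /andP[_ qt]; rewrite lee_fin Vc.
  rewrite integral_cst//= lebesgue_measure_itv/= lte_fin; case: ifPn => _.
    by rewrite -EFinB subr0 -EFinM.
  by rewrite mule0 lee_fin mulr_ge0// (le_trans (V0 0 w))// Vc.
move=> l eta k pl mk k0 k1.
have mcl l' eta' := measurable_cos1 (mlinc l' eta').
have mk' : measurable_fun setT (fun w => k (lin lY w)).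
  by apply: measurableT_comp => //; exact: measurable_lin.
have F (K : T -> R) : measurable_fun setT K -> (forall w, 0 <= K w) ->
    (\int[P]_w (K w * W w)%:E = \int[mu]_(q in `[0%R, t]) \int[P]_w (K w * V q w)%:E)%E.
  move=> mK K0.
  have mKf : measurable_fun setT (fun p : T * R => ((K p.1)%:E * f p.1 p.2)%E).
    by apply: emeasurable_funM => //; apply/measurable_EFinP; exact: measurableT_comp.
  have := @tonelli_domains _ _ _ _ _ P mu (fun w q => (K w)%:E * f w q)%E mKf _ setT `[0%R, t]%classic measurableT.
  move=> <- //; last by move=> w q; rewrite mule_ge0 ?lee_fin.
  apply: eq_integral => w _; rewrite EFinM WE ge0_integralZl//.
  - by apply: measurable_funTS; exact: mVw.
  - by move=> q _; rewrite lee_fin.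
  - by rewrite lee_fin.
have kfin := Ebound mk' (fun=> k0 _) (fun=> k1 _).
have kap0 : 0 <= fine (\int[P]_w (k (lin lY w))%:E)%E.
  by apply: fine_ge0; apply: integral_ge0 => w _; rewrite lee_fin.
transitivity (\int[P]_w (((1 + cos (lin l w + eta)) * k (lin lY w)) * W w)%:E)%E.
  by apply: eq_integral => w _; congr EFin; ring.
rewrite F; last 2 first.
- exact: measurable_funM.
- by move=> w; rewrite mulr_ge0 ?cos1_ge0.
rewrite F//.
rewrite -(fineK kfin) muleC -ge0_integralZl//.
- apply: eq_integral => q; rewrite inE/= in_itv/= => /andP[q0 qt].
  have [_ _ _ Hq] := HV q q0 qt.
  rewrite fineK// muleC -Hq//.
  by apply: eq_integral => w _; congr EFin; ring.
- apply: measurable_funTS.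
  pose g (q : R) (w : T) : \bar R := ((1 + cos (lin l w + eta)) * V q w)%:E.
  apply: (@measurable_integral_right _ _ _ _ _ P g) => //.
  + apply/measurable_EFinP; apply: measurable_funM => //.
    by apply: (measurableT_comp (mcl l eta)).
  + by move=> q w; rewrite lee_fin mulr_ge0 ?cos1_ge0.
- by move=> q _; apply: integral_ge0 => w _; rewrite lee_fin mulr_ge0 ?cos1_ge0.
Qed.

(** Under [P] weighted by [V], the variable [lin lY] is independent of [path r] and keeps its normal
    law. On rectangles, this is the defining property of the past functional [V] times an indicator
    of [path r]. *)
Lemma past_functional_indep r V (v : R) (f : R -> R -> \bar R) : r <= s -> past_functional V ->
  v != 0 -> (forall A : set R, measurable A -> P (lin lY @^-1` A) = normal_prob 0 v A) ->
  measurable_fun setT (fun p : R * R => f p.1 p.2) -> (forall x y, (0 <= f x y)%E) ->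
  (\int[P]_w (f (path r w) (lin lY w) * (V w)%:E) =
   \int[P]_w (\int[mu]_y (f (path r w) y * (heat (v ^+ 2) y)%:E) * (V w)%:E))%E.
Proof.
move=> rs GV v0 lawY mf f0; have [mV V0 [c Vc] HV] := GV.
have v2 : 0 < v ^+ 2 by rewrite exprn_even_gt0.
have fin : (weighted_measure P mV V0 setT < +oo)%E.
  by have := Ebound mV V0 Vc; rewrite ge0_fin_numE// integral_ge0// => w _; rewrite lee_fin.
have mX := measurable_path b r; have mY := measurable_lin b lY.
pose m := as_finite_measure fin.
have E (g : T -> \bar R) : measurable_fun setT g -> (forall w, (0 <= g w)%E) ->
    (\int[m]_w g w = \int[P]_w (g w * (V w)%:E))%E.
  move=> mg g0; rewrite -(ge0_integral_weighted_measure P mV V0)//.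
have rect (A B : set R) : measurable A -> measurable B ->
    (m (path r @^-1` A `&` lin lY @^-1` B) = m (path r @^-1` A) * normal_prob 0 v B)%E.
  move=> mA mB.
  have mXA : measurable (path r @^-1` A) by rewrite -[_ @^-1` _]setTI; exact: mX.
  have mYB : measurable (lin lY @^-1` B) by rewrite -[_ @^-1` _]setTI; exact: mY.
  (* For the empty combination the cosine factor is [1 + cos 0 = 2], which accounts for the factors
     2 below. *)
  have ind (D : set T) : measurable D -> (2%:E * m D = \int[P]_w ((1 + cos (lin [::] w + 0)) * (V w * \1_D w))%:E)%E.
    move=> mD; have -> : m D = (\int[P]_(w in D) (V w)%:E)%E by [].
    rewrite integral_mkcond -ge0_integralZl//.
    - apply: eq_integral => w _; rewrite /bridge_comb big_nil addr0 cos0 patchE indicE.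
      by case: ifP => _; rewrite ?mulr1 ?mulr0 ?mule0 -?EFinM; congr EFin; ring.
    - by apply/(measurable_restrictT _ _).1 => //; apply: measurable_funTS; apply/measurable_EFinP.
    - by move=> w _; apply: erestrict_ge0 => u; rewrite lee_fin.
  have i1 (D : set R) x : \1_D x <= 1 :> R by rewrite indicE; case: (_ \in _).
  have [_ _ _ HVA] := @past_functional_comp r (\1_A) 1 V rs GV (measurable_indic mA) (fun=> ler0n _ _) (i1 _).
  have := HVA [::] 0 (\1_B) isT (measurable_indic mB) (fun=> ler0n _ _) (i1 _).
  have EB : (\int[P]_w (\1_B (lin lY w))%:E = normal_prob 0 v B)%E.
    by rewrite -lawY// -[RHS]mul1e -[_ @^-1` _]setIT -integral_indic// mul1e.
  rewrite EB -ind//= => HH.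
  have : (2%:E * m (path r @^-1` A `&` lin lY @^-1` B) = 2%:E * (m (path r @^-1` A) * normal_prob 0 v B))%E.
    rewrite muleA -HH ind; last exact: measurableI.
    apply: eq_integral => w _; rewrite indicI//= -mulrA.
    by [].
  by move/(congr1 (fun z => (2^-1)%:E * z)%E); rewrite !muleA -!EFinM mulVf// !mul1e.
have := @ge0_integral_indep _ _ _ _ _ _ _ m (normal_prob 0 v) (path r) (lin lY) f mX mY rect mf f0.
have mheat : measurable_fun setT (heat (v ^+ 2)) by exact: measurable_heat2.
have inner x : (\int[normal_prob 0 v]_y f x y = \int[mu]_y (f x y * (heat (v ^+ 2) y)%:E))%E.
  apply: (@ge0_integral_density _ (measurableTypeR R) R (normal_prob 0 v) idfun (heat (v ^+ 2)) (f x)) => //.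
  - exact: measurable_id.
  - by move=> y; exact: heat_ge0.
  - move=> A mA; rewrite preimage_id; apply: (eq_trans (normal_prob_heat 0 A v0)).
    by apply: eq_integral => y _; rewrite subr0.
  - exact: (measurableT_comp mf (pair1_measurable x)).
rewrite !E.
- by move=> ->; apply: eq_integral => w _; rewrite inner.
- apply: (measurableT_comp (f := fun x => \int[normal_prob 0 v]_y f x y)%E) => //.
  exact: (measurable_integral_right (normal_prob 0 v) mf f0 measurableT).
- by move=> w; apply: integral_ge0.
- exact: (measurableT_comp mf (measurable_fun_pair mX mY)).
- by [].
Qed.

End independent_increment.

Lemma iheat_antitone (R : realType) n (t x y : R) : 0 < t -> 0 <= x -> x <= y ->
  (iheat n t y <= iheat n t x)%E.
Proof.
move=> t0; elim: n x y => [|n ih] x y x0 xy.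
  rewrite !iheat0 lee_fin /heat ler_wpM2l ?invr_ge0// ler_expR.
  by rewrite ler_pM2r ?invr_gt0 ?mulr_gt0// lerN2 ler_sqr ?nnegrE// (le_trans x0).
rewrite !iheatS; apply: ge0_le_integral => //.
- by move=> l _; exact: iheat_ge0.
- by apply: measurable_funTS; apply: measurable_iheat => //; exact: measurable_funD.
- by apply: measurable_funTS; apply: measurable_iheat => //; exact: measurable_funD.
- by move=> l /=; rewrite in_itv/= andbT => l0; rewrite ih ?addr_ge0// lerD2r.
Qed.

(* [leb true] is [<=] and [leb false] is [>=]: upper and lower bounds are
   propagated by the same argument. *)
Definition leb (R : realType) (up : bool) (x y : \bar R) : bool :=
  if up then (x <= y)%E else (y <= x)%E.

Section leb.
Context {R : realType}.
Implicit Types (up : bool) (x y z : \bar R).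

Lemma leb_trans up y x z : leb up x y -> leb up y z -> leb up x z.
Proof. by case: up => /= h k; [exact: le_trans h k|exact: le_trans k h]. Qed.

Lemma leb_refl up x : leb up x x.
Proof. by case: up => /=. Qed.

Lemma leb_integral up d (T : measurableType d) (m : {measure set T -> \bar R}) (D : set T)
    (f g : T -> \bar R) : measurable D -> measurable_fun D f -> measurable_fun D g ->
  (forall x : T, (0 <= f x)%E) -> (forall x : T, (0 <= g x)%E) ->
  (forall x : T, D x -> leb up (f x) (g x)) ->
  leb up (\int[m]_(x in D) f x)%E (\int[m]_(x in D) g x)%E.
Proof. by move=> mD mf mg f0 g0; case: up => h; apply: ge0_le_integral. Qed.

Lemma leb_pmul2l up (a x y : \bar R) : (0 <= a)%E -> leb up x y -> leb up (a * x)%E (a * y)%E.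
Proof. by case: up => /= a0 h; exact: lee_wpmul2l. Qed.

Lemma leb_add up (x y x' y' : \bar R) : leb up x y -> leb up x' y' -> leb up (x + x')%E (y + y')%E.
Proof. by case: up => /= h k; exact: leeD. Qed.

End leb.

(** * Markov property of the bridge and the convolution step *)

Section markov.
Context d (T : measurableType d) (R : realType) (P : probability T R) (b : R -> {RV P >-> R}).
Hypothesis hb : brownian_bridge b.
Notation mu := (@lebesgue_measure R).
Notation path := (bridge_path b).
Implicit Types (s t r x z : R).

(** For [s < t], [bridge_ratio] is the regression coefficient of the bridge at [t] on its value at
    [s], [bridge_var] is the residual variance, and [increment] is the residual itself. *)
Definition bridge_ratio s t : R := (1 - t) / (1 - s).
Definition bridge_var s t : R := (t - s) * (1 - t) / (1 - s).
Definition increment s t : seq (R * R) := [:: (1, t); (- bridge_ratio s t, s)].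

(** For [r <= s] the covariances of the bridge at [r] with its values at [t] and [s] are [r (1 - t)]
    and [r (1 - s)]; the ratio of the two does not depend on [r]. *)
Lemma increment_orth s t l : 0 <= s -> s < t -> t < 1 -> past s l ->
  lin_cov (increment s t) l = 0.
Proof.
move=> s0 st t1 pl; have s1 := lt_trans st t1.
rewrite /lin_cov !big_cons big_nil addr0 -big_split/= big_seq big1// => p pin.
have ps : p.2 <= s by move/allP: pl; exact.
have cs : clip s = s by rewrite clip_id// ltW.
have ct : clip t = t by rewrite clip_id ?ltW// (le_lt_trans s0).
have cp : clip p.2 <= s by rewrite -cs clip_le.
rewrite /bridge_cov cs ct !min_r//; last by rewrite (le_trans cp)// ltW.
rewrite /bridge_ratio; field.
by rewrite subr_eq0 gt_eqF.
Qed.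

Lemma increment_var s t : 0 <= s -> s < t -> t < 1 ->
  lin_cov (increment s t) (increment s t) = bridge_var s t.
Proof.
move=> s0 st t1; have s1 := lt_trans st t1.
have cs : clip s = s by rewrite clip_id// ltW.
have ct : clip t = t by rewrite clip_id ?ltW// (le_lt_trans s0).
rewrite /lin_cov !big_cons !big_nil/= /bridge_cov cs ct !minxx minC min_l ?ltW//.
rewrite /bridge_ratio /bridge_var; field.
by rewrite subr_eq0 gt_eqF.
Qed.

Lemma bridge_var_gt0 s t : s < t -> t < 1 -> 0 < bridge_var s t.
Proof.
by move=> st t1; rewrite divr_gt0 ?mulr_gt0 ?subr_gt0// (lt_trans st).
Qed.

Lemma increment_law s t : 0 <= s -> s < t -> t < 1 ->
  exists v, [/\ v != 0, v ^+ 2 = bridge_var s t &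
    forall A : set R, measurable A -> P (bridge_comb b (increment s t) @^-1` A) = normal_prob 0 v A].
Proof.
move=> s0 st t1; have [v vE h] := lin_law hb (increment s t).
rewrite increment_var// in vE.
have v0 : v != 0.
  apply/eqP => v0; have := bridge_var_gt0 st t1.
  by rewrite -vE v0 expr0n ltxx.
by exists v; split => // A mA; rewrite h// /gaussian_law (negbTE v0).
Qed.

(** The bridge as a Doob transform of Brownian motion: its transition density is the heat kernel,
    multiplied by the quotient of [heat (1 - t) x] and [heat (1 - s) z]. *)
Lemma heat_bridge_kernel s t z x : s < t -> t < 1 ->
  heat (bridge_var s t) (x - bridge_ratio s t * z) * heat (1 - s) z =
  heat (t - s) (x - z) * heat (1 - t) x.
Proof.
move=> st t1; have s1 := lt_trans st t1.
have [a0 a1 a2] : [/\ 0 < t - s, 0 < 1 - t & 0 < 1 - s] by rewrite !subr_gt0.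
have v0 := bridge_var_gt0 st t1.
have [b0 b1 b2 w0] := And4 (ltW a0) (ltW a1) (ltW a2) (ltW v0).
have E (u v p q : R) : heat u p * heat v q =
    (Num.sqrt (2 * pi * u) * Num.sqrt (2 * pi * v))^-1 * expR (- p ^+ 2 / (2 * u) - q ^+ 2 / (2 * v)).
  by rewrite /heat mulrACA -expRD -invfM !mulNr.
rewrite !E; congr (_^-1 * expR _).
  rewrite -!sqrtrM ?mulr_ge0 ?invr_ge0 ?pi_ge0//.
  by congr Num.sqrt; rewrite /bridge_var; field; rewrite gt_eqF.
rewrite /bridge_var /bridge_ratio; field.
by rewrite !gt_eqF.
Qed.

Lemma markov s t V (g : R -> \bar R) : 0 <= s -> s < t -> t < 1 ->
  past_functional b s (increment s t) V ->
  measurable_fun setT g -> (forall x, (0 <= g x)%E) ->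
  (\int[P]_w (g (path t w) * (V w)%:E) =
   \int[P]_w (\int[mu]_x (g x * (heat (bridge_var s t) (x - bridge_ratio s t * path s w))%:E) * (V w)%:E))%E.
Proof.
move=> s0 st t1 HV mg g0.
have [v [v0 vE lawY]] := increment_law s0 st t1.
pose f (x y : R) : \bar R := g (y + bridge_ratio s t * x).
have mf : measurable_fun setT (fun p : R * R => f p.1 p.2).
  by apply: measurableT_comp => //; apply: measurable_funD => //; exact: measurable_funM.
have f0 x y : (0 <= f x y)%E by exact: g0.
have := @past_functional_indep _ _ _ P b s (increment s t) s V v f (lexx s) HV v0 lawY mf f0.
have pE w : path t w = bridge_comb b (increment s t) w + bridge_ratio s t * path s w.
  by rewrite /bridge_comb !big_cons big_nil/=; ring.
under eq_integral do rewrite /f -pE.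
move=> h; apply: (eq_trans h) => {h}.
apply: eq_integral => w _; apply: (congr1 (fun u => u * _)%E).
rewrite vE -(ge0_integral_shift (bridge_ratio s t * path s w)
   (f := fun x => g x * (heat (bridge_var s t) (x - bridge_ratio s t * path s w))%:E)%E).
- by apply: eq_integral => y _; rewrite /f addrK.
- apply: emeasurable_funM => //; apply/measurable_EFinP; apply: measurable_heat2 => //.
  exact: measurable_funB.
- by move=> x; rewrite mule_ge0 ?lee_fin ?heat_ge0.
Qed.

Section step.
Variables (up : bool) (V : R -> T -> R) (c : R) (f : R -> R) (cf : R).
Hypothesis mV : measurable_fun setT (fun p : R * T => V p.1 p.2).
Hypothesis mpath : measurable_fun setT (fun p : R * T => path p.1 p.2).
Hypothesis V0 : forall q w, 0 <= V q w.
Hypothesis pastV : forall s t, 0 <= s -> s < t -> t < 1 -> past_functional b s (increment s t) (V s).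
Hypothesis mf : measurable_fun setT f.
Hypothesis f0 : forall x, 0 <= f x.
Hypothesis fcf : forall x, f x <= cf.
Variables (a dd : R) (m : nat).
Hypothesis a0 : 0 <= a.
Hypothesis d0 : 0 <= dd.
Hypothesis HV : forall s (h : R -> \bar R), 0 < s -> s < 1 ->
  measurable_fun setT h -> (forall x, (0 <= h x)%E) ->
  leb up (\int[P]_w (h (path s w) * (V s w * f (path s w))%:E))%E
    (\int[mu]_z (h z * (f z)%:E * (heat (1 - s) z)%:E * (a%:E * iheat m s dd)))%E.

Let mVf : measurable_fun setT (fun p : R * T => V p.1 p.2 * f (path p.1 p.2)).
Proof. by apply: measurable_funM => //; apply: (measurableT_comp mf). Qed.

Let iheat_step t x z : 0 < t -> 
  (\int[mu]_(s in `]0%R, t[) ((heat (t - s) (x - z))%:E * (a%:E * iheat m s dd)) =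
   a%:E * iheat m.+1 t (dd + `|x - z|)%R)%E.
Proof.
move=> t0; rewrite -iheat_convolution// -ge0_integralZl//.
- by apply: eq_integral => s _; rewrite muleCA [(_ * iheat _ _ _)%E]muleC.
- apply: measurable_funTS; apply: emeasurable_funM; first exact: measurable_iheat.
  by apply/measurable_EFinP; apply: measurable_heat2 => //; exact: measurable_funB.
- by move=> s _; rewrite mule_ge0 ?iheat_ge0 ?lee_fin ?heat_ge0.
Qed.

(** The Markov property at time [s] transports the density from [z] to [x]; [heat_bridge_kernel]
    exchanges the factor [heat (1 - s) z] for [heat (t - s) (x - z)] and [heat (1 - t) x]. The
    integral over [s] is then the convolution that raises [iheat m] to [iheat m.+1]. *)
Lemma density_step t (g : R -> \bar R) (W : T -> \bar R) : 0 < t -> t < 1 ->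
  (forall w, W w = \int[mu]_(s in `]0%R, t[) (V s w * f (path s w))%:E)%E ->
  measurable_fun setT g -> (forall x, (0 <= g x)%E) ->
  leb up (\int[P]_w (g (path t w) * W w))%E
    (\int[mu]_x (g x * (heat (1 - t) x)%:E *
       \int[mu]_z ((f z)%:E * (a%:E * iheat m.+1 t (dd + `|x - z|)%R))))%E.
Proof.
move=> t0 t1 WE mg g0.
have mpt := measurable_path b t.
pose F (w : T) (s : R) : \bar R := (g (path t w) * (V s w * f (path s w))%:E)%E.
have mF : measurable_fun setT (fun p : T * R => F p.1 p.2).
  apply: emeasurable_funM.
    by apply: (measurableT_comp mg); apply: (measurableT_comp mpt).
  apply/measurable_EFinP.
  rewrite (_ : (fun _ => _) = (fun p : R * T => V p.1 p.2 * f (path p.1 p.2)) \o (fun p : T * R => (p.2, p.1)))//.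
  by apply: measurableT_comp => //; exact: measurable_fun_pair.
have F0 w s : (0 <= F w s)%E by rewrite mule_ge0 ?lee_fin ?mulr_ge0.
have -> : (\int[P]_w (g (path t w) * W w) = \int[mu]_(s in `]0%R, t[) \int[P]_w F w s)%E.
  rewrite -(tonelli_domains P mu mF)//; apply: eq_integral => w _.
  rewrite WE ge0_integralZl//.
  - apply: measurable_funTS; apply/measurable_EFinP.
    exact: (measurableT_comp mVf (pair2_measurable w)).
  - by move=> s _; rewrite lee_fin mulr_ge0.
pose K (s z : R) : \bar R := (\int[mu]_x (g x * (heat (bridge_var s t) (x - bridge_ratio s t * z))%:E))%E.
have mKi : measurable_fun setT (fun p : (R * R) * R => (g p.2 * (heat (bridge_var p.1.1 t) (p.2 - bridge_ratio p.1.1 t * p.1.2))%:E)%E).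
  apply: emeasurable_funM; first exact: (measurableT_comp mg).
  have m1 : measurable_fun setT (fun p : (R * R) * R => 1 - p.1.1).
    by apply: measurable_funB => //; exact: measurableT_comp.
  apply/measurable_EFinP; apply: measurable_heat2.
    apply: measurable_funM; last exact: (measurableT_comp measurable_invr).
    by apply: measurable_funM => //; apply: measurable_funB => //; exact: measurableT_comp.
  apply: measurable_funB => //; apply: measurable_funM.
    by apply: measurable_funM => //; exact: (measurableT_comp measurable_invr).
  exact: measurableT_comp.
have Ki0 s z x : (0 <= g x * (heat (bridge_var s t) (x - bridge_ratio s t * z))%:E)%E.
  by rewrite mule_ge0 ?lee_fin ?heat_ge0.
have mK : measurable_fun setT (fun p : R * R => K p.1 p.2).
  apply: (@measurable_integral_right _ _ _ _ _ mu (fun (p : R * R) x => (g x * (heat (bridge_var p.1 t) (x - bridge_ratio p.1 t * p.2))%:E)%E)) => //.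
have K0 s z : (0 <= K s z)%E by apply: integral_ge0.
(* The integrand over the time [s] of the last visit, its position [z] and the position [x] at time
   [t]. All later exchanges of integrals are made on this one function. *)
pose G (s z x : R) : \bar R :=
  (g x * (heat (1 - t) x)%:E * ((f z)%:E * ((heat (t - s) (x - z)%R)%:E * (a%:E * iheat m s dd))))%E.
have mG : measurable_fun setT (fun p : (R * R) * R => G p.1.1 p.1.2 p.2).
  apply: emeasurable_funM.
    apply: emeasurable_funM; first exact: (measurableT_comp mg).
    by apply/measurable_EFinP; exact: measurable_heat2.
  apply: emeasurable_funM.
    by apply/measurable_EFinP; apply: (measurableT_comp mf); exact: measurableT_comp.
  apply: emeasurable_funM.
    apply/measurable_EFinP; apply: measurable_heat2.
      by apply: measurable_funB => //; exact: measurableT_comp.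
    by apply: measurable_funB => //; exact: measurableT_comp.
  by apply: emeasurable_funM => //; apply: measurable_iheat => //; exact: measurableT_comp.
have G0 s z x : (0 <= G s z x)%E by rewrite /G !mule_ge0 ?lee_fin ?heat_ge0 ?iheat_ge0.
have GE s z : 0 < s -> s < t ->
    (K s z * (f z)%:E * (heat (1 - s) z)%:E * (a%:E * iheat m s dd) = \int[mu]_x G s z x)%E.
  move=> s0 st; rewrite /K -!muleA muleC -ge0_integralZl//; last 2 first.
  - exact: (measurableT_comp mKi (pair1_measurable (s, z))).
  - by rewrite !mule_ge0 ?lee_fin ?heat_ge0 ?iheat_ge0.
  apply: eq_integral => x _; rewrite /G.
  have E : ((heat (bridge_var s t) (x - bridge_ratio s t * z))%:E * (heat (1 - s) z)%:E =
      (heat (t - s) (x - z))%:E * (heat (1 - t) x)%:E)%E by rewrite -!EFinM heat_bridge_kernel.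
  set C := (a%:E * _)%E; set H := (heat (1 - s) z)%:E in E *; set HB := (heat (bridge_var s t) _)%:E in E *.
  clearbody C H HB.
  rewrite (_ : (_ * _)%E = (g x * (f z)%:E * C * (HB * H))%E); last first.
    by rewrite !muleA [LHS](ACl (4*1*3*5*2)%AC).
  by rewrite E !muleA [LHS](ACl (1*5*2*4*3)%AC).
apply: (@leb_trans _ up (\int[mu]_(s in `]0%R, t[) \int[mu]_z \int[mu]_x G s z x)%E).
  have mG1 : measurable_fun setT (fun p : R * R => \int[mu]_x G p.1 p.2 x)%E.
    by apply: (@measurable_integral_right _ _ _ _ _ mu (fun (p : R * R) x => G p.1 p.2 x)) => // p x; exact: G0.
  apply: leb_integral => //.
  - by apply: measurable_funTS; apply: (measurable_integral_left P mF).
  - apply: measurable_funTS.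
    apply: (@measurable_integral_right _ _ _ _ _ mu (fun s z => \int[mu]_x G s z x)%E) => //.
    by move=> s z; exact: integral_ge0.
  - by move=> s; exact: integral_ge0.
  - by move=> s; apply: integral_ge0 => z _; exact: integral_ge0.
  move=> s /=; rewrite in_itv/= => /andP[s0 st].
  have s1 := lt_trans st t1.
  have pVf := past_functional_comp (lexx s) (pastV (ltW s0) st t1) mf f0 fcf.
  rewrite /F (markov (ltW s0) st t1 pVf mg g0).
  have mKs : measurable_fun setT (K s) by exact: (measurableT_comp mK (pair1_measurable s)).
  have := HV s0 s1 mKs (K0 s).
  by under [X in leb _ _ X]eq_integral do rewrite GE//.
have mG2 (s : R) : measurable_fun setT (fun p : R * R => G s p.1 p.2).
  apply: (measurableT_comp (f := fun p : (R * R) * R => G p.1.1 p.1.2 p.2)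
    (g := fun p : R * R => ((s, p.1), p.2))) => //.
  by apply: measurable_fun_pair => //; exact: measurable_fun_pair.
have mG3 (x : R) : measurable_fun setT (fun p : R * R => G p.1 p.2 x).
  apply: (measurableT_comp (f := fun p : (R * R) * R => G p.1.1 p.1.2 p.2)
    (g := fun p : R * R => (p, x))) => //.
pose H (s x : R) : \bar R := (\int[mu]_z G s z x)%E.
have mH : measurable_fun setT (fun p : R * R => H p.1 p.2).
  apply: (@measurable_integral_right _ _ _ _ _ mu (fun (p : R * R) z => G p.1 z p.2)) => //.
  apply: (measurableT_comp (f := fun p : (R * R) * R => G p.1.1 p.1.2 p.2)
    (g := fun p : (R * R) * R => ((p.1.1, p.2), p.1.2))) => //.
  apply: measurable_fun_pair; last exact: measurableT_comp.
  by apply: measurable_fun_pair => //; exact: measurableT_comp.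
rewrite (_ : (\int[mu]_(s in `]0%R, t[) _)%E = (\int[mu]_(s in `]0%R, t[) \int[mu]_x H s x)%E); last first.
  by apply: eq_integral => s _; exact: (tonelli_domains mu mu (mG2 s) (G0 s) measurableT measurableT).
rewrite (tonelli_domains mu mu mH)//; last by move=> s x; exact: integral_ge0.
rewrite (_ : (\int[mu]_x \int[mu]_(s in `]0%R, t[) H s x)%E = (\int[mu]_x (g x * (heat (1 - t) x)%:E *
       \int[mu]_z ((f z)%:E * (a%:E * iheat m.+1 t (dd + `|x - z|)%R))))%E); first exact: leb_refl.
apply: eq_integral => x _.
rewrite (tonelli_domains mu mu (mG3 x) (fun s z => G0 s z x))//.
have mzi : measurable_fun setT (fun z : R => ((f z)%:E * (a%:E * iheat m.+1 t (dd + `|x - z|)%R))%E).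
  apply: emeasurable_funM; first exact/measurable_EFinP.
  apply: emeasurable_funM => //; apply: measurable_iheat => //; apply: measurable_funD => //.
  by apply: measurableT_comp => //; exact: measurable_funB.
rewrite -ge0_integralZl//.
1: apply: eq_integral => z _; rewrite -(iheat_step x z t0).
1: have msz : measurable_fun setT (fun s : R => ((heat (t - s) (x - z))%:E * (a%:E * iheat m s dd))%E).
1: apply: emeasurable_funM; last by apply: emeasurable_funM => //; exact: measurable_iheat.
1: by apply/measurable_EFinP; apply: measurable_heat2 => //; exact: measurable_funB.
1: rewrite -!ge0_integralZl//.
all: try by apply: measurable_funTS; apply: emeasurable_funM.
all: try by apply: measurable_funTS.
all: try by move=> ? _; rewrite ?mule_ge0 ?lee_fin ?heat_ge0 ?iheat_ge0.
all: try by rewrite ?mule_ge0 ?lee_fin ?heat_ge0 ?iheat_ge0.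
all: try by rewrite ?mule_ge0 ?g0 ?lee_fin ?heat_ge0 ?iheat_ge0.
Qed.

(** The endpoint [t = 1], where there is no further transition to apply: the factor [heat (1 - s) z]
    already is the kernel for the return to [0], so it plays the part of [heat (t - s) (x - z)] at
    [x = 0]. *)
Lemma mass_step (W : T -> \bar R) :
  (forall w, W w = \int[mu]_(s in `]0%R, 1%R[) (V s w * f (path s w))%:E)%E ->
  leb up (\int[P]_w W w)%E
    (\int[mu]_z ((f z)%:E * (a%:E * iheat m.+1 1 (dd + `|z|)%R)))%E.
Proof.
move=> WE.
pose F (w : T) (s : R) : \bar R := (V s w * f (path s w))%:E.
have mF : measurable_fun setT (fun p : T * R => F p.1 p.2).
  apply/measurable_EFinP.
  rewrite (_ : (fun _ => _) = (fun p : R * T => V p.1 p.2 * f (path p.1 p.2)) \o (fun p : T * R => (p.2, p.1)))//.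
  by apply: measurableT_comp => //; exact: measurable_fun_pair.
have F0 w s : (0 <= F w s)%E by rewrite lee_fin mulr_ge0.
under eq_integral do rewrite WE.
rewrite (tonelli_domains P mu mF F0)//.
pose G (s z : R) : \bar R := ((f z)%:E * ((heat (1 - s) z)%:E * (a%:E * iheat m s dd)))%E.
have mG : measurable_fun setT (fun p : R * R => G p.1 p.2).
  apply: emeasurable_funM; first by apply/measurable_EFinP; exact: measurableT_comp.
  apply: emeasurable_funM.
    by apply/measurable_EFinP; apply: measurable_heat2 => //; exact: measurable_funB.
  by apply: emeasurable_funM => //; exact: measurable_iheat.
have G0 s z : (0 <= G s z)%E by rewrite !mule_ge0 ?lee_fin ?heat_ge0 ?iheat_ge0.
apply: (@leb_trans _ up (\int[mu]_(s in `]0%R, 1%R[) \int[mu]_z G s z)%E).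
  apply: leb_integral => //.
  - by apply: measurable_funTS; apply: (measurable_integral_left P mF).
  - by apply: measurable_funTS; apply: (measurable_integral_right mu mG).
  - by move=> s; exact: integral_ge0.
  - by move=> s; exact: integral_ge0.
  move=> s /=; rewrite in_itv/= => /andP[s0 s1].
  have := @HV s (cst 1%E) s0 s1 (measurable_cst _) (fun=> lee01).
  under [X in leb up X _]eq_integral do rewrite mul1e.
  by under [X in leb up _ X]eq_integral do rewrite mul1e -muleA.
rewrite (tonelli_domains mu mu mG G0)//.
rewrite (_ : (\int[mu]_z _)%E = (\int[mu]_z ((f z)%:E * (a%:E * iheat m.+1 1 (dd + `|z|)%R)))%E).
  exact: leb_refl.
apply: eq_integral => z _.
have := iheat_step 0 z ltr01; rewrite sub0r normrN => <-.
have mh : measurable_fun setT (fun s : R => ((heat (1 - s) (- z))%:E * (a%:E * iheat m s dd))%E).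
  apply: emeasurable_funM.
    by apply/measurable_EFinP; apply: measurable_heat2 => //; exact: measurable_funB.
  by apply: emeasurable_funM => //; exact: measurable_iheat.
rewrite -(@ge0_integralZl _ _ _ mu `]0%R, 1%R[%classic (measurable_itv _)
  (fun s => (heat (1 - s) (- z))%:E * (a%:E * iheat m s dd))%E).
- by apply: eq_integral => s _; rewrite heatN.
- exact: measurable_funTS.
- by move=> s _; rewrite !mule_ge0 ?lee_fin ?heat_ge0 ?iheat_ge0.
- by rewrite lee_fin.
Qed.

End step.

(** Replaces a distance to a point of the tent by the distance to its centre. As [iheat] decreases,
    an upper bound takes the smaller distance, cut off at [0], and a lower bound the larger one. *)
Definition shift_dist (up : bool) (eps u : R) : R :=
  if up then Num.max 0 (u - eps) else u + eps.

Lemma measurable_shift_dist up eps (f : R -> R) : measurable_fun setT f ->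
  measurable_fun setT (fun x => shift_dist up eps (f x)).
Proof.
move=> mf; case: up => /=; last exact: measurable_funD.
by apply: measurable_maxr => //; exact: measurable_funB.
Qed.

Lemma shift_dist_ge0 up eps u : 0 <= eps -> 0 <= u -> 0 <= shift_dist up eps u.
Proof. by case: up => /= e0 u0; rewrite ?le_max ?lexx// addr_ge0. Qed.

Lemma leb_localize up (f : R -> R) (p eps a dd t x : R) m : 0 < t -> 0 <= a -> 0 <= dd -> 0 <= eps ->
  measurable_fun setT f -> (forall z, 0 <= f z) ->
  (forall z, f z != 0 -> `|z - p| <= eps) -> (\int[mu]_z (f z)%:E = 1)%E ->
  leb up (\int[mu]_z ((f z)%:E * (a%:E * iheat m t (dd + `|x - z|)%R)))%E
    (a%:E * iheat m t (dd + shift_dist up eps `|x - p|)%R)%E.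
Proof.
move=> t0 a0 dd0 e0 mf f0 fsupp f1.
have sd0 := shift_dist_ge0 up e0 (normr_ge0 (x - p)).
rewrite -[X in leb up _ X](_ : (\int[mu]_z ((a%:E * iheat m t (dd + shift_dist up eps `|x - p|)%R) * (f z)%:E))%E = _); last first.
  rewrite ge0_integralZl//; first by rewrite f1 mule1.
  - exact/measurable_EFinP.
  - by move=> z _; rewrite lee_fin.
  - by rewrite mule_ge0 ?iheat_ge0.
apply: leb_integral => //.
- apply: emeasurable_funM; first exact/measurable_EFinP.
  apply: emeasurable_funM => //; apply: measurable_iheat => //; apply: measurable_funD => //.
  by apply: measurableT_comp => //; exact: measurable_funB.
- by apply: emeasurable_funM => //; exact/measurable_EFinP.
- by move=> z; rewrite !mule_ge0 ?iheat_ge0 ?lee_fin.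
- by move=> z; rewrite !mule_ge0 ?iheat_ge0 ?lee_fin.
move=> z _; rewrite [X in leb up X _]muleC.
have [->|fz] := eqVneq (f z) 0; first by rewrite !mule0; exact: leb_refl.
rewrite ![(_ * (f z)%:E)%E]muleC; apply: leb_pmul2l; first by rewrite lee_fin.
apply: leb_pmul2l; first by rewrite lee_fin.
have zp := fsupp z fz.
have h1 : `|x - z| <= `|x - p| + eps.
  by rewrite (le_trans (ler_distD p x z))// lerD2l distrC.
have h2 : `|x - p| <= `|x - z| + eps.
  by rewrite (le_trans (ler_distD z x p))// lerD2l.
case: up {sd0} => /=; apply: iheat_antitone => //; rewrite ?addr_ge0// ?lerD2l ?le_max ?lexx//.
by rewrite ge_max normr_ge0/= lerBlDr.
Qed.

End markov.

Lemma continuous_clip (R : realType) : continuous (@clip R).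
Proof.
move=> t; rewrite /clip; apply: continuous_max; first exact: cvg_cst.
by apply: continuous_min; [exact: cvg_cst|exact: cvg_id].
Qed.

Lemma clip_clip (R : realType) (t : R) : clip (clip t) = clip t.
Proof. by rewrite clip_id// ?clip_ge0// clip_le1. Qed.

Lemma continuous_comp_clip (R : realType) (f : R -> R) :
  {within `[0, 1], continuous f} -> continuous (f \o @clip R).
Proof.
move=> /subspace_continuousP cf t.
apply: (cvg_comp _ _ _ (cf (clip t) (clip_in t))) => U /= hU.
have inA (s : R) : `[0, 1]%classic (clip s) by exact: clip_in.
have h : nbhs t [set s | `[0, 1]%classic (clip s) -> U (clip s)] by exact: continuous_clip hU.
have : nbhs t [set s | U (clip s)] by apply: filterS h => s; apply.
by [].
Qed.

(** Continuity in time upgrades measurability at each time to joint measurability. The sigma-algebra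
    on [T] is arbitrary because the one generated by the bridge is used as well. *)
Lemma measurable_clipped_process d (T : measurableType d) (R : realType) (X : R -> T -> R) :
  (forall t, measurable_fun setT (X t)) -> (forall w, continuous (X^~ w)) ->
  (forall t w, X (clip t) w = X t w) ->
  measurable_fun setT (fun p : R * T => X p.1 p.2).
Proof.
move=> mX cX clX.
(* Time discretization [floor(n t)/n]. *)
pose D (n m : nat) : set R := [set t | m%:R <= n%:R * clip t < m.+1%:R].
have mclip : measurable_fun setT (@clip R).
  by apply: measurable_maxr => //; exact: measurable_minr.
have mD n m : measurable (D n m).
  have -> : D n m = (fun t => n%:R * clip t) @^-1` `[m%:R, m.+1%:R[%classic.
    by apply/seteqP; split => t /=; rewrite /D/= in_itv.
  by rewrite -[_ @^-1` _]setTI; apply: measurable_funM.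
pose Y n (p : R * T) : R := \sum_(m < n.+1) \1_(D n m) p.1 * X (m%:R / n%:R) p.2.
apply: (@measurable_fun_cvg _ _ _ setT Y) => [n|[t w] _].
  apply: measurable_sum => m; apply: measurable_funM.
    by apply: measurableT_comp => //; exact: measurable_indic.
  exact: measurableT_comp.
rewrite /= -(clX t).
pose k n := Num.truncn (n%:R * clip t).
have kn n : (0 < n)%N -> Y n (t, w) = X ((k n)%:R / n%:R) w.
  move=> n0; have nt0 : 0 <= n%:R * clip t by rewrite mulr_ge0 ?clip_ge0.
  have kD : D n (k n) t by exact: truncn_itv nt0.
  have kn : (k n < n.+1)%N.
    rewrite ltnS -(@ler_nat R) (le_trans _ (_ : n%:R * clip t <= _))//.
      by case/andP: kD.
    by rewrite ger_pMr ?ltr0n// clip_le1.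
  rewrite /Y (bigD1 (Ordinal kn))//= big1 ?addr0.
    by rewrite indicE mem_set// mul1r.
  move=> m mk; rewrite indicE memNset ?mul0r//= => /andP[h1 h2].
  move/andP: kD => [h3 h4]; move/eqP: mk; apply; apply/val_inj => /=.
  have a1 : (m < (k n).+1)%N by rewrite -(ltr_nat R) (le_lt_trans h1 h4).
  have a2 : (k n < m.+1)%N by rewrite -(ltr_nat R) (le_lt_trans h3 h2).
  by apply/eqP; rewrite eqn_leq; apply/andP; split.
have ck : (k n)%:R / n%:R @[n --> \oo] --> clip t.
  apply/cvgrPdist_le => e e0; near=> n.
  have n0 : (0 < n)%N by near: n; exists 1%N.
  have nR : 0 < n%:R :> R by rewrite ltr0n.
  have nt0 : 0 <= n%:R * clip t by rewrite mulr_ge0 ?clip_ge0.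
  have h1 : (k n)%:R <= n%:R * clip t by rewrite truncn_le.
  have h2 : n%:R * clip t < (k n).+1%:R by rewrite truncnS_gt.
  rewrite ger0_norm; last by rewrite subr_ge0 ler_pdivrMr// mulrC.
  rewrite lerBlDr -lerBlDl.
  have : 1 <= e * n%:R by rewrite -ler_pdivrMl// mulr1; near: n; exact: nbhs_infty_ger.
  move=> en; rewrite ler_pdivlMr// mulrBl.
  rewrite -natr1 in h2.
  by rewrite lerBlDr (le_trans (ltW _ : _ <= (k n)%:R + 1)) ?lerD2l// mulrC.
apply: (@cvg_trans _ (X ((k n)%:R / n%:R) w @[n --> \oo])).
  apply: near_eq_cvg; near=> n; rewrite kn//; near: n; exists 1%N => //.
by apply: (cvg_comp _ (X^~ w) ck); exact: cX.
Unshelve. all: by end_near. Qed.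

(** * Occupation times *)
Section occupation.
Context d (T : measurableType d) (R : realType) (P : probability T R) (b : R -> {RV P >-> R}).
Hypothesis hb : brownian_bridge b.
Notation mu := (@lebesgue_measure R).
Notation path := (bridge_path b).
Implicit Types (s t q : R) (w : T) (f phi : R -> R).

Lemma continuous_path w : continuous (path^~ w).
Proof. by case: hb => _ _ _ c; exact: (continuous_comp_clip (c w)). Qed.

Lemma measurable_path_pair : measurable_fun setT (fun p : R * T => path p.1 p.2).
Proof.
apply: measurable_clipped_process.
- exact: measurable_path.
- exact: continuous_path.
- by move=> t w; rewrite /bridge_path clip_clip.
Qed.

Definition occ f t w : R := (\int[mu]_(q in `[0%R, t]) f (path q w))%R.

Section one_function.
Variables (f : R -> R) (c : R).
Hypothesis cf : continuous f.
Hypothesis f0 : forall x, 0 <= f x.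
Hypothesis fc : forall x, f x <= c.

Let c0 : 0 <= c. Proof. exact: le_trans (f0 0) (fc 0). Qed.

Lemma continuous_fpath w : continuous (fun q => f (path q w)).
Proof.
by move=> q; apply: (@cvg_comp _ _ _ (path^~ w) f); [exact: continuous_path|exact: cf].
Qed.

Let mf : measurable_fun setT f.
Proof. exact: continuous_measurable_fun. Qed.

Lemma measurable_fpath : measurable_fun setT (fun p : R * T => f (path p.1 p.2)).
Proof. by apply: (measurableT_comp mf); exact: measurable_path_pair. Qed.

Let mfq w : measurable_fun setT (fun q : R => (f (path q w))%:E).
Proof. by apply/measurable_EFinP; exact: (measurableT_comp measurable_fpath (pair2_measurable w)). Qed.

Let int_le t w : 0 <= t -> (\int[mu]_(q in `[0%R, t]) (f (path q w))%:E <= (c * t)%:E)%E.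
Proof.
move=> t0; apply: (@le_trans _ _ (\int[mu]_(q in `[0%R, t]) c%:E)%E).
  apply: ge0_le_integral => //.
  - by move=> q _; rewrite lee_fin.
  - by apply: measurable_funTS; exact: mfq.
  - by move=> q _; rewrite lee_fin.
rewrite integral_cst//= lebesgue_measure_itv/= lte_fin; case: ifPn => _.
  by rewrite -EFinB subr0 -EFinM.
by rewrite mule0 lee_fin mulr_ge0.
Qed.

Let fin t w : (\int[mu]_(q in `[0%R, t]) (f (path q w))%:E \is a fin_num)%E.
Proof.
have [t0|t0] := leP 0 t; last by rewrite set_itv_ge ?integral_set0// -leNgt bnd_simp.
rewrite ge0_fin_numE; last by apply: integral_ge0 => q _; rewrite lee_fin.
by rewrite (le_lt_trans (int_le w t0))// ltry.
Qed.

Lemma occE t w : (occ f t w)%:E = (\int[mu]_(q in `[0%R, t]) (f (path q w))%:E)%E.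
Proof. by rewrite /occ /Rintegral fineK. Qed.

Lemma occ_ge0 t w : 0 <= occ f t w.
Proof. by rewrite -lee_fin occE; apply: integral_ge0 => q _; rewrite lee_fin. Qed.

Lemma occ_le t w : 0 <= t -> occ f t w <= c * t.
Proof. by move=> t0; rewrite -lee_fin occE int_le. Qed.

Lemma occ_neg t w : t < 0 -> occ f t w = 0.
Proof. by move=> t0; rewrite /occ set_itv_ge ?Rintegral_set0// -leNgt bnd_simp. Qed.

Lemma occ_le1 t w : t <= 1 -> occ f t w <= c.
Proof.
move=> t1; have [t0|t0] := leP 0 t; last by rewrite occ_neg.
by rewrite (le_trans (occ_le w t0))// ler_piMr.
Qed.

Lemma occ0 w : occ f 0 w = 0.
Proof. by apply/eqP; rewrite eq_le occ_ge0 andbT (le_trans (occ_le w (lexx 0)))// mulr0. Qed.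

Let occ_integrable t w : mu.-integrable `[0%R, t] (EFin \o (fun q => f (path q w))).
Proof.
apply/integrableP; split; first by apply: measurable_funTS; exact: mfq.
rewrite (_ : (\int[mu]_(x in _) _)%E = (occ f t w)%:E) ?ltry// occE.
by apply: eq_integral => q _; rewrite gee0_abs// lee_fin.
Qed.

Lemma is_derive_occ t w : 0 < t -> is_derive t 1 (occ f ^~ w) (f (path t w)).
Proof.
move=> t0.
have tu : t < t + 1 by rewrite ltrDl.
have ii := occ_integrable (t + 1) w.
have [h1 h2] := @continuous_FTC1_closed _ (fun q => f (path q w)) 0 t (t + 1) tu ii t0 (@continuous_fpath w t).
apply: DeriveDef; first exact: h1.
by move: h2; rewrite derive1E.
Qed.

Lemma cvg_occ0 w : occ f ^~ w t @[t --> 0^'+] --> (0 : R).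
Proof.
apply: cvg_at_right_filter.
exact: (parameterized_integral_cvg_left ltr01 (occ_integrable 1 w)).
Qed.

Lemma measurable_occ : measurable_fun setT (fun p : R * T => occ f p.1 p.2).
Proof.
(* The domain [0 <= q <= t] depends on [t]; as a product of indicators it becomes a jointly
   measurable factor of the integrand. *)
pose h (p : R * T) (q : R) : \bar R :=
  (f (path q p.2) * (\1_`[0%R, +oo[%classic q * \1_`[0%R, +oo[%classic (p.1 - q)))%:E.
have mh : measurable_fun setT (fun x : (R * T) * R => h x.1 x.2).
  apply/measurable_EFinP; apply: measurable_funM.
    apply: (measurableT_comp (f := fun p : R * T => f (path p.1 p.2)) (g := fun x : (R * T) * R => (x.2, x.1.2))).
      exact: measurable_fpath.
    by apply: measurable_fun_pair => //; exact: measurableT_comp.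
  apply: measurable_funM.
    by apply: measurableT_comp => //; exact: measurable_indic.
  apply: (measurableT_comp (f := \1_`[0%R, +oo[%classic : R -> R)).
    exact: measurable_indic.
  by apply: measurable_funB => //; exact: measurableT_comp.
apply/measurable_EFinP.
rewrite (_ : _ \o _ = (fun p => \int[mu]_q h p q)%E).
  apply: (measurable_integral_right mu mh) => //.
  by move=> p q; rewrite lee_fin !mulr_ge0// indicE.
apply/funext => -[t w] /=; rewrite occE integral_mkcond; apply: eq_integral => q _.
rewrite /h/= patchE !indicE !mem_setE/= !in_itv/= !andbT subr_ge0.
by case: (0 <= q); case: (q <= t); rewrite /= ?mulr1 ?mulr0 ?mul0r ?mulr0.
Qed.

End one_function.

(** The product is the integral of its time derivative, which singles out the latest visit: to the
    support of [f] in the first term, of [phi] in the second. For [n = 0] the predecessor does no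
    harm, its term having the factor [0]. *)
Lemma occ_power f phi (c c' : R) n t w : continuous f -> continuous phi ->
  (forall x, 0 <= f x) -> (forall x, 0 <= phi x) ->
  (forall x, f x <= c) -> (forall x, phi x <= c') -> 0 < t ->
  (occ f t w ^+ n * occ phi t w)%:E =
  (\int[mu]_(q in `]0%R, t[) (n%:R * (occ f q w ^+ n.-1 * occ phi q w) * f (path q w) +
     occ f q w ^+ n * phi (path q w))%:E)%E.
Proof.
move=> cf cphi f0 phi0 fc phic t0.
pose F q : R := occ f q w ^+ n * occ phi q w.
pose F' q : R := n%:R * (occ f q w ^+ n.-1 * occ phi q w) * f (path q w) +
     occ f q w ^+ n * phi (path q w).
have dF q : 0 < q -> is_derive q 1 F (F' q).
  move=> q0.
  have h1 := is_derive_occ cf f0 fc w q0.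
  have h2 := is_derive_occ cphi phi0 phic w q0.
  have h := is_deriveM (is_deriveX n h1) h2.
  rewrite (_ : F = (occ f ^~ w) ^+ n * (occ phi ^~ w)); last by apply/funext => x; rewrite mulrfctE exprfctE.
  by apply: (is_derive_eq h); rewrite /GRing.scale/= exprfctE /F'; ring.
have co (g : R -> R) (c1 q : R) : continuous g -> (forall x, 0 <= g x) -> (forall x, g x <= c1) -> 0 < q ->
    occ g x w @[x --> q] --> occ g q w.
  by move=> cg g0 gc q0; exact: (is_derive_cvg (is_derive_occ cg g0 gc w q0)).
rewrite (@ge0_FTC2_oo R F' F 0 t 0 (F t)) ?subr0//.
- move=> q _; rewrite /F' addr_ge0// !mulr_ge0//; first [exact: exprn_ge0 (occ_ge0 cf f0 fc q w) | exact: (occ_ge0 cphi phi0 phic)].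
- move=> q /[!in_itv]/= /andP[q0 _].
  have hf := co f c q cf f0 fc q0; have hp := co phi c' q cphi phi0 phic q0.
  have pw (k : nat) : (occ f x w ^+ k) @[x --> q] --> occ f q w ^+ k.
    by apply: (cvg_comp _ (fun z : R => z ^+ k) hf); exact: exprn_continuous.
  apply: cvgD; apply: cvgM => //.
  + apply: cvgM; first exact: cvg_cst.
    by apply: cvgM.
  + exact: continuous_fpath.
  + exact: continuous_fpath.
- by move=> q /[!in_itv]/= /andP[q0 _]; exact: dF.
- rewrite -[X in _ --> X](mulr0 (0 ^+ n)).
  apply: cvgM; last exact: (cvg_occ0 cphi phi0 phic).
  by apply: (cvg_comp _ (fun z : R => z ^+ n) (cvg_occ0 cf f0 fc w)); exact: exprn_continuous.
- apply: cvg_at_left_filter; exact: is_derive_cvg (dF t t0).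
Qed.

Lemma occ_powerS f (c : R) n t w : continuous f -> (forall x, 0 <= f x) ->
  (forall x, f x <= c) -> 0 < t ->
  (occ f t w ^+ n.+1)%:E =
  (\int[mu]_(q in `]0%R, t[) (n.+1%:R * occ f q w ^+ n * f (path q w))%:E)%E.
Proof.
move=> cf f0 fc t0; rewrite exprSr (occ_power n w cf cf f0 f0 fc fc t0).
apply: eq_integral => q _; congr EFin.
by case: n => [|n] /=; rewrite ?exprSr -?natr1; ring.
Qed.

End occupation.

Section past_occupation.
Context d (T : measurableType d) (R : realType) (P : probability T R) (b : R -> {RV P >-> R}).
Hypothesis hb : brownian_bridge b.
Notation mu := (@lebesgue_measure R).
Notation path := (bridge_path b).
Notation occ := (occ b).

Lemma integral_itvoo_itvcc (t : R) (h : R -> \bar R) : measurable_fun setT h ->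
  (\int[mu]_(q in `]0%R, t[) h q = \int[mu]_(q in `[0%R, t]) h q)%E.
Proof.
move=> mh; rewrite -integral_itv_bndo_bndc; last exact: measurable_funTS.
by rewrite -integral_itv_obnd_cbnd//; exact: measurable_funTS.
Qed.

Lemma measurable_occ_t (f : R -> R) (c t : R) : continuous f -> (forall x, 0 <= f x) ->
  (forall x, f x <= c) -> measurable_fun setT (occ f t).
Proof.
move=> cf f0 fc; have h := measurable_occ hb cf f0 fc.
exact: (measurableT_comp h (pair1_measurable t)).
Qed.

Variables (s : R) (lY : seq (R * R)).
Hypothesis s1 : s <= 1.
Hypothesis orth : forall l, past s l -> lin_cov lY l = 0.

Let pfun := past_functional b s lY.

Let past_scale1 (a : R) V : 0 <= a -> pfun V -> pfun (fun w => a * V w).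
Proof.
move=> a0 HV; rewrite (_ : (fun _ => _) = (fun w => a * V w + 0 * V w)).
  exact: past_functional_sum.
by apply/funext => w; rewrite mul0r addr0.
Qed.

(** By induction: [occ_powerS] writes the next power as a time integral of the previous one times
    [f (path r)], and past functionals are closed under both operations. *)
Lemma past_occ_power (f : R -> R) (c : R) n q : continuous f -> (forall x, 0 <= f x) ->
  (forall x, f x <= c) -> 0 <= q -> q <= s -> pfun (fun w => occ f q w ^+ n).
Proof.
move=> cf f0 fc; have mf := continuous_measurable_fun cf.
have mo := measurable_occ hb cf f0 fc.
have c0 : 0 <= c by exact: le_trans (f0 0) (fc 0).
elim: n q => [|n ih] q q0 qs.
  rewrite (_ : (fun _ => _) = cst 1); last by apply/funext => w; rewrite expr0.
  exact: past_functional1.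
pose V r w := n.+1%:R * (occ f r w ^+ n * f (path r w)).
have mV : measurable_fun setT (fun p : R * T => V p.1 p.2).
  apply: measurable_funM => //; apply: measurable_funM; first exact: measurable_funX.
  exact: (measurable_fpath hb cf).
apply: (@past_functional_integral _ _ _ P b s lY q V (n.+1%:R * (c ^+ n * c))) => //.
- by move=> r w; rewrite !mulr_ge0// exprn_ge0// (occ_ge0 hb cf f0 fc).
- move=> r w rq; rewrite ler_wpM2l// ler_pM// ?exprn_ge0 ?(occ_ge0 hb cf f0 fc)//.
  by rewrite lerXn2r ?nnegrE ?(occ_ge0 hb cf f0 fc)// (occ_le1 hb cf f0 fc)// (le_trans rq)// (le_trans qs).
- move=> r r0 rq; have rs := le_trans rq qs.
  by apply: past_scale1 => //; exact: (past_functional_comp rs (ih r r0 rs) mf f0 fc).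
move=> w; move: q0; rewrite le_eqVlt => /predU1P[<-|q0].
  by rewrite set_itv1 integral_set1 (occ0 hb cf f0 fc) expr0n.
rewrite (occ_powerS hb n w cf f0 fc q0) integral_itvoo_itvcc.
  by apply: eq_integral => r _; rewrite /V mulrA.
apply/measurable_EFinP; under eq_fun do rewrite -mulrA.
exact: (measurableT_comp mV (pair2_measurable w)).
Qed.

Lemma past_occ_prod (f phi : R -> R) (c c' : R) n q : continuous f -> continuous phi ->
  (forall x, 0 <= f x) -> (forall x, 0 <= phi x) ->
  (forall x, f x <= c) -> (forall x, phi x <= c') -> 0 <= q -> q <= s ->
  pfun (fun w => occ f q w ^+ n * occ phi q w).
Proof.
move=> cf cphi f0 phi0 fc phic.
have mf := continuous_measurable_fun cf; have mphi := continuous_measurable_fun cphi.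
have mo := measurable_occ hb cf f0 fc; have mp := measurable_occ hb cphi phi0 phic.
have c0 : 0 <= c by exact: le_trans (f0 0) (fc 0).
have c'0 : 0 <= c' by exact: le_trans (phi0 0) (phic 0).
have of0 := occ_ge0 hb cf f0 fc; have op0 := occ_ge0 hb cphi phi0 phic.
have ofc := occ_le1 hb cf f0 fc; have opc := occ_le1 hb cphi phi0 phic.
elim: n q => [|n ih] q q0 qs.
  rewrite (_ : (fun _ => _) = (fun w => occ phi q w ^+ 1)); last by apply/funext => w; rewrite expr0 mul1r.
  exact: (past_occ_power 1 cphi phi0 phic).
pose V r w := n.+1%:R * (occ f r w ^+ n * occ phi r w * f (path r w)) +
  1 * (occ f r w ^+ n.+1 * phi (path r w)).
have mV : measurable_fun setT (fun p : R * T => V p.1 p.2).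
  apply: measurable_funD; apply: measurable_funM => //; apply: measurable_funM.
  - by apply: measurable_funM => //; exact: measurable_funX.
  - exact: (measurable_fpath hb cf).
  - exact: measurable_funX.
  - exact: (measurable_fpath hb cphi).
apply: (@past_functional_integral _ _ _ P b s lY q V
    (n.+1%:R * (c ^+ n * c' * c) + 1 * (c ^+ n.+1 * c'))) => //.
- by move=> r w; rewrite addr_ge0// !mulr_ge0// exprn_ge0.
- move=> r w rq; have r1 : r <= 1 by rewrite (le_trans rq)// (le_trans qs).
  have X k : occ f r w ^+ k <= c ^+ k by rewrite lerXn2r ?nnegrE// ofc.
  rewrite lerD// ler_wpM2l//; first by rewrite ler_pM ?mulr_ge0 ?exprn_ge0// ler_pM ?exprn_ge0 ?opc.
  by rewrite ler_pM ?exprn_ge0.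
- move=> r r0 rq; have rs := le_trans rq qs.
  apply: past_functional_sum => //.
  + exact: (past_functional_comp rs (ih r r0 rs) mf f0 fc).
  + exact: (past_functional_comp rs (past_occ_power n.+1 cf f0 fc r0 rs) mphi phi0 phic).
move=> w; move: q0; rewrite le_eqVlt => /predU1P[<-|q0].
  by rewrite set_itv1 integral_set1 (occ0 hb cf f0 fc) expr0n/= mul0r.
rewrite (occ_power hb n.+1 w cf cphi f0 phi0 fc phic q0) integral_itvoo_itvcc.
  by apply: eq_integral => r _; rewrite /V mul1r !mulrA.
apply/measurable_EFinP.
rewrite (_ : (fun _ => _) = (fun r => V r w)); last by apply/funext => r; rewrite /V mul1r !mulrA.
exact: (measurableT_comp mV (pair2_measurable w)).
Qed.

End past_occupation.

(** * Bounds on densities at a fixed time and their propagation *)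

Section densities.
Context d (T : measurableType d) (R : realType) (P : probability T R) (b : R -> {RV P >-> R}).
Hypothesis hb : brownian_bridge b.
Notation mu := (@lebesgue_measure R).
Notation path := (bridge_path b).
Notation occ := (occ b).
Implicit Types (up : bool).

(* [F t x / heat t x] bounds the expectation of [V t] given [path t = x], up
   to the constant in the density [sqrt (2 pi) heat t x * heat (1 - t) x] of
   [path t]. *)
Definition dens up (V : R -> T -> \bar R) (F : R -> R -> \bar R) :=
  forall t (g : R -> \bar R), 0 < t -> t < 1 ->
    measurable_fun setT g -> (forall x, (0 <= g x)%E) ->
    leb up (\int[P]_w (g (path t w) * V t w))%E
      (\int[mu]_x (g x * (heat (1 - t) x)%:E * F t x))%E.

Let mgh (g : R -> \bar R) t : measurable_fun setT g ->
  measurable_fun setT (fun x : R => (g x * (heat (1 - t) x)%:E)%E).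
Proof. by move=> mg; apply: emeasurable_funM => //; apply/measurable_EFinP; exact: measurable_heat2. Qed.

Let mgp (g : R -> \bar R) t : measurable_fun setT g -> measurable_fun setT (fun w => g (path t w)).
Proof. by move=> mg; apply: (measurableT_comp mg); exact: measurable_path. Qed.

Lemma dens_weaken up V F F' :
  (forall t, measurable_fun setT (F t)) -> (forall t, measurable_fun setT (F' t)) ->
  (forall t x, (0 <= F t x)%E) -> (forall t x, (0 <= F' t x)%E) ->
  (forall t x, 0 < t -> t < 1 -> leb up (F t x) (F' t x)) ->
  dens up V F -> dens up V F'.
Proof.
move=> mF mF' F0 F'0 FF' HV t g t0 t1 mg g0; apply: (leb_trans (HV t g t0 t1 mg g0)).
have mg' := mgh t mg.
apply: leb_integral => //.
- exact: (emeasurable_funM mg' (mF t)).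
- exact: (emeasurable_funM mg' (mF' t)).
- by move=> x; rewrite !mule_ge0 ?lee_fin ?heat_ge0.
- by move=> x; rewrite !mule_ge0 ?lee_fin ?heat_ge0.
- by move=> x _; apply: leb_pmul2l; [rewrite mule_ge0 ?lee_fin ?heat_ge0|exact: FF'].
Qed.

Lemma dens_add up V1 V2 F1 F2 :
  (forall t, measurable_fun setT (V1 t)) -> (forall t, measurable_fun setT (V2 t)) ->
  (forall t w, (0 <= V1 t w)%E) -> (forall t w, (0 <= V2 t w)%E) ->
  (forall t, measurable_fun setT (F1 t)) -> (forall t, measurable_fun setT (F2 t)) ->
  (forall t x, (0 <= F1 t x)%E) -> (forall t x, (0 <= F2 t x)%E) ->
  dens up V1 F1 -> dens up V2 F2 ->
  dens up (fun t w => V1 t w + V2 t w)%E (fun t x => F1 t x + F2 t x)%E.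
Proof.
move=> mV1 mV2 V10 V20 mF1 mF2 F10 F20 H1 H2 t g t0 t1 mg g0.
have mg' := mgh t mg; have mg'' := mgp t mg.
have gh0 x : (0 <= g x * (heat (1 - t) x)%:E)%E by rewrite mule_ge0 ?lee_fin ?heat_ge0.
under eq_integral do rewrite ge0_muleDr//.
under [X in leb up _ X]eq_integral do rewrite ge0_muleDr//.
rewrite ge0_integralD//; last 4 first.
- by move=> w _; rewrite mule_ge0.
- by apply: emeasurable_funM.
- by move=> w _; rewrite mule_ge0.
- by apply: emeasurable_funM.
rewrite ge0_integralD//; last 4 first.
- by move=> x _; rewrite mule_ge0.
- exact: (emeasurable_funM mg' (mF1 t)).
- by move=> x _; rewrite mule_ge0.
- exact: (emeasurable_funM mg' (mF2 t)).
by apply: leb_add; [exact: H1|exact: H2].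
Qed.

Lemma dens_scale up V F (k : R) : 0 <= k ->
  (forall t, measurable_fun setT (V t)) -> (forall t w, (0 <= V t w)%E) ->
  (forall t, measurable_fun setT (F t)) -> (forall t x, (0 <= F t x)%E) ->
  dens up V F -> dens up (fun t w => k%:E * V t w)%E (fun t x => k%:E * F t x)%E.
Proof.
move=> k0 mV V0 mF F0 H t g t0 t1 mg g0.
have mg' := mgh t mg; have mg'' := mgp t mg.
have gh0 x : (0 <= g x * (heat (1 - t) x)%:E)%E by rewrite mule_ge0 ?lee_fin ?heat_ge0.
under eq_integral do rewrite muleCA.
under [X in leb up _ X]eq_integral do rewrite muleCA.
rewrite ge0_integralZl//; last 2 first.
- by apply: emeasurable_funM.
- by move=> w _; rewrite mule_ge0.
rewrite ge0_integralZl//; last 2 first.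
- exact: (emeasurable_funM mg' (mF t)).
- by move=> x _; rewrite mule_ge0.
by apply: leb_pmul2l; [rewrite lee_fin|exact: H].
Qed.

Definition kappa : R := Num.sqrt (2 * pi).

Lemma kappa_gt0 : 0 < kappa.
Proof. by rewrite sqrtr_gt0 mulr_gt0// pi_gt0. Qed.

Lemma dens_one up : dens up (fun _ => cst 1%E) (fun t x => kappa%:E * iheat 0 t x)%E.
Proof.
move=> t g t0 t1 mg g0; under eq_integral do rewrite mule1.
have [v vE h] := lin_law hb [:: (1, t)].
have vE' : v ^+ 2 = bridge_var 0 t.
  by rewrite vE /lin_cov !big_seq1/= /bridge_cov clip_id ?ltW// minxx /bridge_var; field.
have v2 : 0 < v ^+ 2 by rewrite vE' bridge_var_gt0.
have v0 : v != 0 by apply/eqP => v0; move: v2; rewrite v0 expr0n ltxx.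
(* The kernel identity from [s = 0], [z = 0]. Dividing by [heat 1 0], the inverse of [kappa], gives
   the density of the bridge at time [t]. *)
have hE x : heat (v ^+ 2) x = kappa * (heat (1 - t) x * heat t x).
  have := heat_bridge_kernel 0 x t0 t1; rewrite vE' mulr0 !subr0 [heat t x * _]mulrC => <-.
  rewrite mulrCA -[LHS]mulr1; congr (_ * _); rewrite /heat expr0n/= oppr0 mul0r expR0 mulr1 mulr1.
  by rewrite divff// gt_eqF// kappa_gt0.
rewrite (@ge0_integral_density _ _ _ P (path t) (heat (v ^+ 2)) g)//.
- rewrite (_ : (\int[mu]_x _)%E = (\int[mu]_x (g x * (heat (1 - t) x)%:E * (kappa%:E * iheat 0 t x)))%E).
    exact: leb_refl.
  apply: eq_integral => x _; rewrite hE iheat0 -muleA -!EFinM; congr (_ * _%:E)%E.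
  by rewrite mulrCA.
- exact: measurable_heat2.
- by move=> x; exact: heat_ge0.
move=> A mA; rewrite (_ : path t = bridge_comb b [:: (1, t)]); last first.
  by apply/funext => w; rewrite /bridge_comb big_seq1 mul1r.
apply: (eq_trans (h A mA)); rewrite /gaussian_law (negbTE v0).
apply: (eq_trans (normal_prob_heat 0 A v0)).
by apply: eq_integral => x _; rewrite subr0.
Qed.

Section dens_step.
Variables (up : bool) (V : R -> T -> R) (F : R -> R -> \bar R) (f : R -> R) (cf : R).
Hypothesis mV : measurable_fun setT (fun p : R * T => V p.1 p.2).
Hypothesis V0 : forall q w, 0 <= V q w.
Hypothesis pastV : forall s t, 0 <= s -> s < t -> t < 1 -> past_functional b s (increment s t) (V s).
Hypothesis mf : measurable_fun setT f.
Hypothesis f0 : forall x, 0 <= f x.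
Hypothesis fcf : forall x, f x <= cf.
Variables (p eps : R).
Hypothesis eps0 : 0 <= eps.
Hypothesis fsupp : forall z, f z != 0 -> `|z - p| <= eps.
Hypothesis f1 : (\int[mu]_z (f z)%:E = 1)%E.
Variables (a dd : R) (m : nat).
Hypothesis a0 : 0 <= a.
Hypothesis d0 : 0 <= dd.
Hypothesis mF : forall s, measurable_fun setT (F s).
Hypothesis F0 : forall s z, (0 <= F s z)%E.
Hypothesis HF : forall s z, 0 < s -> s < 1 -> `|z - p| <= eps ->
  leb up (F s z) (a%:E * iheat m s dd)%E.
Hypothesis HV : dens up (fun t w => (V t w)%:E) F.

Let HV' s (h : R -> \bar R) : 0 < s -> s < 1 ->
  measurable_fun setT h -> (forall x, (0 <= h x)%E) ->
  leb up (\int[P]_w (h (path s w) * (V s w * f (path s w))%:E))%E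
    (\int[mu]_z (h z * (f z)%:E * (heat (1 - s) z)%:E * (a%:E * iheat m s dd)))%E.
Proof.
move=> s0 s1 mh h0.
have mhf : measurable_fun setT (fun x => (h x * (f x)%:E)%E).
  by apply: emeasurable_funM => //; exact/measurable_EFinP.
have hf0 x : (0 <= h x * (f x)%:E)%E by rewrite mule_ge0 ?lee_fin.
rewrite (_ : (\int[P]_w _)%E = (\int[P]_w (h (path s w) * (f (path s w))%:E * (V s w)%:E))%E); last first.
  by apply: eq_integral => w _; rewrite -muleA -EFinM [f _ * _]mulrC.
apply: (leb_trans (HV s0 s1 mhf hf0)).
have m1 := mgh s mhf.
apply: leb_integral => //.
- exact: (emeasurable_funM m1 (mF s)).
- by apply: emeasurable_funM => //; apply: emeasurable_funM => //; exact: measurable_iheat.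
- by move=> x; rewrite mule_ge0// mule_ge0 ?lee_fin ?heat_ge0.
- by move=> x; rewrite !mule_ge0 ?lee_fin ?heat_ge0 ?iheat_ge0.
move=> z _; have [fz|fz] := eqVneq (f z) 0.
  by rewrite fz !mule0 !mul0e; exact: leb_refl.
apply: leb_pmul2l; first by rewrite mule_ge0 ?lee_fin ?heat_ge0.
by apply: HF => //; exact: fsupp.
Qed.

Let W t w := (\int[mu]_(s in `]0%R, t[) (V s w * f (path s w))%:E)%E.

(** The factor [f] only sees [F] near [p], where it is bounded by [iheat m] at distance [dd]. The
    convolution step adds the distance from the tent to [x], and localization replaces the tent by
    its centre. *)
Lemma dens_integral :
  dens up W (fun t x => a%:E * iheat m.+1 t (dd + shift_dist up eps `|x - p|)%R)%E.
Proof.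
move=> t g t0 t1 mg g0.
apply: (leb_trans (density_step hb mV (measurable_path_pair hb) V0 pastV mf f0 fcf a0 d0 HV' t0 t1 (fun=> erefl) mg g0)).
have m1 := mgh t mg.
pose G (x z : R) : \bar R := ((f z)%:E * (a%:E * iheat m.+1 t (dd + `|x - z|)%R))%E.
have mG : measurable_fun setT (fun q : R * R => G q.1 q.2).
  apply: emeasurable_funM; first by apply/measurable_EFinP; exact: measurableT_comp.
  apply: emeasurable_funM => //; apply: measurable_iheat => //; apply: measurable_funD => //.
  by apply: measurableT_comp => //; exact: measurable_funB.
have G0 x z : (0 <= G x z)%E by rewrite !mule_ge0 ?lee_fin ?iheat_ge0.
apply: leb_integral => //.
- by apply: emeasurable_funM => //; exact: (measurable_integral_right mu mG G0 measurableT).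
- apply: emeasurable_funM => //; apply: emeasurable_funM => //; apply: measurable_iheat => //.
  apply: measurable_funD => //; apply: measurable_shift_dist; apply: measurableT_comp => //.
  exact: measurable_funB.
- move=> x; apply: mule_ge0; first by rewrite mule_ge0 ?lee_fin ?heat_ge0.
  by apply: integral_ge0 => z _; exact: G0.
- by move=> x; rewrite !mule_ge0 ?lee_fin ?heat_ge0 ?iheat_ge0.
move=> x _; apply: leb_pmul2l; first by rewrite mule_ge0 ?lee_fin ?heat_ge0.
exact: leb_localize.
Qed.

Lemma mass_integral :
  leb up (\int[P]_w W 1 w)%E (a%:E * iheat m.+1 1 (dd + shift_dist up eps `|p|)%R)%E.
Proof.
apply: (leb_trans (mass_step mV (measurable_path_pair hb) V0 mf f0 a0 d0 HV' (fun=> erefl))).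
rewrite -[`|p|]normrN -sub0r.
rewrite (_ : (\int[mu]_z _)%E = (\int[mu]_z ((f z)%:E * (a%:E * iheat m.+1 1 (dd + `|0 - z|)%R)))%E).
  exact: leb_localize.
by apply: eq_integral => z _; rewrite sub0r normrN.
Qed.

Lemma measurable_integral_path t : measurable_fun setT (W t).
Proof.
apply: (measurable_integral_right mu (f := fun w s => (V s w * f (path s w))%:E)) => //.
  apply/measurable_EFinP.
  apply: (measurableT_comp (f := fun p : R * T => V p.1 p.2 * f (path p.1 p.2)) (g := fun p : T * R => (p.2, p.1))).
    by apply: measurable_funM => //; apply: (measurableT_comp mf); exact: (measurable_path_pair hb).
  exact: measurable_fun_pair.
by move=> w s; rewrite lee_fin mulr_ge0.
Qed.

End dens_step.

End densities.

(** * Moments of occupation times *)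
Section occupation_moments.
Context d (T : measurableType d) (R : realType) (P : probability T R) (b : R -> {RV P >-> R}).
Hypothesis hb : brownian_bridge b.
Notation mu := (@lebesgue_measure R).
Notation path := (bridge_path b).
Notation occ := (occ b).
Notation kappa := (@kappa R).
Notation dens := (dens b).
Implicit Types (up : bool).

Lemma dens_ext up (V V' : R -> T -> \bar R) (F F' : R -> R -> \bar R) :
  (forall t w, 0 < t -> V t w = V' t w) -> (forall t x, F t x = F' t x) ->
  dens up V F -> dens up V' F'.
Proof.
move=> VV' FF' H t g t0 t1 mg g0; have := H t g t0 t1 mg g0.
under eq_integral do rewrite VV'//.
by under [X in leb up _ X]eq_integral do rewrite FF'.
Qed.

Lemma iheat_leb up n (t u v : R) : 0 < t -> 0 <= u -> 0 <= v ->
  (if up then v <= u else u <= v) -> leb up (iheat n t u) (iheat n t v).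
Proof. by case: up => t0 u0 v0 h /=; exact: iheat_antitone. Qed.

Let mshift up n (k eps p : R) t : measurable_fun setT
  (fun x : R => iheat n t (k + shift_dist up eps `|x - p|)%R).
Proof.
apply: measurable_iheat => //; apply: measurable_funD => //; apply: measurable_shift_dist.
by apply: measurableT_comp => //; exact: measurable_funB.
Qed.

Section one_function.
Variables (f : R -> R) (c : R).
Hypothesis cf : continuous f.
Hypothesis f0 : forall x, 0 <= f x.
Hypothesis fc : forall x, f x <= c.

Let mf : measurable_fun setT f. Proof. exact: continuous_measurable_fun. Qed.

Lemma occ_powerS_split n t w : 0 < t ->
  (occ f t w ^+ n.+1)%:E =
  (n.+1%:R%:E * \int[mu]_(s in `]0%R, t[) (occ f s w ^+ n * f (path s w))%:E)%E.
Proof.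
move=> t0; rewrite (occ_powerS hb n w cf f0 fc t0) -ge0_integralZl//.
- by apply: eq_integral => s _; rewrite -EFinM mulrA.
- apply: measurable_funTS; apply/measurable_EFinP; apply: measurable_funM.
    apply: measurable_funX; exact: (measurableT_comp (measurable_occ hb cf f0 fc) (pair2_measurable w)).
  exact: (measurableT_comp (measurable_fpath hb cf) (pair2_measurable w)).
- by move=> s _; rewrite lee_fin mulr_ge0// exprn_ge0// (occ_ge0 hb cf f0 fc).
Qed.

Let V n (t : R) w := occ f t w ^+ n.

Let mV n : measurable_fun setT (fun p : R * T => V n p.1 p.2).
Proof. by apply: measurable_funX; exact: (measurable_occ hb cf f0 fc). Qed.

Let V0 n q w : 0 <= V n q w.
Proof. by rewrite exprn_ge0// (occ_ge0 hb cf f0 fc). Qed.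

Let pastV n s t : 0 <= s -> s < t -> t < 1 -> past_functional b s (increment s t) (V n s).
Proof.
move=> s0 st t1; apply: (past_occ_power hb _ _ _ cf f0 fc s0) => //.
- by rewrite ltW// (lt_trans st).
- by move=> l; exact: increment_orth.
Qed.

Let W n t w := (\int[mu]_(s in `]0%R, t[) (V n s w * f (path s w))%:E)%E.

Let mW n t : measurable_fun setT (W n t).
Proof. by apply: (measurable_integral_path hb (mV n) (V0 n) mf f0). Qed.

Let W0 n t w : (0 <= W n t w)%E.
Proof. by apply: integral_ge0 => s _; rewrite lee_fin mulr_ge0. Qed.

Section support.
Variables (p eps : R).
Hypothesis eps0 : 0 <= eps.
Hypothesis fsupp : forall z, f z != 0 -> `|z - p| <= eps.
Hypothesis f1 : (\int[mu]_z (f z)%:E = 1)%E.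

Lemma dens_occ_power_step up n (F : R -> R -> \bar R) (a dd : R) : 0 <= a -> 0 <= dd ->
  (forall s, measurable_fun setT (F s)) -> (forall s z, (0 <= F s z)%E) ->
  (forall s z, 0 < s -> s < 1 -> `|z - p| <= eps -> leb up (F s z) (a%:E * iheat n s dd)%E) ->
  dens up (fun t w => (occ f t w ^+ n)%:E) F ->
  dens up (fun t w => (occ f t w ^+ n.+1)%:E)
    (fun t x => (n.+1%:R * a)%:E * iheat n.+1 t (dd + shift_dist up eps `|x - p|)%R)%E /\
  leb up (\int[P]_w (occ f 1 w ^+ n.+1)%:E)%E
    ((n.+1%:R * a)%:E * iheat n.+1 1 (dd + shift_dist up eps `|p|)%R)%E.
Proof.
move=> a0 d0 mF F0 HF HV; split.
- have := dens_integral hb (mV n) (V0 n) (pastV n) mf f0 fc eps0 fsupp f1 a0 d0 mF F0 HF HV.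
  move=> /(dens_scale (ler0n R n.+1)) H.
  apply: (dens_ext _ _ (H _ _ _ _)).
  + by move=> t w t0; rewrite occ_powerS_split.
  + by move=> t x; rewrite muleA EFinM.
  + exact: mW.
  + exact: W0.
  + by move=> t; apply: emeasurable_funM => //; exact: mshift.
  + by move=> t x; rewrite mule_ge0 ?iheat_ge0 ?lee_fin.
- have := mass_integral hb (mV n) (V0 n) mf f0 eps0 fsupp f1 a0 d0 mF F0 HF HV.
  move=> H; under eq_integral do rewrite occ_powerS_split//.
  rewrite ge0_integralZl//; last 2 first.
  + exact: (mW n 1).
  + by move=> w _; exact: (W0 n 1 w).
  by rewrite EFinM -muleA; apply: leb_pmul2l; rewrite ?lee_fin.
Qed.

(** Dropping every distance to [0] gives a bound which depends neither on the centre nor on the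
    width of the tent. It supplies the uniform moment bounds for the passage to the limit. *)
Lemma occ_moment_le n :
  dens true (fun t w => (occ f t w ^+ n)%:E) (fun t x => (kappa * n`!%:R)%:E * iheat n t 0)%E /\
  (\int[P]_w (occ f 1 w ^+ n.+1)%:E <= (kappa * n.+1`!%:R)%:E * iheat n.+1 1 0)%E.
Proof.
have k0 : 0 <= kappa by rewrite ltW// kappa_gt0.
have a0 m : 0 <= kappa * m`!%:R by rewrite mulr_ge0.
have mF m s : measurable_fun setT (fun x : R => (kappa * m`!%:R)%:E * iheat m s 0)%E.
  by apply: emeasurable_funM => //; exact: measurable_iheat.
have F0 m s (z : R) : (0 <= (kappa * m`!%:R)%:E * iheat m s 0)%E.
  by rewrite mule_ge0 ?iheat_ge0 ?lee_fin.
have step m : dens true (fun t w => (occ f t w ^+ m)%:E) (fun t x => (kappa * m`!%:R)%:E * iheat m t 0)%E ->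
    dens true (fun t w => (occ f t w ^+ m.+1)%:E) (fun t x => (kappa * m.+1`!%:R)%:E * iheat m.+1 t 0)%E /\
    (\int[P]_w (occ f 1 w ^+ m.+1)%:E <= (kappa * m.+1`!%:R)%:E * iheat m.+1 1 0)%E.
  move=> Hm.
  have [] := @dens_occ_power_step true m _ (kappa * m`!%:R) 0 (a0 m) (lexx 0) (mF m) (F0 m) _ Hm.
    by move=> s z _ _ _; exact: leb_refl.
  have E : m.+1%:R * (kappa * m`!%:R) = kappa * m.+1`!%:R by rewrite factS natrM mulrCA.
  have sd0 u : 0 <= u -> 0 <= 0 + shift_dist true eps u.
    by move=> u0; rewrite add0r; exact: shift_dist_ge0.
  rewrite E => H1 H2; split.
  - apply: (dens_weaken _ _ _ _ _ H1).
    + by move=> t; apply: emeasurable_funM => //; exact: mshift.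
    + exact: mF.
    + by move=> t x; rewrite mule_ge0 ?iheat_ge0 ?lee_fin.
    + exact: F0.
    + move=> t x t0 _; apply: leb_pmul2l; first by rewrite lee_fin.
      by apply: iheat_leb => //; exact: sd0.
  - apply: (le_trans H2); apply: lee_wpmul2l; first by rewrite lee_fin.
    by apply: iheat_antitone => //; exact: sd0.
have H : dens true (fun t w => (occ f t w ^+ n)%:E) (fun t x => (kappa * n`!%:R)%:E * iheat n t 0)%E.
  elim: n => [|n ih]; last by have [] := step n ih.
  apply: (dens_weaken _ _ _ _ _ (dens_ext _ _ (dens_one hb true))) => //.
  all: try by move=> t w _; rewrite expr0.
  all: try by move=> t /=; apply: emeasurable_funM => //; exact: measurable_iheat.
  all: try by move=> t x /=; rewrite mule_ge0 ?iheat_ge0 ?lee_fin.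
  move=> t x t0 _; rewrite mulr1; apply: leb_pmul2l; first by rewrite lee_fin.
  by rewrite /= !iheat0 lee_fin heat_le// ltW.
by split => //; have [] := step n H.
Qed.

End support.

End one_function.

Section two_functions.
Variables (up : bool) (f phi : R -> R) (c c' eps y : R).
Hypothesis cf : continuous f.
Hypothesis f0 : forall x, 0 <= f x.
Hypothesis fc : forall x, f x <= c.
Hypothesis cphi : continuous phi.
Hypothesis phi0 : forall x, 0 <= phi x.
Hypothesis phic : forall x, phi x <= c'.
Hypothesis eps0 : 0 <= eps.
Hypothesis fsupp : forall z, f z != 0 -> `|z - 0| <= eps.
Hypothesis f1 : (\int[mu]_z (f z)%:E = 1)%E.
Hypothesis phisupp : forall z, phi z != 0 -> `|z - y| <= eps.
Hypothesis phi1 : (\int[mu]_z (phi z)%:E = 1)%E.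

(** The distances below are those travelled after [n] visits near [0] ([dA]), after these and a last
    visit near [y] ([dB]), and after a visit near [y] followed by a return to [0] ([dC]). In lower
    bounds each visit costs [2 eps], once for the position inside the tent and once for
    [shift_dist]; in upper bounds distances between visits near [0] are discarded. *)
Let S := shift_dist up eps.
Let dA (n : nat) : R := if up then 0 else 2 * n%:R * eps.
Let dB (n : nat) : R := if up then Num.max 0 (`|y| - 2 * eps) else `|y| + (2 * n%:R + 2) * eps.
Let dC (n : nat) : R := if up then 2 * Num.max 0 (`|y| - 2 * eps) else 2 * `|y| + (2 * n%:R + 2) * eps.

Let neps (n : nat) : 0 <= n%:R * eps. Proof. exact: mulr_ge0. Qed.

Let S0 u : 0 <= u -> 0 <= S u. Proof. exact: shift_dist_ge0. Qed.
Let dA0 n : 0 <= dA n. Proof. by rewrite /dA; case: up => //; rewrite !mulr_ge0. Qed.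
Let dB0 n : 0 <= dB n.
Proof. by rewrite /dB; case: up; rewrite ?le_max ?lexx// addr_ge0// mulr_ge0// addr_ge0// mulr_ge0. Qed.
Let dC0 n : 0 <= dC n.
Proof.
rewrite /dC; case: up; first by rewrite mulr_ge0// le_max lexx.
by rewrite addr_ge0 ?mulr_ge0// addr_ge0// mulr_ge0.
Qed.

Let k0 n : 0 <= kappa * n`!%:R. Proof. by rewrite mulr_ge0// ltW// kappa_gt0. Qed.

Let FA n (t x : R) : \bar R := ((kappa * n`!%:R)%:E * iheat n t (dA n + S `|x - 0|)%R)%E.

Let mFA n t : measurable_fun setT (FA n t).
Proof. by apply: emeasurable_funM => //; exact: mshift. Qed.

Let FA0 n t x : (0 <= FA n t x)%E.
Proof. by rewrite mule_ge0 ?iheat_ge0 ?lee_fin. Qed.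

Let dens_occ_power n : dens up (fun t w => (occ f t w ^+ n)%:E) (FA n).
Proof.
elim: n => [|n ih].
  apply: (dens_weaken _ _ _ _ _ (dens_ext (F' := fun t x => kappa%:E * iheat 0 t x)%E _ _ (dens_one hb up))) => //.
  all: try by move=> t w _; rewrite expr0.
  all: try by move=> t /=; apply: emeasurable_funM => //; exact: measurable_iheat.
  all: try by move=> t x /=; rewrite mule_ge0 ?iheat_ge0 ?lee_fin// ltW// kappa_gt0.
  move=> t x t0 _; rewrite /FA mulr1; apply: leb_pmul2l; first by rewrite lee_fin ltW// kappa_gt0.
  rewrite (_ : iheat 0 t x = iheat 0 t `|x|); last by rewrite !iheat0 heat_norm.
  apply: iheat_leb => //; first by rewrite addr_ge0// S0.
  rewrite subr0 /dA /S /shift_dist; have x0 := normr_ge0 x; have e0 := eps0; case: up; last by rewrite mulr0 mul0r; lra.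
  by rewrite maxEle; case: ifPn; rewrite -?ltNge => ?; lra.
have [] := @dens_occ_power_step f c cf f0 fc 0 eps eps0 fsupp f1 up n (FA n) (kappa * n`!%:R) (dA n.+1)
  (k0 n) (dA0 _) (mFA n) (FA0 n) _ ih.
  move=> s z s0 _ z0; apply: leb_pmul2l; first by rewrite lee_fin.
  apply: iheat_leb => //; first by rewrite addr_ge0// S0.
  move: z0; rewrite subr0 /dA /S /shift_dist; case: up => z0.
    by rewrite addr_ge0// le_max lexx.
  by rewrite -natr1; lra.
move=> H _; apply: (dens_ext _ _ H) => // t x.
by rewrite /FA factS natrM mulrCA.
Qed.

(** The first summand collects the orders in which [y] is visited last, of which there are [n!]; the
    second those whose last visit is near [0], of which there are [n * n!]. *)
Let FB n (t x : R) : \bar R := ((kappa * n`!%:R)%:E *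
  (iheat n.+1 t (dB n + S `|x - y|)%R + n%:R%:E * iheat n.+1 t (dC n + S `|x - 0|)%R))%E.

Let mFB n t : measurable_fun setT (FB n t).
Proof.
apply: emeasurable_funM => //; apply: emeasurable_funD; first exact: mshift.
by apply: emeasurable_funM => //; exact: mshift.
Qed.

Let FB0 n t x : (0 <= FB n t x)%E.
Proof. by rewrite mule_ge0 ?lee_fin// adde_ge0 ?iheat_ge0// mule_ge0 ?iheat_ge0 ?lee_fin. Qed.

Let mf : measurable_fun setT f. Proof. exact: continuous_measurable_fun. Qed.
Let mphi : measurable_fun setT phi. Proof. exact: continuous_measurable_fun. Qed.

Let VA n (t : R) w := occ f t w ^+ n.
Let VB n (t : R) w := occ f t w ^+ n * occ phi t w.

Let mVA n : measurable_fun setT (fun p : R * T => VA n p.1 p.2).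
Proof. by apply: measurable_funX; exact: (measurable_occ hb cf f0 fc). Qed.
Let mVB n : measurable_fun setT (fun p : R * T => VB n p.1 p.2).
Proof. by apply: measurable_funM; [exact: mVA|exact: (measurable_occ hb cphi phi0 phic)]. Qed.
Let VA0 n q w : 0 <= VA n q w.
Proof. by rewrite exprn_ge0// (occ_ge0 hb cf f0 fc). Qed.
Let VB0 n q w : 0 <= VB n q w.
Proof. by rewrite mulr_ge0 ?exprn_ge0 ?(occ_ge0 hb cf f0 fc)// (occ_ge0 hb cphi phi0 phic). Qed.

Let pastVA n s t : 0 <= s -> s < t -> t < 1 -> past_functional b s (increment s t) (VA n s).
Proof.
move=> s0 st t1; apply: (past_occ_power hb _ _ _ cf f0 fc s0) => //.
- by rewrite ltW// (lt_trans st).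
- by move=> l; exact: increment_orth.
Qed.
Let pastVB n s t : 0 <= s -> s < t -> t < 1 -> past_functional b s (increment s t) (VB n s).
Proof.
move=> s0 st t1; apply: (past_occ_prod hb _ _ _ cf cphi f0 phi0 fc phic s0) => //.
- by rewrite ltW// (lt_trans st).
- by move=> l; exact: increment_orth.
Qed.

Let WA n t w := (\int[mu]_(s in `]0%R, t[) (VA n s w * phi (path s w))%:E)%E.
Let WB n t w := (\int[mu]_(s in `]0%R, t[) (VB n s w * f (path s w))%:E)%E.

Let mWA n t : measurable_fun setT (WA n t).
Proof. exact: (measurable_integral_path hb (mVA n) (VA0 n) mphi phi0). Qed.
Let mWB n t : measurable_fun setT (WB n t).
Proof. exact: (measurable_integral_path hb (mVB n) (VB0 n) mf f0). Qed.
Let WA0 n t w : (0 <= WA n t w)%E.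
Proof. by apply: integral_ge0 => s _; rewrite lee_fin mulr_ge0. Qed.
Let WB0 n t w : (0 <= WB n t w)%E.
Proof. by apply: integral_ge0 => s _; rewrite lee_fin mulr_ge0. Qed.

Let splitE n t w : 0 < t ->
  ((VB n t w)%:E = WA n t w + n%:R%:E * WB n.-1 t w)%E.
Proof.
move=> t0; rewrite /VB (occ_power hb n w cf cphi f0 phi0 fc phic t0).
have m1 : measurable_fun setT (fun s : R => (VA n s w * phi (path s w))%:E).
  apply/measurable_EFinP; apply: measurable_funM.
    exact: (measurableT_comp (mVA n) (pair2_measurable w)).
  exact: (measurableT_comp (measurable_fpath hb cphi) (pair2_measurable w)).
have m2 : measurable_fun setT (fun s : R => (VB n.-1 s w * f (path s w))%:E).
  apply/measurable_EFinP; apply: measurable_funM.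
    exact: (measurableT_comp (mVB n.-1) (pair2_measurable w)).
  exact: (measurableT_comp (measurable_fpath hb cf) (pair2_measurable w)).
rewrite /WA /WB -ge0_integralZl//; last 2 first.
- exact: measurable_funTS.
- by move=> s _; rewrite lee_fin mulr_ge0.
rewrite -ge0_integralD//; last 4 first.
- by move=> s _; rewrite lee_fin mulr_ge0.
- exact: measurable_funTS.
- by move=> s _; rewrite mule_ge0 ?lee_fin// mulr_ge0.
- by apply: measurable_funTS; exact: (emeasurable_funM (measurable_cst _) m2).
by apply: eq_integral => s _; rewrite -EFinM -EFinD; congr EFin; rewrite /VA /VB; ring.
Qed.

Let stepA n : dens up (WA n)
    (fun t x => (kappa * n`!%:R)%:E * iheat n.+1 t (dB n + S `|x - y|)%R)%E /\
  leb up (\int[P]_w WA n 1 w)%E ((kappa * n`!%:R)%:E * iheat n.+1 1 (dB n + S `|y|)%R)%E.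
Proof.
have HF s z : 0 < s -> s < 1 -> `|z - y| <= eps ->
    leb up (FA n s z) ((kappa * n`!%:R)%:E * iheat n s (dB n))%E.
  move=> s0 s1 zy; apply: leb_pmul2l; first by rewrite lee_fin.
  apply: iheat_leb => //; first by rewrite addr_ge0// S0.
  have h1 : `|z| <= `|y| + eps by rewrite -{1}(subrK y z) (le_trans (ler_normD _ _))// addrC lerD2l.
  have h2 : `|y| <= `|z| + eps by rewrite -{1}(subrK z y) (le_trans (ler_normD _ _))// addrC lerD2l distrC.
  have e0 := eps0; have ne := neps n; rewrite subr0 /dA /dB /S /shift_dist; case: up; last by lra.
  by rewrite !maxEle; do ?[case: ifPn; rewrite -?ltNge => ?]; lra.
split.
- exact: (dens_integral hb (mVA n) (VA0 n) (pastVA n) mphi phi0 phic eps0 phisupp phi1 (k0 n) (dB0 n) (mFA n) (FA0 n) HF (dens_occ_power n)).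
- exact: (mass_integral hb (mVA n) (VA0 n) mphi phi0 eps0 phisupp phi1 (k0 n) (dB0 n) (mFA n) (FA0 n) HF (dens_occ_power n)).
Qed.

Let stepB n : dens up (fun t w => (VB n t w)%:E) (FB n) ->
  dens up (WB n) (fun t x => (kappa * n.+1`!%:R)%:E * iheat n.+2 t (dC n.+1 + S `|x - 0|)%R)%E /\
  leb up (\int[P]_w WB n 1 w)%E ((kappa * n.+1`!%:R)%:E * iheat n.+2 1 (dC n.+1 + S `|0 : R|)%R)%E.
Proof.
move=> HV.
have HF s z : 0 < s -> s < 1 -> `|z - 0| <= eps ->
    leb up (FB n s z) ((kappa * n.+1`!%:R)%:E * iheat n.+1 s (dC n.+1))%E.
  move=> s0 s1 z0; rewrite /FB.
  rewrite (_ : ((kappa * n.+1`!%:R)%:E * iheat n.+1 s (dC n.+1) =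
    (kappa * n`!%:R)%:E * (iheat n.+1 s (dC n.+1) + n%:R%:E * iheat n.+1 s (dC n.+1)))%E); last first.
    have := iheat_fin_num n.+1 (dC n.+1) s0; case: (iheat _ _ _) => // r _.
    rewrite [X in _ = (_ * X)%E](_ : _ = (r + n%:R * r)%:E); last by rewrite EFinD EFinM.
    rewrite -!EFinM factS natrM -natr1.
    by congr EFin; ring.
  apply: leb_pmul2l; first by rewrite lee_fin.
  have zy0 := normr_ge0 (z - y); have e0 := eps0; have ne := neps n; have y0 := normr_ge0 y.
  have h1 : `|z - y| <= `|y| + eps.
    by move: z0; rewrite subr0 => z0; rewrite (le_trans (ler_normB _ _))// addrC lerD2l.
  have h2 : `|y| <= `|z - y| + eps.
    by move: z0; rewrite subr0 => z0; rewrite -{1}(subrK z y) (le_trans (ler_normD _ _))// distrC lerD2l.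
  have nz := normr_ge0 (z - 0).
  apply: leb_add.
    apply: iheat_leb => //; first by rewrite addr_ge0// S0.
    rewrite /dB /dC /S /shift_dist -natr1; case: up; last by lra.
    by rewrite !maxEle; do ?[case: ifPn; rewrite -?ltNge => ?]; lra.
  apply: leb_pmul2l; first by rewrite lee_fin.
  apply: iheat_leb => //; first by rewrite addr_ge0// S0.
  rewrite /dC /S /shift_dist -natr1; case: up; last by lra.
  by rewrite !maxEle; do ?[case: ifPn; rewrite -?ltNge => ?]; lra.
split.
- exact: (dens_integral hb (mVB n) (VB0 n) (pastVB n) mf f0 fc eps0 fsupp f1 (k0 n.+1) (dC0 n.+1) (mFB n) (FB0 n) HF HV).
- exact: (mass_integral hb (mVB n) (VB0 n) mf f0 eps0 fsupp f1 (k0 n.+1) (dC0 n.+1) (mFB n) (FB0 n) HF HV).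
Qed.

Let dens_occ_prod n : dens up (fun t w => (VB n t w)%:E) (FB n).
Proof.
elim: n => [|n ih].
  apply: (dens_ext _ _ (stepA 0).1) => [t w t0|t x]; first by rewrite splitE// mul0e adde0.
  by rewrite /FB mul0e adde0.
have [HA _] := stepA n.+1; have [HB _] := stepB ih.
have mE t : measurable_fun setT (fun x : R => ((kappa * n.+1`!%:R)%:E * iheat n.+2 t (dC n.+1 + S `|x - 0|)%R)%E).
  by apply: emeasurable_funM => //; exact: mshift.
have pE t (x : R) : (0 <= (kappa * n.+1`!%:R)%:E * iheat n.+2 t (dC n.+1 + S `|x - 0|)%R)%E.
  by rewrite mule_ge0 ?iheat_ge0 ?lee_fin.
have HB' := dens_scale (ler0n R n.+1) (mWB n) (WB0 n) mE pE HB.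
apply: (dens_ext _ _ (dens_add _ _ _ _ _ _ _ _ HA HB')).
- by move=> t w t0; rewrite splitE.
- move=> t x; have nE : (0 <= n.+1%:R%:E * iheat n.+2 t (dC n.+1 + S `|x - 0|)%R)%E.
    by rewrite mule_ge0 ?iheat_ge0 ?lee_fin.
  rewrite /FB (@ge0_muleDr _ _ _ _ (iheat_ge0 _ _ _) nE).
  by congr (_ + _)%E; exact: muleCA.
- exact: mWA.
- by move=> t; apply: emeasurable_funM => //; exact: mWB.
- exact: WA0.
- by move=> t w; rewrite mule_ge0 ?lee_fin// WB0.
- by move=> t; apply: emeasurable_funM => //; exact: mshift.
- by move=> t; exact: (emeasurable_funM (measurable_cst _) (mE t)).
- by move=> t x; rewrite mule_ge0 ?iheat_ge0 ?lee_fin.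
- by move=> t x; rewrite mule_ge0 ?lee_fin// pE.
Qed.

(** A common bound for the total distances [dB n + S |y|] and [dC n + S 0], according to the place
    of the last visit; it tends to [2|y|] with [eps]. *)
Definition mixed_moment_dist n : R :=
  if up then Num.max 0 (2 * `|y| - 4 * eps) else 2 * `|y| + (2 * n%:R + 4) * eps.

Lemma occ_mixed_moment n :
  leb up (\int[P]_w (occ f 1 w ^+ n * occ phi 1 w)%:E)%E
    ((kappa * n.+1`!%:R)%:E * iheat n.+1 1 (mixed_moment_dist n))%E.
Proof.
have E0 : 0 <= mixed_moment_dist n.
  rewrite /mixed_moment_dist; case: up; first by rewrite le_max lexx.
  by rewrite addr_ge0 ?mulr_ge0// addr_ge0// mulr_ge0.
have y0 := normr_ge0 y; have e0 := eps0; have ne := neps n.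
rewrite (_ : ((kappa * n.+1`!%:R)%:E * iheat n.+1 1 (mixed_moment_dist n) =
    (kappa * n`!%:R)%:E * iheat n.+1 1 (mixed_moment_dist n) +
    n%:R%:E * ((kappa * n`!%:R)%:E * iheat n.+1 1 (mixed_moment_dist n)))%E); last first.
  have := iheat_fin_num n.+1 (mixed_moment_dist n) ltr01; case: (iheat _ _ _) => // r _.
  rewrite -!EFinM -EFinD factS natrM -natr1.
  by congr EFin; ring.
rewrite (_ : (\int[P]_w _)%E = (\int[P]_w WA n 1 w + n%:R%:E * \int[P]_w WB n.-1 1 w)%E); last first.
  rewrite -ge0_integralZl//.
  rewrite -ge0_integralD//.
  - by apply: eq_integral => w _; rewrite -splitE.
  - by move=> w _; rewrite mule_ge0 ?lee_fin// WB0.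
  - by apply: emeasurable_funM => //; exact: mWB.
apply: leb_add.
  apply: (leb_trans (stepA n).2); apply: leb_pmul2l; first by rewrite lee_fin.
  apply: iheat_leb => //; first by rewrite addr_ge0// S0.
  rewrite /mixed_moment_dist /dB /S /shift_dist; case: up; last by lra.
  by rewrite !maxEle; do ?[case: ifPn; rewrite -?ltNge => ?]; lra.
case: n {E0 ne} => [|n]; first by rewrite !mul0e; exact: leb_refl.
apply: leb_pmul2l; first by rewrite lee_fin.
have ne := neps n.+1.
apply: (leb_trans (stepB (dens_occ_prod n)).2); apply: leb_pmul2l; first by rewrite lee_fin.
apply: iheat_leb => //.
- by rewrite addr_ge0// S0.
- rewrite /mixed_moment_dist; case: up; first by rewrite le_max lexx.
  by rewrite addr_ge0 ?mulr_ge0// addr_ge0// mulr_ge0.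
rewrite /mixed_moment_dist /dC /S /shift_dist normr0; case: up; last by lra.
by rewrite !maxEle; do ?[case: ifPn; rewrite -?ltNge => ?]; lra.
Qed.

End two_functions.

End occupation_moments.

(** The bound on second moments gives uniform integrability: truncation at [M] changes the integrals
    by at most [C / M], and truncated integrals converge by dominated convergence. *)
Lemma integral_cvg_square_bounded d (T : measurableType d) (R : realType) (P : probability T R)
  (X : nat -> T -> R) (Y : T -> R) (C : R) (v : R) :
  (forall k, measurable_fun setT (X k)) -> measurable_fun setT Y -> (forall k w, 0 <= X k w) ->
  {ae P, forall w, X k w @[k --> \oo] --> Y w} ->
  (forall k, (\int[P]_w (X k w ^+ 2)%:E <= C%:E)%E) ->
  (\int[P]_w (X k w)%:E)%E @[k --> \oo] --> v%:E ->
  (\int[P]_w (Y w)%:E = v%:E)%E.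
Proof.
move=> mX mY X0 XY XC Xv.
(* The limit is non-negative only almost everywhere; its positive part is non-negative everywhere
   and has the same integral. *)
pose Z w := Num.max 0 (Y w).
have mZ : measurable_fun setT Z by exact: measurable_maxr.
have Z0 w : 0 <= Z w by rewrite le_max lexx.
have YZ w : X k w @[k --> \oo] --> Y w -> Y w = Z w.
  move=> h; rewrite /Z max_r// -(cvg_lim _ h)//; apply: limr_ge; first by apply: cvgP h.
  by near=> k.
have XZ : {ae P, forall w, X k w @[k --> \oo] --> Z w}.
  by apply: filterS XY => w h; rewrite -YZ.
have -> : (\int[P]_w (Y w)%:E = \int[P]_w (Z w)%:E)%E.
  apply: ae_eq_integral => //; [exact/measurable_EFinP|exact/measurable_EFinP|].
  by apply: filterS XY => w /YZ <-.
pose I (M : R) := (\int[P]_w (Num.min (Z w) M)%:E)%E.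
have mmin (f : T -> R) M : measurable_fun setT f -> measurable_fun setT (fun w => (Num.min (f w) M)%:E).
  by move=> mf; apply/measurable_EFinP; exact: measurable_minr.
have cI M : 0 < M -> (\int[P]_w (Num.min (X k w) M)%:E)%E @[k --> \oo] --> I M.
  move=> M0.
  have h1 k : measurable_fun setT (fun w => (Num.min (X k w) M)%:E) by exact: mmin.
  have h2 : {ae P, forall w, setT w -> (Num.min (X k w) M)%:E @[k --> \oo] --> (Num.min (Z w) M)%:E}.
    apply: filterS XZ => w h _; apply: cvg_EFin; first exact: nearW.
    have cm : {for Z w, continuous (fun x : R => Num.min x M)}.
      by apply: (@continuous_min R R id (cst M)); [exact: cvg_id|exact: cvg_cst].
    exact: (cvg_comp _ _ h cm).
  have h3 : P.-integrable setT (cst M%:E).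
    by apply/integrableP; split=> //; rewrite integral_cst//= probability_setT mule1 ltry.
  have h4 : {ae P, forall w k, setT w -> (`|(Num.min (X k w) M)%:E| <= cst M%:E w)%E}.
    by apply: aeW => w k _; rewrite /= lee_fin ger0_norm ?ge_min ?lexx ?orbT// le_min X0 ltW.
  by have [_ _ h] := dominated_convergence measurableT h1 (mmin _ M mZ) h2 h3 h4.
have lo M : 0 < M -> (I M <= v%:E)%E.
  move=> M0; rewrite -(cvg_lim _ (cI M M0))// -(cvg_lim _ Xv)//.
  apply: lee_lim; [by apply: cvgP (cI M M0)|by apply: cvgP Xv|].
  near=> k; apply: ge0_le_integral => //.
  - by move=> w _; rewrite lee_fin le_min X0 ltW.
  - exact: mmin.
  - exact/measurable_EFinP.
  - by move=> w _; rewrite lee_fin ge_min lexx.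
have I0 M : 0 < M -> (0 <= I M)%E.
  by move=> M0; apply: integral_ge0 => w _; rewrite lee_fin le_min Z0 ltW.
have Ifin M : 0 < M -> I M \is a fin_num.
  by move=> M0; rewrite ge0_fin_numE ?I0// (le_lt_trans (lo M M0))// ltry.
have hi M : 0 < M -> (v%:E <= I M + (C / M)%:E)%E.
  move=> M0; rewrite -(cvg_lim _ Xv)//.
  have c2 : ((\int[P]_w (Num.min (X k w) M)%:E) + (C / M)%:E)%E @[k --> \oo] --> (I M + (C / M)%:E)%E.
    by apply: cvgeD; [rewrite fin_num_adde_defl|exact: cI|exact: cvg_cst].
  rewrite -(cvg_lim _ c2)//.
  apply: lee_lim; [by apply: cvgP Xv|by apply: cvgP c2|].
  near=> k.
  have XM w : (0 <= (M^-1 * X k w ^+ 2)%:E)%E.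
    by rewrite lee_fin mulr_ge0 ?exprn_ge0// invr_ge0 ltW.
  have mXM : measurable_fun setT (fun w => (M^-1 * X k w ^+ 2)%:E).
    by apply/measurable_EFinP; apply: measurable_funM => //; exact: measurable_funX.
  (* Pointwise, [x <= min x M + x ^ 2 / M]: the last term alone exceeds [x] as soon as [x > M]. *)
  apply: (@le_trans _ _ (\int[P]_w ((Num.min (X k w) M)%:E + (M^-1 * X k w ^+ 2)%:E))%E).
    apply: ge0_le_integral => //.
    - by move=> w _; rewrite lee_fin.
    - exact/measurable_EFinP.
    - by apply: emeasurable_funD => //; exact: mmin.
    - move=> w _; rewrite -EFinD lee_fin minEle; case: ifPn => [|]; rewrite -?ltNge => h.
        by rewrite lerDl mulr_ge0 ?exprn_ge0// invr_ge0 ltW.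
      rewrite (le_trans _ (_ : M^-1 * X k w ^+ 2 <= _)) ?lerDr ?(ltW M0)//.
      by rewrite mulrC ler_pdivlMr// expr2 ler_wpM2l// ltW.
  rewrite ge0_integralD//=; first last.
  - exact: mmin.
  - by move=> w _; rewrite lee_fin le_min X0 ltW.
  rewrite leeD2l//.
  under eq_integral do rewrite EFinM.
  rewrite ge0_integralZl_EFin//; first last.
  - by rewrite invr_ge0 ltW.
  - by apply/measurable_EFinP; exact: measurable_funX.
  - by move=> w _; rewrite lee_fin exprn_ge0.
  by rewrite mulrC EFinM lee_wpmul2l// lee_fin invr_ge0 ltW.
have Iv : I n.+1%:R @[n --> \oo] --> v%:E.
  apply: (@squeeze_cvge _ _ _ _ (fun n : nat => (v - C * n.+1%:R^-1)%:E) _ (fun=> v%:E)).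
  - near=> n; rewrite lo// andbT EFinB leeBlDr//.
    exact: hi.
  - apply: cvg_EFin; first exact: nearW.
    rewrite -[X in _ --> X]subr0; apply: cvgB; first exact: cvg_cst.
    by rewrite -(mulr0 C); apply: cvgMr; exact: cvg_harmonic.
  - exact: cvg_cst.
have IZ : I n.+1%:R @[n --> \oo] --> (\int[P]_w (Z w)%:E)%E.
  rewrite (_ : (fun w => (Z w)%:E) = (fun w => limn (fun n => (Num.min (Z w) n.+1%:R)%:E))); last first.
    apply/funext => w; apply/esym/cvg_lim => //.
    apply: cvg_EFin; first exact: nearW.
    apply: cvg_near_cst; near=> n.
    rewrite /= min_l//.
    have : Z w <= n%:R by near: n; exact: nbhs_infty_ger.
    by move=> h; rewrite (le_trans h)// ler_nat.
  apply: cvg_monotone_convergence => //.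
  - by move=> n; exact: mmin.
  - by move=> n w _; rewrite lee_fin le_min Z0 ler0n.
  - move=> w _ m n mn; rewrite lee_fin le_min ge_min lexx/= ge_min.
    by rewrite ler_nat ltnS mn orbT.
by rewrite -(cvg_lim _ Iv)// -(cvg_lim _ IZ).
Unshelve. all: by end_near. Qed.

(** * Limit of shrinking tents *)
Section tents.
Context {R : realType}.
Notation mu := (@lebesgue_measure R).
Implicit Types (k : nat) (p x z : R).

(** Height [k + 1] and half-width [1 / (k + 1)], hence mass 1. Continuity is what makes the
    occupation time of a tent differentiable in time. *)
Definition tent k p x : R := Num.max 0 (k.+1%:R - k.+1%:R ^+ 2 * `|x - p|).

Lemma continuous_tent k p : continuous (tent k p).
Proof.
move=> x.
apply: (@continuous_max _ _ (fun=> 0) (fun x : R => k.+1%:R - k.+1%:R ^+ 2 * `|x - p|)); first exact: cvg_cst.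
apply: cvgB; first exact: cvg_cst.
apply: cvgMr; apply: cvg_norm; apply: cvgB; [exact: cvg_id|exact: cvg_cst].
Qed.

Lemma tent_ge0 k p x : 0 <= tent k p x.
Proof. by rewrite le_max lexx. Qed.

Lemma tent_le k p x : tent k p x <= k.+1%:R.
Proof. by rewrite ge_max ler0n lerBlDr lerDl mulr_ge0. Qed.

Lemma tent_supp k p x : tent k p x != 0 -> `|x - p| <= k.+1%:R^-1.
Proof.
apply: contra_neqT; rewrite -ltNge => h; apply/max_l.
rewrite subr_le0 expr2 -mulrA ler_peMr ?ler0n// -ler_pdivrMl ?ltr0Sn// mulr1.
exact: ltW.
Qed.

Lemma tentE k p x : tent k p x = k.+1%:R * tent 0 0 (affine k.+1%:R (- (k.+1%:R * p)) x).
Proof.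
rewrite /tent /affine expr1n mul1r subr0 -mulrBr normrM (ger0_norm (ler0n R _)).
by rewrite maxr_pMr ?ler0n// mulr0 mulrBr mulr1 mulrA expr2.
Qed.

Lemma integral_tent k p : (\int[mu]_z (tent k p z)%:E = 1)%E.
Proof.
have m0 : measurable_fun setT (fun x => (tent 0 0 x)%:E).
  by apply/measurable_EFinP; apply: continuous_measurable_fun; exact: continuous_tent.
under eq_integral do rewrite tentE EFinM.
rewrite ge0_integralZl_EFin//; first last.
- by apply: (measurableT_comp m0); exact: measurable_affine.
- by move=> x _; rewrite lee_fin tent_ge0.
rewrite (ge0_integral_affine _ _ m0) ?ltr0Sn//; last by move=> x; rewrite lee_fin tent_ge0.
rewrite muleA -EFinM mulfV ?pnatr_eq0// mul1e.
rewrite ge0_symfun_integralT; first last.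
- by move=> x; rewrite /tent /= !subr0 normrN.
- exact: continuous_tent.
- exact: tent_ge0.
have -> : (\int[mu]_(x in [set x | (0 <= x)%R]) (tent 0 0 x)%:E = \int[mu]_(x in `[0%R, 1%R]) ((1 - x) ^+ 1 / 1`!%:R)%:E)%E.
  rewrite integral_mkcond [RHS]integral_mkcond; apply: eq_integral => x _; rewrite /patch.
  rewrite /tent expr1n mul1r subr0 expr1 divr1.
  case: (boolP (0 <= x)) => x0; last first.
    by rewrite !memNset//= ?in_itv/= ?(negbTE x0)//; apply/negP.
  rewrite mem_set// ger0_norm//.
  case: (leP x 1) => x1.
    by rewrite mem_set/= ?in_itv/= ?x0// max_r// subr_ge0.
  by rewrite memNset/= ?in_itv/= ?x0 ?leNgt ?x1//= max_l// subr_le0 ltW.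
rewrite integral_pow_sub// expr1n -EFinM; congr EFin.
by rewrite (_ : 2`! = 2)%N//; field.
Qed.

End tents.

Lemma cvg_iheatS (R : realType) n t (z : nat -> R) (z0 : R) : 0 < t ->
  (forall k, 0 <= z k) -> 0 <= z0 -> z k @[k --> \oo] --> z0 ->
  iheat n.+1 t (z k) @[k --> \oo] --> iheat n.+1 t z0.
Proof.
move=> t0 zk0 z00 zz.
rewrite -(fineK (iheat_fin_num n.+1 z0 t0)); apply: cvg_EFin.
  by apply: nearW => k; exact: iheat_fin_num.
apply/cvgrPdist_le => e e0.
have h0 := heat_bound_ge0 t.
have hb1 : 0 < heat_bound t + 1 by rewrite ltr_wpDl.
move/cvgrPdist_le : zz => /(_ (e / (heat_bound t + 1)) (divr_gt0 e0 hb1)).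
apply: filterS => k hk.
rewrite (le_trans (iheatS_lipschitz_dist n t0 z00 (zk0 k)))//.
rewrite (le_trans (_ : _ <= (heat_bound t + 1) * `|z0 - z k|))//.
  by rewrite ler_wpM2r// lerDl.
by rewrite -ler_pdivlMl// mulrC.
Qed.

Section local_time_moments.
Context d (T : measurableType d) (R : realType) (P : probability T R).
Variables (b : R -> {RV P >-> R}) (lam : R -> R -> {RV P >-> R}).
Hypothesis hb : brownian_bridge b.
Hypothesis hlam : local_times b lam.
Notation mu := (@lebesgue_measure R).
Notation occ := (occ b).
Notation path := (bridge_path b).
Notation kappa := (@kappa R).
Implicit Types (k n : nat) (p x y : R).

Lemma local_time_at1 : {ae P, forall w,
  continuous (fun x : R => lam 1 x w) /\
  forall phi : R -> R, measurable_fun setT phi -> (forall x, 0 <= phi x) ->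
    (\int[mu]_(s in `[0%R, 1%R]) (phi (path s w))%:E =
     \int[mu]_x (phi x * lam 1 x w)%:E)%E}.
Proof.
apply: filterS hlam => w [/subspace_continuousP cl hphi]; split.
  move=> x.
  have inA (q : R) : [set p : R * R | p.1 \in `[0, 1]] (1, q) by rewrite /= in_itv/= ler01 lexx.
  apply: (@cvg_comp _ _ _ (fun q : R => (1 : R, q)) (fun p : R * R => lam p.1 p.2 w) _ _ _ _ (cl (1, x) (inA x))) => A hA.
  have c1 : (1 : R, q) @[q --> x] --> ((1, x) : R * R) by exact: (cvg_pair (cvg_cst _) cvg_id).
  have h : nbhs x [set q : R | [set p : R * R | p.1 \in `[0, 1]] (1, q) -> A (1, q)] by exact: c1 hA.
  have : nbhs x [set q | A (1, q)] by apply: filterS h => q; apply.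
  by [].
move=> phi mphi phi0; rewrite -hphi//; last by rewrite in_itv/= ler01 lexx.
apply: eq_integral => s; rewrite inE/= in_itv/= => /andP[s0 s1].
by rewrite /bridge_path clip_id.
Qed.

(** By the occupation formula, the occupation time of a tent is an average of [lam 1 x w] over [x]
    near [p], so continuity in the level gives the limit. One null set serves for all levels [p]. *)
Lemma cvg_occ_tent : {ae P, forall w p, occ (tent k p) 1 w @[k --> \oo] --> lam 1 p w}.
Proof.
apply: filterS local_time_at1 => w [cl hphi] p.
have mtent k : measurable_fun setT (tent k p) by apply: continuous_measurable_fun; exact: continuous_tent.
have ml : measurable_fun setT (fun x : R => lam 1 x w) by exact: continuous_measurable_fun.
have oE k : (occ (tent k p) 1 w)%:E = (\int[mu]_x (tent k p x * lam 1 x w)%:E)%E.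
  rewrite (occE hb (continuous_tent (p := p)) (tent_ge0 k p) (tent_le k p)) hphi//.
  exact: tent_ge0.
have it k : mu.-integrable setT (EFin \o tent k p).
  apply/integrableP; split; first by apply/measurable_EFinP; exact: mtent.
  under eq_integral do rewrite /= ger0_norm ?tent_ge0//.
  by rewrite integral_tent ltry.
have itc k (c : R) : mu.-integrable setT (fun x => (c * tent k p x)%:E).
  exact: (integrableZl measurableT c (it k)).
have Itc k (c : R) : (\int[mu]_x (c * tent k p x)%:E = c%:E)%E.
  have := integralZl measurableT (it k) c => /= ->.
  by rewrite integral_tent mule1.
set l := lam 1 p w.
apply/cvgrPdist_le => e e0.
have [r /= r0 hr] : exists2 r : R, 0 < r & forall x, `|x - p| < r -> `|lam 1 x w - l| <= e.
  have /cvgrPdist_le/(_ e e0) := cl p.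
  move=> /nbhs_ballP[r /= r0 hr]; exists r => // x xp.
  by rewrite distrC; apply: hr; rewrite /ball/= distrC.
near=> k.
have kr : k.+1%:R^-1 < r.
  by near: k; exact: (cvgr_lt _ (@cvg_harmonic R) _ r0).
have bd x : (l - e) * tent k p x <= tent k p x * lam 1 x w <= (l + e) * tent k p x.
  have [->|/tent_supp t0] := eqVneq (tent k p x) 0; first by rewrite !mulr0 mul0r lexx.
  have := hr x (le_lt_trans t0 kr); rewrite ler_distl => /andP[h1 h2].
  rewrite [X in _ <= X <= _]mulrC !ler_wpM2r ?tent_ge0//=.
have il : mu.-integrable setT (fun x => (tent k p x * lam 1 x w)%:E).
  apply: (le_integrable measurableT _ _ (itc k (`|l| + e))).
    by apply/measurable_EFinP; exact: (measurable_funM (mtent k) ml).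
  move=> x _; rewrite lee_fin; have := bd x => /andP[h1 h2].
  rewrite [leRHS]ger0_norm ?mulr_ge0 ?tent_ge0 ?addr_ge0// ?(ltW e0)//.
  rewrite ler_norml (le_trans _ h1) ?(le_trans h2)//.
    by rewrite ler_wpM2r ?tent_ge0// lerD2r ler_norm.
  rewrite -mulNr ler_wpM2r ?tent_ge0// opprD lerD2r lerNl -normrN ler_norm//.
rewrite distrC ler_distl -!lee_fin oE -(Itc k (l - e)) -[X in _ && (_ <= X)%E](Itc k (l + e)).
by apply/andP; split; apply: le_integral => // x _; rewrite lee_fin; have /andP[] := bd x.
Unshelve. all: by end_near. Qed.

Lemma cvg_mixed_moment_dist up y n :
  mixed_moment_dist up k.+1%:R^-1 y n @[k --> \oo] --> 2 * `|y|.
Proof.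
apply/cvgrPdist_le => e e0.
have n0 : 0 < 2 * n%:R + 4 :> R by rewrite ltr_wpDl// mulr_ge0.
have : \forall k \near \oo, (k.+1%:R^-1 : R) < e / (2 * n%:R + 4).
  by apply: (cvgr_lt _ (@cvg_harmonic R)); rewrite divr_gt0.
apply: filterS => k; rewrite ltr_pdivlMr// => /ltW hk.
have k0 : 0 <= k.+1%:R^-1 :> R by rewrite invr_ge0.
have y0 := normr_ge0 y.
apply: le_trans hk; rewrite mulrC /mixed_moment_dist.
have nk : 0 <= n%:R * k.+1%:R^-1 :> R by rewrite mulr_ge0.
move: (k.+1%:R^-1) k0 nk => eps k0 nk.
rewrite ler_norml; case: up; last by apply/andP; split; lra.
by rewrite !maxEle; case: ifPn; rewrite -?ltNge => ?; apply/andP; split; lra.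
Qed.

Lemma mixed_moment_dist_ge0 up (eps : R) y n : 0 <= eps -> 0 <= mixed_moment_dist up eps y n.
Proof.
move=> e0; rewrite /mixed_moment_dist; case: up; first by rewrite le_max lexx.
by rewrite addr_ge0 ?mulr_ge0// addr_ge0// mulr_ge0.
Qed.

(** The mixed moments of tents are squeezed between the bounds for [up = false] and [up = true],
    both of which converge to the right-hand side; bounded second moments carry the limit over to
    the local times. *)
Lemma local_time_moment y n :
  (\int[P]_w (lam 1 y w * lam 1 0 w ^+ n)%:E =
   (kappa * n.+1`!%:R)%:E * iheat n.+1 1 (2 * `|y|))%E.
Proof.
pose f k := tent k (0 : R); pose phi k := tent k y.
have ct k p : continuous (tent k p : R -> R) by exact: continuous_tent.
have t0 k p x : 0 <= tent k p x by exact: tent_ge0.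
have tk k p x : tent k p x <= k.+1%:R by exact: tent_le.
have O0 k p w : 0 <= occ (tent k p) 1 w by exact: (occ_ge0 hb (ct k p) (t0 k p) (tk k p)).
have mO k p : measurable_fun setT (occ (tent k p) 1).
  exact: (measurable_occ_t hb 1 (ct k p) (t0 k p) (tk k p)).
have mOX k p m : measurable_fun setT (fun w => (occ (tent k p) 1 w ^+ m)%:E).
  by apply/measurable_EFinP; exact: (measurable_funX m (mO k p)).
have kk k : 0 <= k.+1%:R^-1 :> R by rewrite invr_ge0.
pose C m := kappa * m.+1`!%:R * fine (iheat m.+1 1 (0 : R)).
have CE m : ((kappa * m.+1`!%:R)%:E * iheat m.+1 1 (0 : R) = (C m)%:E)%E.
  by rewrite /C [RHS]EFinM fineK ?iheat_fin_num.
have OC k p m : (\int[P]_w (occ (tent k p) 1 w ^+ m.+1)%:E <= (C m)%:E)%E.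
  by rewrite -CE; exact: (occ_moment_le hb (ct k p) (t0 k p) (tk k p) (kk k) (@tent_supp R k p) (integral_tent k p) m).2.
have cvgS (up : bool) : ((kappa * n.+1`!%:R)%:E * iheat n.+1 1 (mixed_moment_dist up k.+1%:R^-1 y n))%E @[k --> \oo] -->
    ((kappa * n.+1`!%:R)%:E * iheat n.+1 1 (2 * `|y|))%E.
  apply: cvgeZl => //; apply: cvg_iheatS => //.
  - by move=> k; exact: mixed_moment_dist_ge0.
  - exact: cvg_mixed_moment_dist.
have cX : (\int[P]_w (occ (f k) 1 w ^+ n * occ (phi k) 1 w)%:E)%E @[k --> \oo] -->
    ((kappa * n.+1`!%:R)%:E * iheat n.+1 1 (2 * `|y|))%E.
  apply: (squeeze_cvge _ (cvgS false) (cvgS true)); apply: nearW => k.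
  have h (up : bool) := occ_mixed_moment hb up (ct k 0) (t0 k 0) (tk k 0) (ct k y) (t0 k y) (tk k y)
    (kk k) (@tent_supp R k 0) (integral_tent k 0) (@tent_supp R k y) (integral_tent k y) n.
  by apply/andP; split; [exact: (h false)|exact: (h true)].
have vfin : ((kappa * n.+1`!%:R)%:E * iheat n.+1 1 (2 * `|y|) \is a fin_num)%E.
  by rewrite fin_numM// iheat_fin_num.
rewrite -(fineK vfin) in cX *.
(* The constant comes from [(A ^ n B) ^ 2 <= A ^ (4 n) + B ^ 4] and
   [A ^ (4 n) <= 1 + A ^ (4 n + 1)]. The second inequality is there because [OC] bounds positive
   powers only, and [n] may be [0]. *)
apply: (@integral_cvg_square_bounded _ _ _ P (fun k w => occ (f k) 1 w ^+ n * occ (phi k) 1 w)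
  (fun w => lam 1 y w * lam 1 0 w ^+ n) (1 + C (4 * n)%N + C 3)).
- by move=> k; exact: (measurable_funM (measurable_funX n (mO k 0)) (mO k y)).
- by apply: measurable_funM => //; exact: measurable_funX.
- by move=> k w; rewrite mulr_ge0 ?exprn_ge0 ?O0.
- apply: filterS cvg_occ_tent => w h; rewrite mulrC.
  apply: (cvgM _ (h y)); exact: (cvg_comp _ _ (h 0) (@exprn_continuous _ n _)).
- move=> k.
  apply: (@le_trans _ _ (\int[P]_w ((1 + (occ (f k) 1 w ^+ (4 * n).+1)%:E) + (occ (phi k) 1 w ^+ 4)%:E))%E).
    apply: ge0_le_integral => //.
    - by move=> w _; rewrite lee_fin sqr_ge0.
    - apply/measurable_EFinP; exact: (measurable_funX 2 (measurable_funM (measurable_funX n (mO k 0)) (mO k y))).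
    - apply: emeasurable_funD; last exact: mOX.
      by apply: emeasurable_funD => //; exact: mOX.
    move=> w _; rewrite -!EFinD lee_fin.
    set A := occ (f k) 1 w; set B := occ (phi k) 1 w.
    have A0 : 0 <= A by exact: O0.
    have h1 : A ^+ (4 * n) <= 1 + A ^+ (4 * n).+1.
      have [A1|/ltW A1] := leP A 1.
        by rewrite (le_trans (exprn_ile1 _ A0 A1))// lerDl exprn_ge0.
      by rewrite (le_trans (ler_weXn2l A1 (leqnSn _)))// lerDr.
    rewrite (le_trans _ (lerD h1 (lexx _)))//.
    have -> : A ^+ (4 * n) = (A ^+ n) ^+ 2 ^+ 2 by rewrite mulnC -[4%N]/(2 * 2)%N exprM exprM.
    have -> : B ^+ 4 = B ^+ 2 ^+ 2 by rewrite -exprM.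
    rewrite exprMn; set a := (A ^+ n) ^+ 2; set c := B ^+ 2.
    have := sqr_ge0 (a - c); have := sqr_ge0 a; have := sqr_ge0 c; nra.
  rewrite ge0_integralD//; first last.
  - exact: mOX.
  - by move=> w _; rewrite lee_fin exprn_ge0 ?O0.
  - by apply: emeasurable_funD => //; exact: mOX.
  - by move=> w _; rewrite adde_ge0// lee_fin exprn_ge0 ?O0.
  rewrite ge0_integralD//; first last.
  - exact: mOX.
  - by move=> w _; rewrite lee_fin exprn_ge0 ?O0.
  rewrite integral_cst//= probability_setT mule1 !EFinD leeD// ?leeD//; exact: OC.
- exact: cX.
Qed.

End local_time_moments.

(** * Moment determinacy *)
Section moment_uniqueness.
Context {R : realType}.
Implicit Types (a eta u x : R) (m : {finite_measure set R -> \bar R}).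

Lemma series_exp_coeff_le u N : 0 <= u -> series (exp_coeff u) N <= expR u.
Proof.
move=> u0; apply: nondecreasing_cvgn_le; last exact: is_cvg_series_exp_coeff.
by apply: nondecreasing_series => n _ _; exact: exp_coeff_ge0.
Qed.

Lemma exp_coeff_le u n : 0 <= u -> u ^+ n / n`!%:R <= expR u.
Proof.
move=> u0; rewrite (le_trans _ (series_exp_coeff_le n.+1 u0))//.
rewrite /series/= big_nat_recr//= lerDr; apply: sumr_ge0 => i _; exact: exp_coeff_ge0.
Qed.

(** Taylor coefficients in [x] of [cos (a x + eta)], after the addition formula; the parity factors
    select the even terms of the cosine series and the odd terms of the sine series. *)
Let coef a eta (k : nat) : R :=
  (cos eta * ((~~ odd k)%:R * (-1) ^+ k./2) - sin eta * ((odd k)%:R * (-1) ^+ k.-1./2))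
  * (a ^+ k / k`!%:R).

Let partial a eta N x : R := 1 + \sum_(k < N) coef a eta k * x ^+ k.

Let partialE a eta N x : partial a eta N x =
  1 + (cos eta * series (cos_coeff (a * x)) N - sin eta * series (sin_coeff (a * x)) N).
Proof.
rewrite /partial /series/= !big_mkord !mulr_sumr -sumrB; congr (1 + _).
apply: eq_bigr => k _; rewrite /coef /cos_coeff /sin_coeff/= -exprnP exprMn.
move: (~~ odd k)%:R (odd k)%:R ((-1) ^+ k./2) ((-1) ^+ k.-1./2) (k`!%:R^-1) => p q r s f.
by ring.
Qed.

Let cvg_partial a eta x : partial a eta N x @[N --> \oo] --> 1 + cos (a * x + eta).
Proof.
under eq_fun do rewrite partialE.
rewrite addrC [_ + eta]addrC cosD addrC; apply: cvgD; first exact: cvg_cst.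
apply: cvgB.
  apply: cvgMr; move: (a * x) => u; rewrite unlock; exact: is_cvg_series_cos_coeff.
apply: cvgMr; move: (a * x) => u; rewrite unlock; exact: is_cvg_series_sin_coeff.
Qed.

Let coef_le a eta k x : `|coef a eta k * x ^+ k| <= 2 * exp_coeff (`|a| * `|x|) k.
Proof.
rewrite /coef /exp_coeff/= -mulrA normrM.
rewrite mulrAC -exprMn [X in _ * X]normrM normrX normfV normr_nat normrM.
apply: ler_wpM2r; first by rewrite divr_ge0// exprn_ge0// mulr_ge0.
rewrite (le_trans (ler_normB _ _))// -[2]/(1 + 1)%R lerD//.
  rewrite !normrM normrX normrN1 expr1n mulr1 normr_nat.
  by rewrite mulr_ile1// ?ler_norml ?cos_geN1 ?cos_le1//; case: (odd _).
rewrite !normrM normrX normrN1 expr1n mulr1 normr_nat.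
by rewrite mulr_ile1// ?ler_norml ?sin_geN1 ?sin_le1//; case: (odd _).
Qed.

Let partial_le a eta N x : `|partial a eta N x| <= 3 * expR (`|a| * `|x|).
Proof.
have u0 : 0 <= `|a| * `|x| by rewrite mulr_ge0.
rewrite (le_trans (ler_normD _ _))// normr1.
have h1 : 1 <= expR (`|a| * `|x|) by rewrite -expR0 ler_expR.
have h2 := series_exp_coeff_le N u0.
suff h3 : `|\sum_(k < N) coef a eta k * x ^+ k| <= 2 * series (exp_coeff (`|a| * `|x|)) N by lra.
rewrite (le_trans (ler_norm_sum _ _ _))// /series/= big_mkord mulr_sumr.
by apply: ler_sum => k _; exact: coef_le.
Qed.

Let mexp a : measurable_fun setT (fun x : R => expR (a * `|x|)).
Proof.
by apply: measurableT_comp => //; exact: measurable_funM.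
Qed.

Lemma integral_expR_series m (a : R) : 0 <= a ->
  (\int[m]_x (series (exp_coeff (a * `|x|)) N)%:E)%E @[N --> \oo] -->
  (\int[m]_x (expR (a * `|x|))%:E)%E.
Proof.
move=> a0.
have -> : (fun x : R => (expR (a * `|x|))%:E) = (fun x => limn (fun N => (series (exp_coeff (a * `|x|)) N)%:E)).
  apply/funext => x; apply/esym/cvg_lim => //.
  by apply: cvg_EFin; [exact: nearW|exact: is_cvg_series_exp_coeff].
have e0 x n : 0 <= exp_coeff (a * `|x|) n by apply: exp_coeff_ge0; rewrite mulr_ge0.
apply: cvg_monotone_convergence => //.
- move=> N; apply/measurable_EFinP; rewrite /series/=; apply: measurable_sum => k.
  by apply: measurable_funM => //; apply: measurable_funX; exact: measurable_funM.
- by move=> N x _; rewrite lee_fin; apply: sumr_ge0.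
- by move=> x _ p q pq; rewrite lee_fin; apply: nondecreasing_series.
Qed.

Section two_measures.
Variables m1 m2 : {finite_measure set R -> \bar R}.
Hypothesis pos1 : m1 `]-oo, 0[%classic = 0%E.
Hypothesis pos2 : m2 `]-oo, 0[%classic = 0%E.
Hypothesis abs_moments : forall n, (\int[m1]_x (`|x| ^+ n)%:E = \int[m2]_x (`|x| ^+ n)%:E)%E.
Hypothesis exp_moments : forall a, (\int[m2]_x (expR (a * `|x|))%:E < +oo)%E.

(** Both measures are carried by [[0, +oo[], where absolute and ordinary powers coincide. *)
Let moments n : (\int[m1]_x (x ^+ n)%:E = \int[m2]_x (x ^+ n)%:E)%E.
Proof.
have h (m : {finite_measure set R -> \bar R}) : m `]-oo, 0[%classic = 0%E ->
    (\int[m]_x (x ^+ n)%:E = \int[m]_x (`|x| ^+ n)%:E)%E.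
  move=> m0; apply: ae_eq_integral => //.
  - by apply/measurable_EFinP; exact: exprn_measurable.
  - by apply/measurable_EFinP; exact: measurable_funX.
  exists `]-oo, 0[%classic; split => // x /= /not_implyP[_ xx].
  by rewrite in_itv/= ltNge; apply/negP => x0; apply: xx; rewrite ger0_norm.
by rewrite !h.
Qed.

(** The integral of the exponential is the limit of sums of absolute moments, by monotone
    convergence; equality of these moments transfers finiteness from [m2] to [m1]. *)
Let exp_moments1 a : 0 <= a -> (\int[m1]_x (expR (a * `|x|))%:E < +oo)%E.
Proof.
move=> a0; rewrite -(cvg_lim _ (@integral_expR_series m1 _ a0))//.
rewrite (_ : (fun N => _) = (fun N => (\int[m2]_x (series (exp_coeff (a * `|x|)) N)%:E)%E)).
  by rewrite (cvg_lim _ (@integral_expR_series m2 _ a0)).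
apply/funext => N.
have h (m : {finite_measure set R -> \bar R}) : (\int[m]_x (series (exp_coeff (a * `|x|)) N)%:E =
    \sum_(0 <= k < N) (a ^+ k / k`!%:R)%:E * \int[m]_x (`|x| ^+ k)%:E)%E.
  under eq_integral do rewrite /series/= -sumEFin.
  rewrite ge0_integral_sum//; last first.
  - by move=> n x _; rewrite lee_fin exp_coeff_ge0// mulr_ge0.
  - move=> n; apply/measurable_EFinP.
    by apply: measurable_funM => //; apply: measurable_funX; exact: measurable_funM.
  apply: eq_bigr => k _; rewrite -ge0_integralZl_EFin//; first last.
  - by rewrite divr_ge0// exprn_ge0.
  - by apply/measurable_EFinP; exact: measurable_funX.
  by apply: eq_integral => x _; rewrite -EFinM /exp_coeff/= exprMn mulrAC.
by rewrite !h; apply: eq_bigr => k _; rewrite abs_moments.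
Qed.

Let iexp (m : {finite_measure set R -> \bar R}) (c a : R) : (\int[m]_x (expR (a * `|x|))%:E < +oo)%E ->
  m.-integrable setT (fun x => (c * expR (a * `|x|))%:E).
Proof.
move=> h; have ie : m.-integrable setT (EFin \o (fun x => expR (a * `|x|))).
  apply/integrableP; split; first exact/measurable_EFinP.
  by under eq_integral do rewrite /= ger0_norm ?expR_ge0//.
exact: (integrableZl measurableT c ie).
Qed.

Let ipow (m : {finite_measure set R -> \bar R}) n : (forall a, 0 <= a -> (\int[m]_x (expR (a * `|x|))%:E < +oo)%E) ->
  m.-integrable setT (fun x : R => (x ^+ n)%:E).
Proof.
move=> h; apply: (le_integrable measurableT _ _ (iexp n`!%:R (h 1 ler01))).
  by apply/measurable_EFinP; exact: exprn_measurable.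
move=> x _; rewrite lee_fin [leRHS]ger0_norm ?mulr_ge0 ?expR_ge0// normrX mul1r.
rewrite -ler_pdivrMl ?ltr0n ?fact_gt0// mulrC.
exact: exp_coeff_le.
Qed.

Let mpartial a eta N : measurable_fun setT (fun x => (partial a eta N x)%:E).
Proof.
apply/measurable_EFinP; apply: measurable_funD => //; apply: measurable_sum => k.
by apply: measurable_funM => //; exact: exprn_measurable.
Qed.

Let integral_partial a eta N : (\int[m1]_x (partial a eta N x)%:E = \int[m2]_x (partial a eta N x)%:E)%E.
Proof.
have h (m : {finite_measure set R -> \bar R}) : (forall a, 0 <= a -> (\int[m]_x (expR (a * `|x|))%:E < +oo)%E) ->
    (\int[m]_x (partial a eta N x)%:E =
     \int[m]_x (x ^+ 0)%:E + \sum_(k < N) (coef a eta k)%:E * \int[m]_x (x ^+ k)%:E)%E.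
  move=> hm; have i0 := ipow _ hm.
  have ic (k : nat) : m.-integrable setT (fun x => (coef a eta k * x ^+ k)%:E).
    exact: (integrableZl measurableT _ (i0 k)).
  under eq_integral do rewrite EFinD -sumEFin.
  rewrite integralD//; first last.
  - exact: integrable_sum.
  - exact: (i0 0).
  rewrite integral_sum//; congr (_ + _)%E.
  by apply: eq_bigr => k _; exact: (integralZl measurableT (i0 k)).
rewrite h; last exact: exp_moments1.
rewrite h; last by move=> *; exact: exp_moments.
by rewrite moments; congr (_ + _)%E; apply: eq_bigr => k _; rewrite moments.
Qed.

(** The Taylor polynomials of [1 + cos (a x + eta)] have equal integrals and are dominated by
    [3 expR (|a| |x|)]. Passing to the limit gives equal cosine transforms. *)
Lemma moment_uniqueness (A : set R) : measurable A -> m1 A = m2 A.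
Proof.
apply: fourier_uniqueness => a eta.
have h (m : {finite_measure set R -> \bar R}) : (forall a, 0 <= a -> (\int[m]_x (expR (a * `|x|))%:E < +oo)%E) ->
    (\int[m]_x (partial a eta N x)%:E)%E @[N --> \oo] --> (\int[m]_x (1 + cos (a * x + eta))%:E)%E.
  move=> hm.
  have h1 : measurable_fun setT (fun x => (1 + cos (a * x + eta))%:E).
    apply/measurable_EFinP; apply: measurable_funD => //.
    apply: measurableT_comp; first by apply: continuous_measurable_fun; exact: continuous_cos.
    by apply: measurable_funD => //; exact: measurable_funM.
  have h2 : {ae m, forall x, setT x -> (partial a eta N x)%:E @[N --> \oo] --> (1 + cos (a * x + eta))%:E}.
    by apply: aeW => x _; apply: cvg_EFin; [exact: nearW|exact: cvg_partial].
  have h4 : {ae m, forall x N, setT x -> (`|(partial a eta N x)%:E| <= (3 * expR (`|a| * `|x|))%:E)%E}.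
    by apply: aeW => x N _; rewrite lee_fin partial_le.
  by have [_ _] := dominated_convergence measurableT (mpartial a eta) h1 h2 (iexp 3 (hm `|a| (normr_ge0 _))) h4.
have c1 := h m1 exp_moments1; have c2 := h m2 (fun a _ => exp_moments a).
rewrite -(cvg_lim _ c1)// -(cvg_lim _ c2)//; congr (lim (_ @ \oo)).
by apply/funext => N; exact: integral_partial.
Qed.

End two_measures.
End moment_uniqueness.

Lemma integral_weighted_image d (T : measurableType d) (R : realType)
    (m : {measure set T -> \bar R}) (W L : T -> R) (mW : measurable_fun setT W)
    (W0 : forall w, 0 <= W w) (mL : measurable_fun setT L)
    (fin : (image_measure (weighted_measure m mW W0) (pack_mfun mL) setT < +oo)%E) (f : R -> R) :
  measurable_fun setT f -> (forall x, 0 <= f x) ->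
  (\int[as_finite_measure fin]_x (f x)%:E = \int[m]_w (f (L w) * W w)%:E)%E.
Proof.
move=> mf f0; transitivity (\int[weighted_measure m mW W0]_w (f (L w))%:E)%E.
  apply/esym; apply: (@ge0_integral_law _ _ _ _ _ (weighted_measure m mW W0)
      (as_finite_measure fin) L (fun x => (f x)%:E)) => //.
  exact/measurable_EFinP.
rewrite ge0_integral_weighted_measure//.
- by apply/measurable_EFinP; exact: measurableT_comp.
- by move=> w; rewrite lee_fin.
Qed.

(** * The law of the local time at 0 weighted by the local time at [y] *)

Section local_time_law.
Context d (T : measurableType d) (R : realType) (P : probability T R).
Variables (b : R -> {RV P >-> R}) (lam : R -> R -> {RV P >-> R}).
Hypothesis hb : brownian_bridge b.
Hypothesis hlam : local_times b lam.
Notation mu := (@lebesgue_measure R).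
Notation kappa := (@kappa R).
Implicit Types (k n : nat) (x y l : R).

(** The factor [Num.max 0 l] is the prefactor [l] and the restriction to [l >= 0] in one expression,
    defined and non-negative for all real [l]. *)
Definition joint_density y l : R :=
  Num.max 0 l * (2 * `|y| + l) * expR (- (2 * `|y| + l) ^+ 2 / 2).

Lemma joint_density_ge0 y l : 0 <= joint_density y l.
Proof.
rewrite /joint_density maxEle; case: ifPn => l0; last by rewrite !mul0r.
by rewrite mulr_ge0 ?expR_ge0// mulr_ge0// addr_ge0// mulr_ge0.
Qed.

Lemma joint_density_neg y l : l <= 0 -> joint_density y l = 0.
Proof. by move=> l0; rewrite /joint_density max_l// !mul0r. Qed.

Lemma measurable_joint_density d' (T' : measurableType d') (f g : T' -> R) :
  measurable_fun setT f -> measurable_fun setT g ->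
  measurable_fun setT (fun w => joint_density (f w) (g w)).
Proof.
move=> mf mg; have m2 : measurable_fun setT (fun w => 2 * `|f w| + g w).
  by apply: measurable_funD => //; apply: measurable_funM => //; exact: measurableT_comp.
apply: measurable_funM.
  by apply: measurable_funM => //; exact: measurable_maxr.
apply: measurableT_comp => //; apply: measurable_funM => //.
by apply: measurableT_comp => //; exact: measurable_funX.
Qed.

(** This is [iheat_cauchy] at [n + 1]: the factorial cancels that of the kernel, and its power
    [l ^ n.+1] contains the extra factor [l] of the density. *)
Lemma integral_joint_density y n :
  (\int[mu]_l (l ^+ n * joint_density y l)%:E =
   (kappa * n.+1`!%:R)%:E * iheat n.+1 1 (2 * `|y|))%E.
Proof.
have y0 : 0 <= 2 * `|y| by rewrite mulr_ge0.
rewrite iheat_cauchy// -ge0_integralZl//; first last.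
- by rewrite lee_fin mulr_ge0// ltW// kappa_gt0.
- move=> l /=; rewrite in_itv/= andbT => l0; rewrite lee_fin mulr_ge0 ?divr_ge0 ?exprn_ge0//.
  by rewrite mulr_ge0 ?heat_ge0// divr_ge0// addr_ge0.
- apply: measurable_funTS; apply/measurable_EFinP; apply: measurable_funM.
    by apply: measurable_funM => //; exact: exprn_measurable.
  apply: measurable_funM; first by apply: measurable_funM => //; exact: measurable_funD.
  by apply: measurable_heat2 => //; exact: measurable_funD.
rewrite [RHS]integral_mkcond; apply: eq_integral => l _; rewrite patchE.
case: ifPn => [|/negP]; rewrite inE/= in_itv/= andbT.
  move=> l0; rewrite -EFinM; congr EFin.
  rewrite /joint_density max_r// divr1 (exprS l n) /heat !mulr1 /kappa.
  have k0 : Num.sqrt (2 * pi) != 0 :> R by rewrite gt_eqF// sqrtr_gt0 mulr_gt0// pi_gt0.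
  have f0 : n.+1`!%:R != 0 :> R by rewrite pnatr_eq0 -lt0n fact_gt0.
  by field; apply/andP; split.
by move=> /negP; rewrite -ltNge => /ltW l0; rewrite joint_density_neg// mulr0.
Qed.

Lemma exp_moment_joint_density y a :
  (\int[mu]_l (expR (a * `|l|) * joint_density y l)%:E < +oo)%E.
Proof.
set c := 2 * `|y|; have c0 : 0 <= c by rewrite mulr_ge0.
(* From [|a| u <= a ^ 2 + u ^ 2 / 4] with [u = l + c]: half of the Gaussian exponent remains, which
   is that of [heat 2], and the square root undoes the normalization of [heat 2]. *)
pose C := expR (a ^+ 2) * Num.sqrt (2 * pi * 2).
have s0 : 0 < Num.sqrt (2 * pi * 2) :> R by rewrite sqrtr_gt0 !mulr_gt0// pi_gt0.
have C0 : 0 <= C by rewrite mulr_ge0 ?expR_ge0// ltW.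
have mh : measurable_fun setT (fun u : R => (u ^+ 2 * heat 2 u)%:E).
  by apply/measurable_EFinP; apply: measurable_funM; [exact: exprn_measurable|exact: measurable_heat2].
have h0 (u : R) : (0 <= (u ^+ 2 * heat 2 u)%:E)%E by rewrite lee_fin mulr_ge0 ?sqr_ge0 ?heat_ge0.
apply: (@le_lt_trans _ _ (\int[mu]_l (C%:E * ((l + c) ^+ 2 * heat 2 (l + c))%:E))%E); last first.
  rewrite ge0_integralZl_EFin//; last first.
    by apply: (measurableT_comp mh); exact: measurable_funD.
  by rewrite (ge0_integral_shift c mh)// heat_second_moment// -EFinM ltry.
apply: ge0_le_integral => //.
- by move=> l _; rewrite lee_fin mulr_ge0 ?expR_ge0 ?joint_density_ge0.
- apply/measurable_EFinP; apply: measurable_funM; last exact: measurable_joint_density.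
  by apply: measurableT_comp => //; exact: measurable_funM.
- by apply: emeasurable_funM => //; apply: (measurableT_comp mh); exact: measurable_funD.
move=> l _; rewrite -EFinM lee_fin.
have [l0|/ltW l0] := leP l 0.
  by rewrite joint_density_neg// mulr0 mulr_ge0// mulr_ge0 ?sqr_ge0 ?heat_ge0.
rewrite /joint_density max_r// -/c [c + l]addrC; set u := l + c.
have lu : l <= u by rewrite lerDl.
have u0 : 0 <= u by rewrite addr_ge0.
rewrite ger0_norm// /C /heat mulrACA [X in _ <= X](_ : _ = u ^+ 2 * (expR (a ^+ 2) * expR (- u ^+ 2 / (2 * 2)))); last first.
  by field; rewrite gt_eqF.
rewrite (_ : expR _ * _ = (l * u) * (expR (a * l) * expR (- u ^+ 2 / 2))); last by ring.
apply: ler_pM; rewrite ?mulr_ge0 ?expR_ge0//.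
  by rewrite expr2 ler_wpM2r.
rewrite -!expRD ler_expR.
have h1 : a * l <= `|a| * u.
  rewrite (le_trans (ler_norm _))// normrM ler_wpM2l// ger0_norm//.
have := sqr_ge0 (`|a| - u / 2); rewrite sqrrB real_normK ?num_real//; lra.
Qed.

(** Both sides are measures in [A] with the same moments, and the right-hand one has exponential
    moments of all orders, so they coincide by moment determinacy. *)
Lemma integral_local_times y (A : set R) : measurable A ->
  (\int[P]_(w in lam 1 0 @^-1` A) (lam 1 y w)%:E = \int[mu]_(l in A) (joint_density y l)%:E)%E.
Proof.
move=> mA.
have lge0 : {ae P, forall w x, 0 <= lam 1 x w}.
  apply: filterS (cvg_occ_tent hb hlam) => w h x; rewrite -(cvg_lim _ (h x))//.
  apply: limr_ge; first by apply: cvgP (h x).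
  near=> k; exact: (occ_ge0 hb (continuous_tent (p := x)) (tent_ge0 k x) (tent_le k x)).
(* Local times are non-negative only almost surely. The positive parts are non-negative everywhere,
   so that [W] can weight a measure and the image under [L] charges no negative number. *)
pose W w := Num.max 0 (lam 1 y w); pose L w := Num.max 0 (lam 1 0 w).
have mW : measurable_fun setT W by exact: measurable_maxr.
have mL : measurable_fun setT L by exact: measurable_maxr.
have W0 w : 0 <= W w by rewrite le_max lexx.
have L0 w : 0 <= L w by rewrite le_max lexx.
have mom n : (\int[P]_w (L w ^+ n * W w)%:E = \int[mu]_l (l ^+ n * joint_density y l)%:E)%E.
  rewrite integral_joint_density -(local_time_moment hb hlam); apply: ae_eq_integral => //.
  - by apply/measurable_EFinP; apply: measurable_funM => //; exact: measurable_funX.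
  - by apply/measurable_EFinP; apply: measurable_funM => //; exact: measurable_funX.
  by apply: filterS lge0 => w h _; rewrite /L /W !max_r// mulrC.
have qfin : (\int[mu]_l (joint_density y l)%:E < +oo)%E.
  have := exp_moment_joint_density y 0; apply: le_lt_trans.
  by under [leRHS]eq_integral do rewrite mul0r expR0 mul1r.
have mq : measurable_fun setT (joint_density y) by exact: measurable_joint_density.
pose m1' := image_measure (weighted_measure P mW W0) (pack_mfun mL).
have fin1 : (m1' setT < +oo)%E.
  have -> : m1' setT = (\int[P]_w (W w)%:E)%E by rewrite /m1' /image_measure /pushforward preimage_setT.
  have := mom 0; under eq_integral do rewrite expr0 mul1r; move=> ->.
  by under eq_integral do rewrite expr0 mul1r.
have mid : measurable_fun (setT : set (measurableTypeR R)) (id : measurableTypeR R -> R) by exact: measurable_id.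
pose m2' := image_measure (weighted_measure mu mq (joint_density_ge0 y)) (pack_mfun mid).
have fin2 : (m2' setT < +oo)%E by [].
pose m1 := as_finite_measure fin1; pose m2 := as_finite_measure fin2.
have E1 (f : R -> R) : measurable_fun setT f -> (forall x, 0 <= f x) ->
    (\int[m1]_x (f x)%:E = \int[P]_w (f (L w) * W w)%:E)%E.
  by move=> mf f0; exact: integral_weighted_image.
have E2 (f : R -> R) : measurable_fun setT f -> (forall x, 0 <= f x) ->
    (\int[m2]_x (f x)%:E = \int[mu]_l (f l * joint_density y l)%:E)%E.
  by move=> mf f0; exact: (integral_weighted_image (L := id : measurableTypeR R -> R)).
have h : m1 A = m2 A.
  apply: moment_uniqueness => //.
  - change (weighted_measure P mW W0 (L @^-1` `]-oo, 0[%classic) = 0%E).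
    rewrite (_ : _ @^-1` _ = set0) ?measure0//; apply/seteqP; split => // w /=.
    by rewrite in_itv/= ltNge L0.
  - change (\int[mu]_(l in `]-oo, 0%R[%classic) (joint_density y l)%:E = 0)%E.
    apply: integral0_eq => l /=.
    by rewrite in_itv/= => /ltW l0; rewrite joint_density_neg.
  - move=> n; rewrite E1//; last by apply: measurable_funX.
    rewrite E2//; last by apply: measurable_funX.
    have -> : (\int[mu]_l (`|l| ^+ n * joint_density y l)%:E = \int[mu]_l (l ^+ n * joint_density y l)%:E)%E.
      apply: eq_integral => l _; congr EFin.
      have [l0|/ltW l0] := leP l 0; first by rewrite joint_density_neg// !mulr0.
      by rewrite ger0_norm.
    rewrite -mom; apply: eq_integral => w _.
    by rewrite ger0_norm.
  - move=> a; rewrite E2; first exact: exp_moment_joint_density.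
      by apply: measurableT_comp => //; exact: measurable_funM.
    by move=> x; exact: expR_ge0.
rewrite -[RHS]h /m1 /as_finite_measure /m1' /image_measure /pushforward /weighted_measure.
rewrite integral_mkcond [RHS]integral_mkcond; apply: ae_eq_integral => //.
- apply/(measurable_restrictT _ _).1; first by rewrite -[_ @^-1` _]setTI; exact: measurable_funP.
  by apply: measurable_funTS; exact/measurable_EFinP.
- apply/(measurable_restrictT _ _).1; first by rewrite -[_ @^-1` _]setTI; exact: (mL measurableT A mA).
  by apply: measurable_funTS; exact/measurable_EFinP.
apply: filterS lge0 => w hw _; rewrite !patchE /W max_r//.
have e : (pack_mfun mL @^-1` A) w = (lam 1 0 @^-1` A) w.
  by change (A (L w) = A (lam 1 0 w)); rewrite /L max_r.
by rewrite (_ : (w \in pack_mfun mL @^-1` A) = (w \in lam 1 0 @^-1` A))//; apply/idP/idP; rewrite !inE e.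
Unshelve. all: by end_near. Qed.

End local_time_law.

(** * A path-measurable version of the local time, and the bridge at a uniform time *)

Section continuum_local_time.
Context d (T : measurableType d) (R : realType).
Notation mu := (@lebesgue_measure R).

(* Unlike an arbitrary family of local times, this version is jointly measurable
   and measurable with respect to the process alone. *)
Definition loc_time (X : R -> T -> R) (x : R) (w : T) : \bar R :=
  maxe 0%:E (limn_esup (fun k => \int[mu]_(q in `[0%R, 1%R]) (tent k x (X q w))%:E))%E.

Lemma measurable_loc_time X : measurable_fun setT (fun p : R * T => X p.1 p.2) ->
  measurable_fun setT (fun p : R * T => loc_time X p.1 p.2).
Proof.
move=> mX; apply: measurable_maxe => //; apply: measurable_fun_limn_esup => k.
apply: (measurable_integral_right mu (f := fun (p : R * T) q => (tent k p.1 (X q p.2))%:E)) => //.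
  apply/measurable_EFinP.
  have m3 : measurable_fun setT (fun p : (R * T) * measurableTypeR R => X p.2 p.1.2).
    apply: (measurableT_comp mX (f := fun p : R * T => X p.1 p.2) (g := fun p : (R * T) * measurableTypeR R => (p.2 : R, p.1.2))).
    apply: measurable_fun_pair; first exact: measurable_snd.
    exact: (measurableT_comp measurable_snd measurable_fst).
  apply: measurable_maxr => //; apply: measurable_funB => //; apply: measurable_funM => //.
  apply: measurableT_comp => //; apply: measurable_funB => //.
  exact: (measurableT_comp measurable_fst measurable_fst).
by move=> p q; rewrite lee_fin tent_ge0.
Qed.

Lemma measurable_loc_time_level X x : measurable_fun setT (fun p : R * T => X p.1 p.2) ->
  measurable_fun setT (fun w => fine (loc_time X x w)).
Proof.
move=> /measurable_loc_time h; apply: (measurableT_comp (fine_measurable measurableT)).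
exact: (measurableT_comp h (pair1_measurable x)).
Qed.

Lemma loc_time_ge0 X x w : (0 <= loc_time X x w)%E.
Proof. by rewrite /loc_time le_max lexx. Qed.

End continuum_local_time.

Section bridge_laws.
Context d (T : measurableType d) (R : realType) (P : probability T R).
Variables (b : R -> {RV P >-> R}) (lam : R -> R -> {RV P >-> R}).
Hypothesis hb : brownian_bridge b.
Hypothesis hlam : local_times b lam.
Notation mu := (@lebesgue_measure R).
Notation path := (bridge_path b).
Implicit Types (x y l : R).

Lemma loc_timeE : {ae P, forall w x, loc_time path x w = (lam 1 x w)%:E /\ 0 <= lam 1 x w}.
Proof.
apply: filterS (cvg_occ_tent hb hlam) => w h x.
have l0 : 0 <= lam 1 x w.
  rewrite -(cvg_lim _ (h x))//; apply: limr_ge; first by apply: cvgP (h x).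
  near=> k; exact: (occ_ge0 hb (continuous_tent (p := x)) (tent_ge0 k x) (tent_le k x)).
split => //; rewrite /loc_time.
rewrite (_ : (fun k => _) = (fun k => (occ b (tent k x) 1 w)%:E)); last first.
  by apply/funext => k; rewrite (occE hb (continuous_tent (p := x)) (tent_ge0 k x) (tent_le k x)).
have c : (occ b (tent k x) 1 w)%:E @[k --> \oo] --> (lam 1 x w)%:E.
  by apply: cvg_EFin; [exact: nearW|exact: h].
have [_ ->] := cvg_limn_einf_sup c.
by rewrite max_r// lee_fin.
Unshelve. all: by end_near. Qed.

Let mpath : measurable_fun setT (fun p : R * T => path p.1 p.2) := measurable_path_pair hb.

Let mloc := measurable_loc_time mpath.

Let mocc (phi : R -> R) : measurable_fun setT phi -> (forall x, 0 <= phi x) ->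
  measurable_fun setT (fun w => \int[mu]_(s in `[0%R, 1%R]) (phi (path s w))%:E)%E.
Proof.
move=> mphi phi0; apply: (measurable_integral_right mu (f := fun w s => (phi (path s w))%:E)) => //.
  apply/measurable_EFinP; apply: (measurableT_comp mphi).
  apply: (measurableT_comp mpath (g := fun p : T * measurableTypeR R => (p.2 : R, p.1))).
  by apply: measurable_fun_pair; [exact: measurable_snd|exact: measurable_fst].
by move=> w s; rewrite lee_fin.
Qed.

(** The occupation formula for each path, followed by Tonelli in chance and level. The exchange
    needs joint measurability, which [loc_time] has; for each fixed level it is replaced again by
    [lam]. *)
Lemma occupation_joint (phi : R -> R) (B : set R) : measurable_fun setT phi ->
  (forall x, 0 <= phi x) -> measurable B ->
  (\int[P]_w ((\int[mu]_(s in `[0%R, 1%R]) (phi (path s w))%:E) * (\1_B (lam 1 0 w))%:E) =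
   \int[mu]_y ((phi y)%:E * \int[mu]_(l in B) (joint_density y l)%:E))%E.
Proof.
move=> mphi phi0 mB.
have mBl : measurable_fun setT (fun w => \1_B (lam 1 0 w) : R).
  by apply: measurableT_comp => //; exact: measurable_indic.
pose F (w : T) (x : R) : \bar R := ((phi x)%:E * (loc_time path x w * (\1_B (lam 1 0 w))%:E))%E.
have F0 w x : (0 <= F w x)%E by rewrite !mule_ge0 ?loc_time_ge0 ?lee_fin.
have mF : measurable_fun setT (fun p : T * measurableTypeR R => F p.1 p.2).
  apply: emeasurable_funM.
    by apply/measurable_EFinP; exact: (measurableT_comp mphi measurable_snd).
  apply: emeasurable_funM.
    apply: (measurableT_comp mloc (g := fun p : T * measurableTypeR R => (p.2 : R, p.1))).
    by apply: measurable_fun_pair; [exact: measurable_snd|exact: measurable_fst].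
  by apply/measurable_EFinP; exact: (measurableT_comp mBl measurable_fst).
transitivity (\int[P]_w \int[mu]_x F w x)%E.
  apply: ge0_ae_eq_integral => //.
  - by apply: emeasurable_funM; [exact: mocc|exact/measurable_EFinP].
  - exact: (measurable_integral_right mu mF F0 measurableT).
  - by move=> w _; rewrite mule_ge0 ?lee_fin//; apply: integral_ge0 => s _; rewrite lee_fin.
  - by move=> w _; apply: integral_ge0.
  apply: filterS2 (local_time_at1 hlam) loc_timeE => w [_ h1] h2 _.
  rewrite h1// -ge0_integralZr//; first last.
  - by move=> x _; rewrite lee_fin mulr_ge0// (h2 x).2.
  - apply/measurable_EFinP; apply: measurable_funM => //.
    have -> : (fun x => lam 1 x w) = (fun x => fine (loc_time path x w)).
      by apply/funext => x; rewrite (h2 x).1.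
    apply: (measurableT_comp (fine_measurable measurableT)).
    exact: (measurableT_comp mloc (pair2_measurable w)).
  by apply: eq_integral => x _; rewrite /F (h2 x).1 muleA EFinM.
rewrite (tonelli_domains P mu mF F0)//.
apply: eq_integral => y _.
have mly : measurable_fun setT (fun w => loc_time path y w).
  exact: (measurableT_comp mloc (pair1_measurable y)).
rewrite /F ge0_integralZl_EFin//; first last.
- by apply: emeasurable_funM => //; exact/measurable_EFinP.
- by move=> w _; rewrite mule_ge0 ?loc_time_ge0 ?lee_fin.
congr (_ * _)%E; rewrite -(integral_local_times hb hlam y mB) [RHS]integral_mkcond.
apply: ae_eq_integral => //.
- by apply: emeasurable_funM => //; exact/measurable_EFinP.
- apply/(measurable_restrictT _ _).1; first by rewrite -[_ @^-1` _]setTI; exact: measurable_funP.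
  by apply: measurable_funTS; exact/measurable_EFinP.
apply: filterS loc_timeE => w h _; rewrite (h y).1 patchE indicE.
rewrite (_ : (w \in _) = (lam 1 0 w \in B)); last by apply/idP/idP; rewrite !inE.
by case: (lam 1 0 w \in B); rewrite ?mule1 ?mule0.
Qed.

Section uniform_time.
Variable U : {RV P >-> R}.
Hypothesis hU01 : forall w, U w \in `[0, 1].
Hypothesis hU : has_density P U (fun x => (uniform_pdf 0 1 x)%:E).
Hypothesis hUb : independent P (sigma_rv U) (sigma_process `[0, 1] b).

(** The space [T] with only the events of the bridge becomes a measurable type [TG], so the
    independence hypothesis speaks of [U] and of the identity map from [T] to [TG]. *)
Let G : set (set T) := \bigcup_(t in `[0, 1]%classic) sigma_rv (b t).
Let TG : measurableType _ := g_sigma_algebraType G.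

Let mpathG : measurable_fun setT (fun p : R * TG => path p.1 p.2).
Proof.
apply: measurable_clipped_process.
- move=> t _ Y mY; rewrite setTI; apply: sub_sigma_algebra; exists (clip t); first exact: clip_in.
  by exists Y => //; rewrite setTI.
- exact: (continuous_path hb).
- by move=> t w; rewrite /bridge_path clip_clip.
Qed.

Lemma uniform_time_valueE : (fun w => b (U w) w) = (fun w => path (U w) w).
Proof.
apply/funext => w; rewrite /bridge_path clip_id//; first by have := hU01 w; rewrite in_itv/= => /andP[].
by have := hU01 w; rewrite in_itv/= => /andP[].
Qed.

Lemma measurable_uniform_time_value : measurable_fun setT (fun w => b (U w) w).
Proof.
rewrite uniform_time_valueE.
apply: (measurableT_comp mpath (g := fun w => (U w, w))).
exact: measurable_fun_pair.
Qed.

(** Independence freezes the path and averages over [U]; the average of the indicator of [A] along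
    the path is its occupation time of [A] up to time 1, and [occupation_joint] concludes. *)
Lemma uniform_time_joint (A B : set R) : measurable A -> measurable B ->
  (P ((fun w => b (U w) w) @^-1` A `&` lam 1 0 @^-1` B) =
   \int[mu]_(y in A) \int[mu]_(l in B) (joint_density y l)%:E)%E.
Proof.
move=> mA mB.
(* Almost surely equal to [lam 1 0], and by construction a function of the path, hence measurable on
   [TG], as the use of independence requires. *)
pose L0 w : R := fine (loc_time path 0 w).
have mi (C : set R) : measurable C -> measurable_fun setT (\1_C : R -> R) by move=> mC; exact: measurable_indic.
have mV := measurable_uniform_time_value.
have mL0 : measurable_fun setT L0.
  exact: (measurable_loc_time_level 0 mpath).
have mL0G : measurable_fun setT (L0 : TG -> R).
  exact: (measurable_loc_time_level 0 mpathG).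
have LE : {ae P, forall w, L0 w = lam 1 0 w}.
  by apply: filterS loc_timeE => w h; rewrite /L0 (h 0).1.
pose f (w : TG) (u : R) : \bar R := (\1_A (path u w) * \1_B (L0 w))%:E.
have mf : measurable_fun setT (fun p : TG * R => f p.1 p.2).
  apply/measurable_EFinP; apply: measurable_funM.
    apply: (measurableT_comp (mi _ mA)).
    apply: (measurableT_comp mpathG (g := fun p : TG * R => (p.2, p.1))).
    by apply: measurable_fun_pair; [exact: measurable_snd|exact: measurable_fst].
  by apply: (measurableT_comp (mi _ mB)); exact: (measurableT_comp mL0G measurable_fst).
have f0 w u : (0 <= f w u)%E by rewrite lee_fin mulr_ge0.
have mid : measurable_fun setT (id : T -> TG).
  move=> _ Y mY; rewrite setTI; apply: (mY (measurable : set (set T))).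
  split; first exact: sigma_algebra_measurable.
  move=> C [t tI [D mD <-]]; exact: measurable_funP.
transitivity (\int[P]_w (f w (U w)))%E.
  have mAB : measurable ((fun w => b (U w) w) @^-1` A `&` lam 1 0 @^-1` B).
    apply: measurableI; first by rewrite -[_ @^-1` _]setTI; exact: mV.
    by rewrite -[_ @^-1` _]setTI; exact: measurable_funP.
  rewrite -[P _]mul1e -[X in P X]setIT -integral_indic// mul1e.
  apply: ge0_ae_eq_integral => //.
  - by apply/measurable_EFinP; exact: measurable_indic.
  - by apply: (measurableT_comp mf (g := fun w : T => (w : TG, U w))); exact: measurable_fun_pair.
  apply: filterS LE => w Lw _; rewrite /f Lw !indicE -natrM mulnb.
  have := congr1 (fun h => h w) uniform_time_valueE => /= <-.
  congr (_%:R%:E); congr nat_of_bool.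
  by apply/idP/andP; rewrite !inE.
have rect (C : set TG) (D : set R) : measurable C -> measurable D ->
    P ((id : T -> TG) @^-1` C `&` U @^-1` D) = (P ((id : T -> TG) @^-1` C) * distribution P U D)%E.
  move=> mC mD; rewrite setIC muleC; apply: hUb => //.
  by exists D => //; rewrite setTI.
rewrite (ge0_integral_indep mid _ rect mf f0)//.
have -> : (\int[P]_w \int[distribution P U]_u f w u =
    \int[P]_w ((\int[mu]_(s in `[0%R, 1%R]) (\1_A (path s w))%:E) * (\1_B (lam 1 0 w))%:E))%E.
  apply: ge0_ae_eq_integral => //.
  - exact: (measurableT_comp (measurable_integral_right (distribution P U) mf f0 measurableT) mid).
  - apply: emeasurable_funM; first by apply: mocc => //; exact: mi.
    by apply/measurable_EFinP; apply: (measurableT_comp (mi _ mB)).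
  - by move=> w _; apply: integral_ge0.
  - by move=> w _; rewrite mule_ge0 ?lee_fin//; apply: integral_ge0 => s _; rewrite lee_fin.
  apply: filterS LE => w Lw _.
  have mfw : measurable_fun setT (fun u => f w u) by exact: (measurableT_comp mf (pair1_measurable (w : TG))).
  case: hU => mU mpdf pdf0 hUA.
  rewrite (_ : (\int[distribution P U]_u f w u = \int[P]_w' f w (U w'))%E); last first.
    by rewrite ge0_integral_distribution.
  rewrite (ge0_integral_density _ _ _ hUA)//.
  - rewrite [X in (X * _)%E]integral_mkcond -ge0_integralZr//.
    + apply: eq_integral => u _; rewrite patchE /uniform_pdf /f Lw.
      rewrite subr0 invr1.
      case: ifPn => u1; case: ifPn => u2.
      * by rewrite mule1 EFinM.
      * by move: u2; rewrite notin_setE/= in_itv/= u1.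
      * by move: u2 u1; rewrite inE/= in_itv/= => ->.
      * by rewrite mule0 mul0e.
    + apply/(measurable_restrictT _ _).1 => //; apply: measurable_funTS; apply/measurable_EFinP.
      apply: (measurableT_comp (mi _ mA)); exact: (measurableT_comp mpath (pair2_measurable w)).
    + by move=> u _; apply: erestrict_ge0 => v _; rewrite lee_fin.
  - exact/measurable_EFinP.
rewrite (occupation_joint (mi _ mA) _ mB)// [RHS]integral_mkcond.
apply: eq_integral => y _; rewrite patchE indicE.
by case: (y \in A); rewrite ?mul1e ?mul0e.
Qed.

End uniform_time.
End bridge_laws.

(** * The laws in the corollary *)
Section joint_density_integrals.
Context {R : realType}.
Notation mu := (@lebesgue_measure R).
Notation kappa := (@kappa R).
Implicit Types (x y z l : R).

Lemma kappa_heat1 x : kappa * heat 1 x = expR (- x ^+ 2 / 2).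
Proof.
have k0 : kappa != 0 by rewrite gt_eqF// kappa_gt0.
by rewrite /heat !mulr1 mulrA mulfV// mul1r.
Qed.

Lemma rayleigh_pdfE l : rayleigh_pdf l = Num.max 0 l * expR (- l ^+ 2 / 2).
Proof.
rewrite /rayleigh_pdf patchE; case: ifPn => [|/negP]; rewrite inE/= in_itv/= andbT.
  by move=> l0; rewrite max_r.
by move=> /negP; rewrite -ltNge => /ltW l0; rewrite max_l// mul0r.
Qed.

Lemma rayleigh_pdf_ge0 l : 0 <= rayleigh_pdf l.
Proof. by rewrite rayleigh_pdfE mulr_ge0 ?expR_ge0// le_max lexx. Qed.

Lemma measurable_rayleigh_pdf : measurable_fun setT (@rayleigh_pdf R).
Proof.
rewrite (_ : @rayleigh_pdf R = (fun l => Num.max 0 l * expR (- l ^+ 2 / 2))); last first.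
  by apply/funext => l; exact: rayleigh_pdfE.
apply: measurable_funM; first exact: measurable_maxr.
apply: measurableT_comp => //; apply: measurable_funM => //.
by apply: measurableT_comp => //; exact: exprn_measurable.
Qed.

Lemma integral_heat1_tail z : 0 <= z ->
  (\int[mu]_(l in `[0%R, +oo[) ((z + l) * expR (- (z + l) ^+ 2 / 2))%:E = (expR (- z ^+ 2 / 2))%:E)%E.
Proof.
move=> z0; rewrite -kappa_heat1 EFinM -(integral_heat_tail ltr01 z0) -ge0_integralZl_EFin//; first last.
- by rewrite ltW// kappa_gt0.
- apply: measurable_funTS; apply/measurable_EFinP; apply: measurable_funM.
    by apply: measurable_funM => //; exact: measurable_funD.
  by apply: measurable_heat2 => //; exact: measurable_funD.
- move=> l /=; rewrite in_itv/= andbT => l0.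
  by rewrite lee_fin mulr_ge0 ?heat_ge0// divr_ge0// addr_ge0.
by apply: eq_integral => l _; rewrite -EFinM -kappa_heat1 divr1 mulrCA.
Qed.

(** The factor 2 from the symmetry in [y] cancels the Jacobian of the substitution [u = 2 y], and
    the tail [expR (- l ^ 2 / 2)] remains. *)
Lemma integral_joint_density_level l :
  (\int[mu]_y (joint_density y l)%:E = (rayleigh_pdf l)%:E)%E.
Proof.
have [l0|/ltW l0] := leP l 0.
  under eq_integral do rewrite joint_density_neg//.
  by rewrite integral0 rayleigh_pdfE max_l// mul0r.
pose h (u : R) : R := ((fun u => (l + u) * expR (- (l + u) ^+ 2 / 2)) \_ `[0, +oo[) u.
have h0 u : 0 <= h u.
  apply: restrict_ge0 => v /=; rewrite in_itv/= andbT => v0.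
  by rewrite mulr_ge0 ?expR_ge0// addr_ge0.
have mh : measurable_fun setT (fun u => (h u)%:E).
  apply/measurable_EFinP; apply/(measurable_restrictT _ _).1 => //; apply: measurable_funTS.
  apply: measurable_funM; first exact: measurable_funD.
  apply: measurableT_comp => //; apply: measurable_funM => //.
  by apply: measurableT_comp => //; apply: measurable_funX; exact: measurable_funD.
have Ih : (\int[mu]_u (h u)%:E = (expR (- l ^+ 2 / 2))%:E)%E.
  rewrite -(integral_heat1_tail l0) [RHS]integral_mkcond; apply: eq_integral => u _.
  by rewrite /h !patchE; case: ifP.
pose k y : R := (2 * `|y| + l) * expR (- (2 * `|y| + l) ^+ 2 / 2).
have ck : continuous k.
  have c1 : continuous (fun y : R => 2 * `|y| + l).
    by move=> y; apply: cvgD; [apply: cvgMr; exact: norm_continuous|exact: cvg_cst].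
  move=> y; apply: cvgM; first exact: c1.
  have c2 : (- (2 * `|x| + l) ^+ 2 / 2) @[x --> y] --> - (2 * `|y| + l) ^+ 2 / 2.
    by apply: cvgMl; apply: cvgN; exact: (cvg_comp _ _ (c1 y) (@exprn_continuous _ 2 _)).
  exact: (cvg_comp _ _ c2 (@continuous_expR R _)).
have k0 y : 0 <= k y by rewrite mulr_ge0 ?expR_ge0// addr_ge0// mulr_ge0.
have mk : measurable_fun setT (fun y => (k y)%:E) by apply/measurable_EFinP; exact: continuous_measurable_fun.
transitivity (l%:E * \int[mu]_y (k y)%:E)%E.
  rewrite -ge0_integralZl_EFin//; last by move=> y _; rewrite lee_fin.
  by apply: eq_integral => y _; rewrite -EFinM /joint_density max_r// mulrA.
rewrite ge0_symfun_integralT//; last by move=> y; rewrite /k /= normrN.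
have -> : (\int[mu]_(y in [set y | (0 <= y)%R]) (k y)%:E = \int[mu]_y (h (affine 2 0 y))%:E)%E.
  rewrite integral_mkcond; apply: eq_integral => y _; rewrite /h !patchE /affine addr0.
  have -> : (2 * y \in `[0, +oo[%classic) = (y \in [set y : R | 0 <= y]).
    by apply/idP/idP; rewrite !inE/= in_itv/= andbT pmulr_rge0.
  by case: ifPn => //; rewrite inE/= => y0; rewrite /k ger0_norm// addrC.
rewrite (ge0_integral_affine 0 _ mh)// Ih rayleigh_pdfE max_r// -!EFinM; congr EFin.
by field.
Qed.

Lemma integral_rayleigh_tail z : 0 <= z ->
  (\int[mu]_(l in `[z, +oo[) (rayleigh_pdf l)%:E = (expR (- z ^+ 2 / 2))%:E)%E.
Proof.
move=> z0; rewrite ge0_integral_itvcy_shift//; first last.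
- by move=> l; rewrite lee_fin rayleigh_pdf_ge0.
- by apply/measurable_EFinP; exact: measurable_rayleigh_pdf.
rewrite -(integral_heat1_tail z0); apply: eq_integral => l; rewrite inE/= in_itv/= andbT => l0.
by rewrite rayleigh_pdfE max_r ?addr_ge0// addrC.
Qed.

Lemma measure_eq_tails (m1 m2 : {finite_measure set R -> \bar R}) :
  (forall a, m1 `[a, +oo[%classic = m2 `[a, +oo[%classic) ->
  forall A : set R, measurable A -> m1 A = m2 A.
Proof.
move=> H A mA.
have mG : (measurable : set (set R)) = <<s @RGenCInfty.G R >> by exact: RGenCInfty.measurableE.
have GI : setI_closed (@RGenCInfty.G R).
  move=> _ _ [x ->] [y ->]; exists (Num.max x y).
  by apply/seteqP; split => z /=; rewrite !in_itv/= !andbT ge_max => /andP.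
have GG n : @RGenCInfty.G R `[- n%:R, +oo[%classic by exists (- n%:R).
have cover : \bigcup_n `[- n%:R, +oo[%classic = [set: R].
  rewrite -subTset => x _; exists (Num.bound `|x|) => //=.
  rewrite in_itv/= andbT lerNl (le_trans (ler_norm _))// normrN ltW// archi_boundP//.
have fin n : (m1 `[(- n%:R)%R, +oo[%classic < +oo)%E by rewrite ltey_eq fin_num_measure.
have eqG (B : set R) : @RGenCInfty.G R B -> m1 B = m2 B by move=> [x ->]; exact: H.
have := @measure_unique _ R _ _ _ mG GI GG cover m1 m2 eqG fin A mA.
by [].
Qed.

End joint_density_integrals.

Section exponential_transforms.
Context d (T : measurableType d) (R : realType) (P : probability T R).
Notation mu := (@lebesgue_measure R).
Implicit Types (x y z l a : R).

Lemma measurable_sqrt_exponential (E : {RV P >-> R}) :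
  measurable_fun setT (fun w => Num.sqrt (2 * E w)).
Proof. by apply: (measurableT_comp measurable_sqrtr); exact: measurable_funM. Qed.

Lemma exponential_sqrt_tail (E : {RV P >-> R}) z : 0 < z ->
  has_density P E (fun x => (exponential_pdf 1 x)%:E) ->
  P ((fun w => Num.sqrt (2 * E w)) @^-1` `[z, +oo[%classic) = (expR (- z ^+ 2 / 2))%:E.
Proof.
move=> z0 [mE _ _ hE]; have c0 : 0 <= z ^+ 2 / 2 by rewrite divr_ge0// sqr_ge0.
have -> : (fun w => Num.sqrt (2 * E w)) @^-1` `[z, +oo[%classic = E @^-1` `[z ^+ 2 / 2, +oo[%classic.
  apply/seteqP; split => w /=; rewrite !in_itv/= !andbT ler_pdivrMr// [E w * 2]mulrC.
    (* [Num.sqrt] is [0] on negative numbers, so a root above the positive [z] forces a positive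
       argument. *)
    move=> h; have E0 : 0 < 2 * E w by rewrite -sqrtr_gt0 (lt_le_trans z0).
    by rewrite -(sqr_sqrtr (ltW E0)) ler_sqr ?nnegrE ?sqrtr_ge0// ltW.
  move=> h; apply: (@le_trans _ _ (Num.sqrt (z ^+ 2))); last exact: ler_wsqrtr.
  by rewrite sqrtr_sqr ler_norm.
rewrite hE// ge0_integral_itvcy_shift//; first last.
- by move=> x; rewrite lee_fin exponential_pdf_ge0.
- by apply/measurable_EFinP; exact: measurable_exponential_pdf.
have := integral_expRN (z ^+ 2 / 2); rewrite -mulNr => <-.
apply: eq_integral => x; rewrite inE/= in_itv/= andbT => x0.
rewrite /exponential_pdf patchE mem_set ?mul1r ?mulN1r ?[x + _]addrC//=.
by rewrite in_itv/= andbT addr_ge0.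
Qed.

Variables (d' : measure_display) (T' : measurableType d') (P' : probability T' R).

Lemma same_law_sqrt_exponential (L : {RV P' >-> R}) (E : {RV P >-> R}) :
  has_density P' L (fun l => (rayleigh_pdf l)%:E) ->
  has_density P E (fun x => (exponential_pdf 1 x)%:E) ->
  same_law P' L P (fun w => Num.sqrt (2 * E w)).
Proof.
move=> [mL _ _ hL] hE; have mS := measurable_sqrt_exponential E.
split => // A mA.
apply: (@measure_eq_tails R (distribution P' L) (distribution P (pack_mfun mS)) _ A mA) => a.
change (P' (L @^-1` `[a, +oo[%classic) = P ((fun w => Num.sqrt (2 * E w)) @^-1` `[a, +oo[%classic)).
(* For [a <= 0] the tail of the square root is certain, roots being non-negative, and the tail of
   [L] contains that at [0], whose probability is 1. *)
have [a0|a0] := leP a 0; last by rewrite exponential_sqrt_tail// hL// integral_rayleigh_tail// ltW.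
rewrite [X in _ = P X](_ : _ = setT) ?probability_setT//; last first.
  apply/seteqP; split => // w _ /=; rewrite in_itv/= andbT (le_trans a0)//.
apply/eqP; rewrite eq_le probability_le1/=; last by rewrite -[_ @^-1` _]setTI; exact: measurable_funP.
rewrite -expR0 (_ : expR 0 = expR (- (0 : R) ^+ 2 / 2)); last by rewrite expr0n/= oppr0 mul0r.
rewrite -(integral_rayleigh_tail (lexx 0)) -hL//; apply: le_measure; rewrite ?inE.
- by rewrite -[_ @^-1` _]setTI; exact: measurable_funP.
- by rewrite -[_ @^-1` _]setTI; exact: measurable_funP.
by move=> w /=; rewrite !in_itv/= !andbT; exact: le_trans.
Qed.

End exponential_transforms.

Section rayleigh_uniform_product.
Context d (T : measurableType d) (R : realType) (P : probability T R).
Variables (S : T -> R) (V : {RV P >-> R}).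
Hypothesis mS : measurable_fun setT S.
Hypothesis hS : forall A : set R, measurable A ->
  P (S @^-1` A) = (\int[@lebesgue_measure R]_(s in A) (rayleigh_pdf s)%:E)%E.
Hypothesis hV : has_density P V (fun x => (uniform_pdf (-1) 1 x)%:E).
Hypothesis SV : forall A B : set R, measurable A -> measurable B ->
  P (S @^-1` A `&` V @^-1` B) = (P (S @^-1` A) * P (V @^-1` B))%E.
Notation mu := (@lebesgue_measure R).
Implicit Types (y s : R).

(** The joint density of [S V / 2] at [y] and [S] at [s]: given [S = s], the former is uniform on
    [[- s / 2, s / 2]], and its density [1 / s] cancels the factor [s] of the Rayleigh density. The
    test [0 < s] matters at [y = 0], where it excludes [s = 0]. *)
Let K y s : R := if (0 < s) && (2 * `|y| <= s) then expR (- s ^+ 2 / 2) else 0.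

Let K0 y s : 0 <= K y s.
Proof. by rewrite /K; case: ifP => // _; exact: expR_ge0. Qed.

Let mK : measurable_fun setT (fun p : R * R => K p.1 p.2).
Proof.
apply: measurable_fun_ifT => //.
- apply: measurable_and; first exact: measurable_fun_ltr.
  apply: measurable_fun_ler => //; apply: measurable_funM => //.
  exact: measurableT_comp.
- apply: measurableT_comp => //; apply: measurable_funM => //.
  by apply: measurableT_comp => //; exact: measurable_funX.
Qed.

Let integral_K y :
  (\int[mu]_s (K y s)%:E = \int[mu]_(s in `[(2 * `|y|)%R, +oo[) (expR (- s ^+ 2 / 2))%:E)%E.
Proof.
have mE : measurable_fun setT (fun s : R => (expR (- s ^+ 2 / 2))%:E).
  apply/measurable_EFinP; apply: measurableT_comp => //; apply: measurable_funM => //.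
  by apply: measurableT_comp => //; exact: exprn_measurable.
have [->|y0] := eqVneq y 0.
  rewrite normr0 mulr0 -integral_itv_obnd_cbnd; last exact: measurable_funTS.
  rewrite [RHS]integral_mkcond; apply: eq_integral => s _; rewrite patchE /K normr0 mulr0.
  rewrite (_ : (s \in _) = (0 < s)); last by rewrite mem_setE/= in_itv/= andbT.
  by case: (ltP 0 s) => [/ltW ->|].
rewrite [RHS]integral_mkcond; apply: eq_integral => s _; rewrite patchE /K.
rewrite (_ : (s \in _) = (2 * `|y| <= s)); last by rewrite mem_setE/= in_itv/= andbT.
case: (boolP (2 * `|y| <= s)) => h; last by rewrite andbF.
by rewrite (lt_le_trans _ h)// mulr_gt0// normr_gt0.
Qed.

Let uniform_scaled (A : set R) s : measurable A ->
  (\int[mu]_v (\1_A (s * (v / 2)) * uniform_pdf (-1) 1 v)%:E * (rayleigh_pdf s)%:E =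
   \int[mu]_y (\1_A y * K y s)%:E)%E.
Proof.
move=> mA.
have mAK : measurable_fun setT (fun y => (\1_A y * K y s)%:E).
  by apply/measurable_EFinP; apply: measurable_funM; [exact: measurable_indic|exact: (measurableT_comp mK (pair2_measurable s))].
have [s0|s0] := leP s 0.
  rewrite rayleigh_pdfE max_l// mul0r mule0; apply/esym/integral0_eq => y _.
  by rewrite /K ltNge s0/= mulr0.
have h := ge0_integral_affine 0 (divr_gt0 s0 (ltr0Sn R 1)) mAK.
have -> : (\int[mu]_y (\1_A y * K y s)%:E = (s / 2)%:E * \int[mu]_v (\1_A (s / 2 * v) * K (s / 2 * v) s)%:E)%E.
  rewrite -[RHS]/(((s / 2)%:E * \int[mu]_v ((fun y => (\1_A y * K y s)%:E) (s / 2 * v)%R))%E).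
  under [X in (_ * X)%E]eq_integral do rewrite -[(s / 2 * _)%R]addr0.
  rewrite h; last by move=> y; rewrite lee_fin mulr_ge0.
  by rewrite muleA -EFinM mulfV ?mul1e// gt_eqF// divr_gt0.
rewrite muleC -!ge0_integralZl_EFin//; first last.
- by rewrite rayleigh_pdf_ge0.
- apply/measurable_EFinP; apply: measurable_funM; last exact: measurable_uniform_pdf.
  apply: measurableT_comp; first exact: measurable_indic.
  by apply: measurable_funM => //; exact: measurable_funM.
- by move=> v _; rewrite lee_fin mulr_ge0// uniform_pdf_ge0// ltrN1.
- by rewrite divr_ge0// ltW.
- apply: (measurableT_comp mAK (g := fun v : R => s / 2 * v)); exact: measurable_funM.
- by move=> v _; rewrite lee_fin mulr_ge0.
apply: eq_integral => v _; rewrite -!EFinM; congr EFin.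
have -> : s * (v / 2) = s / 2 * v by rewrite mulrCA mulrC.
rewrite rayleigh_pdfE max_r ?(ltW s0)// /K s0/= /uniform_pdf normrM (ger0_norm (ltW (divr_gt0 s0 _)))//.
have -> : (2 * (s / 2 * `|v|) <= s) = (-1 <= v <= 1).
  have -> : 2 * (s / 2 * `|v|) = s * `|v| by field.
  by rewrite -[X in _ <= X]mulr1 ler_pM2l// ler_norml.
by case: ifP => _; [field|rewrite !mulr0].
Qed.

(** Integrating [K y s] over [s] first leaves the Gaussian tail beyond [2|y|], the form in which the
    density of the bridge at a uniform time is known. *)
Lemma rayleigh_uniform_product_law (A : set R) : measurable A ->
  P ((fun w => S w * (V w / 2)) @^-1` A) =
  (\int[mu]_(y in A) \int[mu]_(z in `[(2 * `|y|)%R, +oo[) (expR (- z ^+ 2 / 2))%:E)%E.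
Proof.
move=> mA; case: hV => mV mpdf _ hVA.
have mSV : measurable_fun setT (fun w => S w * (V w / 2)).
  by apply: measurable_funM => //; exact: measurable_funM.
pose f (s v : R) : \bar R := (\1_A (s * (v / 2)))%:E.
have mf : measurable_fun setT (fun p : R * R => f p.1 p.2).
  apply/measurable_EFinP; apply: measurableT_comp; first exact: measurable_indic.
  by apply: measurable_funM => //; exact: measurable_funM.
have f0 s v : (0 <= f s v)%E by rewrite lee_fin.
transitivity (\int[P]_w f (S w) (V w))%E.
  have mAS : measurable ((fun w => S w * (V w / 2)) @^-1` A) by rewrite -[_ @^-1` _]setTI; exact: mSV.
  rewrite -[P _]mul1e -[X in P X]setIT -integral_indic// mul1e.
  by apply: eq_integral => w _; rewrite /f !indicE; congr (_%:R%:E); congr nat_of_bool; apply/idP/idP; rewrite !inE.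
rewrite (ge0_integral_indep (n := distribution P V) mS _ _ mf f0)//.
have mI : measurable_fun setT (fun s => \int[distribution P V]_v f s v)%E.
  exact: (measurable_integral_right (distribution P V) mf f0 measurableT).
rewrite (ge0_integral_density mS measurable_rayleigh_pdf rayleigh_pdf_ge0 hS mI); last first.
  by move=> s; apply: integral_ge0.
transitivity (\int[mu]_s \int[mu]_y (\1_A y * K y s)%:E)%E.
  apply: eq_integral => s _; rewrite -uniform_scaled//; congr (_ * _)%E.
  have mfs : measurable_fun setT (fun v => f s v) by exact: (measurableT_comp mf (pair1_measurable s)).
  rewrite ge0_integral_distribution//.
  rewrite (ge0_integral_density _ _ _ hVA)//.
  - exact/measurable_EFinP.
  - by move=> v; rewrite uniform_pdf_ge0// ltrN1.
have mAK : measurable_fun setT (fun p : measurableTypeR R * measurableTypeR R => (\1_A p.2 * K p.2 p.1)%:E).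
  apply/measurable_EFinP; apply: measurable_funM.
    by apply: (measurableT_comp _ measurable_snd); exact: measurable_indic.
  apply: (measurableT_comp mK (g := fun p : R * R => (p.2, p.1))).
  by apply: measurable_fun_pair; [exact: measurable_snd|exact: measurable_fst].
have AK0 (s y : measurableTypeR R) : (0 <= (\1_A y * K y s)%:E)%E by rewrite lee_fin mulr_ge0.
apply: (eq_trans (tonelli_domains mu mu (f := fun s y => (\1_A y * K y s)%:E) mAK AK0 measurableT measurableT)).
rewrite [RHS]integral_mkcond; apply: eq_integral => y _; rewrite patchE -integral_K indicE.
case: (y \in A); first by apply: eq_integral => s _; rewrite mul1r.
by apply: integral0_eq => s _; rewrite mul0r.
Qed.

End rayleigh_uniform_product.

(** * Conditional laws, expectations and densities of the bridge *)

Section bridge_results.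
Context d (T : measurableType d) (R : realType) (P : probability T R).
Variables (b : R -> {RV P >-> R}) (lam : R -> R -> {RV P >-> R}).
Hypothesis hb : brownian_bridge b.
Hypothesis hlam : local_times b lam.
Notation mu := (@lebesgue_measure R).
Notation kappa := (@kappa R).
Notation L := (lam 1 0).
Implicit Types (x y l : R).

Let mq : measurable_fun setT (fun p : R * R => (joint_density p.1 p.2)%:E).
Proof. by apply/measurable_EFinP; exact: measurable_joint_density. Qed.

Let q0 y l : (0 <= (joint_density y l)%:E)%E.
Proof. by rewrite lee_fin joint_density_ge0. Qed.

(** Case [phi = 1] of [occupation_joint]: the occupation time of the whole line up to time 1 is 1,
    so the weights disappear and the joint density is integrated over all levels. *)
Lemma local_time_rayleigh : has_density P L (fun l => (rayleigh_pdf l)%:E).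
Proof.
split => //.
- by apply/measurable_EFinP; exact: measurable_rayleigh_pdf.
- by move=> l; rewrite lee_fin rayleigh_pdf_ge0.
move=> B mB; have := occupation_joint hb hlam (measurable_cst (1 : R)) (fun _ => ler01) mB.
rewrite (_ : (\int[P]_w _)%E = P (L @^-1` B)); last first.
  have mLB : measurable (L @^-1` B) by rewrite -[_ @^-1` _]setTI; exact: measurable_funP.
  rewrite -[RHS]mul1e -[X in P X]setIT -integral_indic// mul1e.
  apply: eq_integral => w _.
  rewrite [X in (X * _)%E](_ : _ = 1%E) ?mul1e; last first.
    rewrite -[LHS]/(\int[mu]_(s in `[0%R, 1%R]) cst 1%E s)%E integral_cst//=.
    by rewrite lebesgue_measure_itv/= lte_fin ltr01 sube0 mul1e.
  by rewrite !indicE; congr (_%:R%:E); congr nat_of_bool; apply/idP/idP; rewrite !inE.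
move=> ->; under eq_integral do rewrite mul1e.
apply: (eq_trans (tonelli_domains mu mu (f := fun y l => (joint_density y l)%:E) mq q0 measurableT mB)).
by apply: eq_integral => l _; exact: integral_joint_density_level.
Qed.

Lemma integral_local_times_comp y (h : R -> R) : measurable_fun setT h -> (forall l, 0 <= h l) ->
  (\int[P]_w (h (L w) * lam 1 y w)%:E = \int[mu]_l (h l * joint_density y l)%:E)%E.
Proof.
move=> mh h0; pose W w := Num.max 0 (lam 1 y w).
have mW : measurable_fun setT W by exact: measurable_maxr.
have W0 w : 0 <= W w by rewrite le_max lexx.
have mqy : measurable_fun setT (joint_density y) by exact: measurable_joint_density.
have hE : measurable_fun setT (EFin \o h) by exact/measurable_EFinP.
have WA (A : set R) : measurable A ->
    weighted_measure P mW W0 (L @^-1` A) = weighted_measure mu mqy (joint_density_ge0 y) A.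
  move=> mA; rewrite /weighted_measure -(integral_local_times hb hlam y mA).
  have mLA : measurable (L @^-1` A) by rewrite -[_ @^-1` _]setTI; exact: measurable_funP.
  apply: ae_eq_integral => //; try by apply: measurable_funTS; exact/measurable_EFinP.
  by apply: filterS (loc_timeE hb hlam) => w hw _; rewrite /W max_r// (hw y).2.
have := @ge0_integral_law _ T R _ (measurableTypeR R) (weighted_measure P mW W0)
  (weighted_measure mu mqy (joint_density_ge0 y)) L (EFin \o h) (measurable_funP L) WA hE.
rewrite !ge0_integral_weighted_measure//; last first.
- by move=> w; rewrite lee_fin.
- by apply: (measurableT_comp hE).
move=> H; rewrite -[RHS]H; last by move=> x; rewrite lee_fin.
apply: ae_eq_integral => //.
- by apply/measurable_EFinP; apply: measurable_funM => //; exact: measurableT_comp.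
- by apply/measurable_EFinP; apply: measurable_funM => //; exact: measurableT_comp.
by apply: filterS (loc_timeE hb hlam) => w hw _; rewrite /W max_r ?(hw y).2.
Qed.

Let g l y : R := (2 * `|y| + l) * expR (- (2 * y ^+ 2 + 2 * `|y| * l)).
(** For [l < 0] the formula [g] may take negative values. Since [L] is almost surely non-negative,
    [gp] is another version of it, non-negative everywhere. *)
Let gp l y : R := g (Num.max 0 l) y.

Let gp0 l y : 0 <= gp l y.
Proof. by rewrite /gp /g mulr_ge0 ?expR_ge0// addr_ge0 ?mulr_ge0// le_max lexx. Qed.

Let measurable_cond_density : measurable_fun setT (fun p : R * R => g p.1 p.2).
Proof.
have m1 : measurable_fun setT (fun p : R * R => 2 * `|p.2|).
  by apply: measurable_funM => //; exact: measurableT_comp.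
apply: measurable_funM; first exact: measurable_funD.
apply: measurableT_comp => //; apply: measurableT_comp => //; apply: measurable_funD.
  by apply: measurable_funM => //; exact: measurable_funX.
exact: measurable_funM.
Qed.

Let mgp : measurable_fun setT (fun p : R * R => gp p.1 p.2).
Proof.
apply: (measurableT_comp measurable_cond_density (g := fun p : R * R => (Num.max 0 p.1, p.2))).
by apply: measurable_fun_pair => //; exact: measurable_maxr.
Qed.

(** Conditional density times marginal density, by expanding [(2|y| + l) ^ 2 = 4 y ^ 2 + 4 |y| l + l
    ^ 2]. *)
Let gp_rayleigh l y : gp l y * rayleigh_pdf l = joint_density y l.
Proof.
have [l0|/ltW l0] := leP l 0; first by rewrite joint_density_neg// rayleigh_pdfE max_l// mul0r mulr0.
rewrite /gp /g rayleigh_pdfE /joint_density max_r//.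
have -> : - (2 * `|y| + l) ^+ 2 / 2 = - (2 * y ^+ 2 + 2 * `|y| * l) + - l ^+ 2 / 2.
  by rewrite -(real_normK (num_real y)); field.
by rewrite expRD; ring.
Qed.

Let ae_pos : {ae distribution P L, forall l, 0 <= l}.
Proof.
exists `]-oo, 0[%classic; split => //.
  have [_ _ _ h] := local_time_rayleigh.
  rewrite (_ : distribution P L _ = P (L @^-1` `]-oo, 0[%classic))// h//.
  apply: integral0_eq => l /=; rewrite in_itv/= => /ltW l0.
  by rewrite rayleigh_pdfE max_l// mul0r.
by move=> l /= /negP; rewrite -ltNge in_itv.
Qed.

Let ae_g : {ae distribution P L, forall l, forall y, g l y = gp l y}.
Proof. by apply: filterS ae_pos => l l0 y; rewrite /gp max_r. Qed.

Let integral_dist (h : R -> \bar R) : measurable_fun setT h -> (forall l, (0 <= h l)%E) ->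
  (\int[distribution P L]_l h l = \int[mu]_l (h l * (rayleigh_pdf l)%:E))%E.
Proof.
move=> mh h0; have [mL _ _ hL] := local_time_rayleigh.
rewrite ge0_integral_distribution//.
exact: (ge0_integral_density mL measurable_rayleigh_pdf (@rayleigh_pdf_ge0 R) hL mh h0).
Qed.

Let integral_dist_in (h : R -> \bar R) (B : set R) : measurable B ->
  measurable_fun setT h -> (forall l, (0 <= h l)%E) ->
  (\int[distribution P L]_(l in B) h l = \int[mu]_(l in B) (h l * (rayleigh_pdf l)%:E))%E.
Proof.
move=> mB mh h0; rewrite integral_mkcond integral_dist.
- rewrite [RHS]integral_mkcond; apply: eq_integral => l _; rewrite !patchE.
  by case: ifP; rewrite ?mul0e.
- by apply/(measurable_restrictT _ _).1 => //; exact: measurable_funTS.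
- by move=> l; apply: erestrict_ge0.
Qed.

(** [g] has no constant sign, whereas measurability of parametric integrals is known for
    non-negative integrands; positive and negative parts are treated separately. *)
Let measurable_integral_real (F : R -> R -> R) (A : set R) : measurable A ->
  measurable_fun setT (fun p : R * R => F p.1 p.2) ->
  measurable_fun setT (fun l => \int[mu]_(y in A) (F l y)%:E)%E.
Proof.
move=> mA mF; under eq_fun do rewrite integralE.
have mFE : measurable_fun setT (fun p : R * measurableTypeR R => (F p.1 p.2)%:E).
  exact/measurable_EFinP.
apply: emeasurable_funB.
  apply: (measurable_integral_right mu (f := fun l y => ((fun y => (F l y)%:E)^\+ y)%E)) => //.
  rewrite [X in measurable_fun _ X](_ : _ = (fun p : R * measurableTypeR R => maxe (F p.1 p.2)%:E 0%:E)).
    exact: measurable_maxe.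
  by apply/funext => p; rewrite unlock.
apply: (measurable_integral_right mu (f := fun l y => ((fun y => (F l y)%:E)^\- y)%E)) => //.
rewrite [X in measurable_fun _ X](_ : _ = (fun p : R * measurableTypeR R => maxe (- (F p.1 p.2)%:E)%E 0%:E)).
  by apply: measurable_maxe => //; exact: measurableT_comp.
by apply/funext => p; rewrite unlock.
Qed.

Let integral_q_fin y : (\int[mu]_l (joint_density y l)%:E < +oo)%E.
Proof.
have := exp_moment_joint_density y 0; apply: le_lt_trans.
by under [leRHS]eq_integral do rewrite mul0r expR0 mul1r.
Qed.

Lemma local_time_cond_expectation y : is_cond_expectation (lam 1 y) L (fun l => g l y).
Proof.
have mgy : measurable_fun setT (fun l => g l y) by exact: (measurableT_comp measurable_cond_density (pair2_measurable y)).
have mgpy : measurable_fun setT (fun l => (gp l y)%:E).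
  by apply/measurable_EFinP; exact: (measurableT_comp mgp (pair2_measurable y)).
have aeg : {ae distribution P L, forall l, g l y = gp l y} by apply: filterS ae_g => l.
split.
- apply/integrableP; split; first exact/measurable_EFinP.
  rewrite (_ : (\int[P]_w _)%E = (\int[mu]_l (1 * joint_density y l)%:E)%E); last first.
    rewrite -(integral_local_times_comp y (measurable_cst (1 : R)))//.
    apply: ae_eq_integral => //.
    + by apply: measurableT_comp => //; exact/measurable_EFinP.
    + by apply/measurable_EFinP; exact: measurable_funM.
    by apply: filterS (loc_timeE hb hlam) => w hw _ /=; rewrite mul1r ger0_norm// (hw y).2.
  by under eq_integral do rewrite mul1r; exact: integral_q_fin.
- apply/integrableP; split; first exact/measurable_EFinP.
  rewrite (_ : (\int[_]_l _)%E = (\int[distribution P L]_l (gp l y)%:E)%E); last first.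
    apply: ae_eq_integral => //; first by apply: measurableT_comp => //; exact/measurable_EFinP.
    by apply: filterS aeg => l hl _ /=; rewrite hl ger0_norm.
  rewrite integral_dist//; last by move=> l; rewrite lee_fin.
  by under eq_integral do rewrite -EFinM gp_rayleigh; exact: integral_q_fin.
- move=> B mB; rewrite (integral_local_times hb hlam y mB).
  transitivity (\int[distribution P L]_(l in B) (gp l y)%:E)%E.
    rewrite integral_dist_in//; last by move=> l; rewrite lee_fin.
    by apply: eq_integral => l _; rewrite -EFinM gp_rayleigh.
  apply: ae_eq_integral => //; try by apply: measurable_funTS => //; exact/measurable_EFinP.
  by apply: filterS aeg => l hl _; rewrite hl.
Qed.

(** The factor [l] of the joint density cancels the division by the local time at [0]; what remains
    is the derivative of a Gaussian. At [l = 0], where the inverse is [0] by convention, the density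
    vanishes. *)
Lemma expectation_local_time_ratio y :
  'E_P[fun w => lam 1 y w / lam 1 0 w] = (expR (- (2 * y ^+ 2)))%:E.
Proof.
rewrite unlock.
(* The absolute value gives a weight which is non-negative for every [l]; it changes nothing almost
   surely. *)
have mh : measurable_fun setT (fun l : R => `|l^-1|).
  by apply: measurableT_comp => //; exact: measurable_invr.
have c0 : 0 <= 2 * `|y| by rewrite mulr_ge0.
transitivity (\int[P]_w (`|(L w)^-1| * lam 1 y w)%:E)%E.
  have mi : measurable_fun setT (fun w => (L w)^-1) by exact: (measurableT_comp measurable_invr).
  apply: ae_eq_integral => //.
  - by apply/measurable_EFinP; exact: measurable_funM.
  - by apply/measurable_EFinP; apply: measurable_funM => //; exact: measurableT_comp.
  apply: filterS (loc_timeE hb hlam) => w hw _.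
  by rewrite ger0_norm ?invr_ge0 ?(hw 0).2//= mulrC.
rewrite (integral_local_times_comp y mh)//.
rewrite (_ : 2 * y ^+ 2 = (2 * `|y|) ^+ 2 / 2); last by rewrite exprMn real_normK ?num_real//; field.
rewrite -mulNr -(integral_heat1_tail c0) -integral_itv_obnd_cbnd; last first.
  apply: measurable_funTS; apply/measurable_EFinP; apply: measurable_funM; first exact: measurable_funD.
  apply: measurableT_comp => //; apply: measurable_funM => //.
  by apply: measurableT_comp => //; apply: measurable_funX; exact: measurable_funD.
rewrite [RHS]integral_mkcond; apply: eq_integral => l _; rewrite patchE.
rewrite (_ : (l \in _) = (0 < l)); last by rewrite mem_setE/= in_itv/= andbT.
case: ifPn => [l0|]; last by rewrite -leNgt => l0; rewrite joint_density_neg// mulr0.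
by rewrite /joint_density max_r ?(ltW l0)// gtr0_norm ?invr_gt0// !mulrA mulVf ?mul1r// gt_eqF.
Qed.

Lemma expectation_local_time y : ('E_P[lam 1 y] = \int[mu]_l (joint_density y l)%:E)%E.
Proof.
by rewrite unlock -(integral_local_times hb hlam y measurableT) preimage_setT.
Qed.

(** This is the moment of order [0] in the power of [lam 1 0]: there [iheat 1] is a Gaussian tail
    starting at [2|y|]. *)
Lemma expectation_local_time_tail y :
  ('E_P[lam 1 y] = \int[mu]_(z in `[(2 * `|y|)%R, +oo[) (expR (- z ^+ 2 / 2))%:E)%E.
Proof.
have mE : measurable_fun setT (fun s : R => (expR (- s ^+ 2 / 2))%:E).
  apply/measurable_EFinP; apply: measurableT_comp => //; apply: measurable_funM => //.
  by apply: measurableT_comp => //; exact: exprn_measurable.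
rewrite expectation_local_time ge0_integral_itvcy_shift//.
transitivity (\int[mu]_l (l ^+ 0 * joint_density y l)%:E)%E.
  by apply: eq_integral => l _; rewrite mul1r.
rewrite integral_joint_density mulr1 iheatS -ge0_integralZl_EFin//; first last.
- by rewrite ltW// kappa_gt0.
- by apply: measurable_funTS; apply: measurable_iheat => //; exact: measurable_funD.
- by move=> l _; exact: iheat_ge0.
by apply: eq_integral => l _; rewrite iheat0 -EFinM kappa_heat1 addrC.
Qed.

Section uniform_time.
Variable U : {RV P >-> R}.
Hypothesis hU01 : forall w, U w \in `[0, 1].
Hypothesis hU : has_density P U (fun x => (uniform_pdf 0 1 x)%:E).
Hypothesis hUb : independent P (sigma_rv U) (sigma_process `[0, 1] b).

Lemma uniform_time_cond_density : has_cond_density (fun w => b (U w) w) L g.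
Proof.
split; first exact: (measurable_uniform_time_value hb hU01).
- exact: measurable_cond_density.
- by apply: filterS ae_g => l hl y; rewrite hl.
move=> A B mA mB; rewrite (uniform_time_joint hb hlam hU01 hU hUb mA mB).
apply: (eq_trans (tonelli_domains mu mu (f := fun y l => (joint_density y l)%:E) mq q0 mA mB)).
have mgpE : measurable_fun setT (fun p : R * measurableTypeR R => (gp p.1 p.2)%:E) by exact/measurable_EFinP.
have gpE0 l y : (0 <= (gp l y)%:E)%E by rewrite lee_fin.
have mIgp : measurable_fun setT (fun l => \int[mu]_(y in A) (gp l y)%:E)%E.
  exact: (measurable_integral_right mu mgpE gpE0 mA).
transitivity (\int[distribution P L]_(l in B) \int[mu]_(y in A) (gp l y)%:E)%E.
  rewrite integral_dist_in//; last by move=> l; apply: integral_ge0.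
  apply: eq_integral => l _; rewrite -ge0_integralZr//; first last.
  - by rewrite lee_fin rayleigh_pdf_ge0.
  - by apply: measurable_funTS; exact: (measurableT_comp mgpE (pair1_measurable l)).
  by apply: eq_integral => y _; rewrite -EFinM gp_rayleigh.
apply: ae_eq_integral => //.
- exact: measurable_funTS.
- by apply: measurable_funTS; exact: (measurable_integral_real mA measurable_cond_density).
by apply: filterS ae_g => l hl _; apply: eq_integral => y _; rewrite hl.
Qed.

Lemma uniform_time_density : has_density P (fun w => b (U w) w) (fun y => 'E_P[lam 1 y]).
Proof.
have eE : (fun y => 'E_P[lam 1 y]) = (fun y => \int[mu]_l (joint_density y l)%:E)%E.
  by apply/funext => y; exact: expectation_local_time.
rewrite eE; split.
- exact: (measurable_uniform_time_value hb hU01).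
- exact: (measurable_integral_right mu mq q0 measurableT).
- by move=> y; apply: integral_ge0.
move=> A mA; have := uniform_time_joint hb hlam hU01 hU hUb mA measurableT.
by rewrite preimage_setT setIT.
Qed.

End uniform_time.
End bridge_results.

Theorem corollary3p1 (R : realType) (d : measure_display)
    (T : measurableType d) (P : probability T R)
    (b : R -> {RV P >-> R}) (lam : R -> R -> {RV P >-> R}) (U : {RV P >-> R})
    (hb : brownian_bridge b)
    (hlam : local_times b lam)
    (hU01 : forall w, U w \in `[0, 1])
    (hU : has_density P U (fun x => (uniform_pdf 0 1 x)%:E))
    (hUb : independent P (sigma_rv U) (sigma_process `[0, 1] b)) :
  (* (1) *)
  (has_density P (lam 1 0) (fun l => (rayleigh_pdf l)%:E) /\
   forall (d' : measure_display) (T' : measurableType d')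
     (P' : probability T' R) (E : {RV P' >-> R}),
     has_density P' E (fun x => (exponential_pdf 1 x)%:E) ->
     same_law P (lam 1 0) P' (fun w => Num.sqrt (2 * E w))) /\
  (* (2) *)
  (let g (l y : R) :=
     (2 * `|y| + l) * expR (- (2 * y ^+ 2 + 2 * `|y| * l)) in
   [/\ has_cond_density (fun w => b (U w) w) (lam 1 0) g,
       (forall y, is_cond_expectation (lam 1 y) (lam 1 0) (fun l => g l y)) &
       forall y,
         'E_P[fun w => lam 1 y w / lam 1 0 w] = (expR (- (2 * y ^+ 2)))%:E]) /\
  (* (3) *)
  [/\ has_density P (fun w => b (U w) w) (fun y => 'E_P[lam 1 y]),
      (forall y,
         'E_P[lam 1 y] =
         (\int[lebesgue_measure]_(z in `[(2 * `|y|)%R, +oo[)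
            (expR (- (z ^+ 2) / 2))%:E)%E) &
      forall (d' : measure_display) (T' : measurableType d')
        (P' : probability T' R) (E V : {RV P' >-> R}),
        has_density P' E (fun x => (exponential_pdf 1 x)%:E) ->
        has_density P' V (fun x => (uniform_pdf (-1) 1 x)%:E) ->
        independent P' (sigma_rv E) (sigma_rv V) ->
        same_law P (fun w => b (U w) w)
                 P' (fun w => Num.sqrt (2 * E w) * (V w / 2))].
Proof.
have hL := local_time_rayleigh hb hlam.
split; [split => // d' T' P' E hE; exact: same_law_sqrt_exponential|split].
  split.
  - exact: (uniform_time_cond_density hb hlam hU01 hU hUb).
  - exact: (local_time_cond_expectation hb hlam).
  - exact: (expectation_local_time_ratio hb hlam).
have hbU := uniform_time_density hb hlam hU01 hU hUb.
split => //; first exact: (expectation_local_time_tail hb hlam).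
move=> d' T' P' E V hE hV EV.
have [_ mS hS] := same_law_sqrt_exponential hL hE.
have hSR (A : set R) : measurable A -> P' ((fun w => Num.sqrt (2 * E w)) @^-1` A) =
    (\int[@lebesgue_measure R]_(s in A) (rayleigh_pdf s)%:E)%E.
  by move=> mA; rewrite -hS//; case: hL => _ _ _; apply.
(* The square root is a function of [E], so its events belong to the sigma-algebra of [E] and
   inherit the independence from [V]. *)
have SV (A B : set R) : measurable A -> measurable B ->
    P' ((fun w => Num.sqrt (2 * E w)) @^-1` A `&` V @^-1` B) =
    (P' ((fun w => Num.sqrt (2 * E w)) @^-1` A) * P' (V @^-1` B))%E.
  move=> mA mB; apply: EV; last by exists B => //; rewrite setTI.
  exists ((fun x : R => Num.sqrt (2 * x)) @^-1` A); last by rewrite setTI.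
  have m2 : measurable_fun setT (fun x : R => Num.sqrt (2 * x)).
    by apply: (measurableT_comp measurable_sqrtr); exact: measurable_funM.
  by rewrite -[X in measurable X]setTI; exact: m2.
case: hbU => mbU _ _ hbU; split => //.
  exact: (measurable_funM mS (measurable_funM (measurable_funP V) (measurable_cst _))).
move=> A mA; rewrite hbU// (rayleigh_uniform_product_law mS hSR hV SV mA).
by apply: eq_integral => y _; exact: (expectation_local_time_tail hb hlam).
Qed.
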